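(* Let $\mathcal C$ be one of: (1) the class of groups satisfying some generic almost positive sentence; (2) the class of groups with non-trivial positive theory; (3) the class of groups satisfying a non-trivial law. Then $\mathcal C$ is closed under extensions: if $K\trianglelefteq E$ with $K\in\mathcal C$ and $E/K\in\mathcal C$, then $E\in\mathcal C$.
   Context: Formulas are in the language of groups without constants; positive means without negations; a diophantine condition is $\exists v\,\Pi(v,w)=1$ with $\Pi$ a finite system of equations. Formal solution relative to a diophantine condition: for $\psi(w)\equiv\forall x^1\exists y^1\cdots\forall x^m\exists y^m\,\bigvee_{j=1}^k\Sigma_j(w,x^1,y^1,\dots,x^m,y^m)=1$ and $\exists v\,\Pi(v,w)=1$, it is a tuple $\alpha=(\alpha^1,\dots,\alpha^m)$, $\alpha^l\in F(v,w,x^1,\dots,x^l)^{|y^l|}$, such that for some $j$ all words of $\Sigma_j(w,x^1,\alpha^1,\dots,x^m,\alpha^m)$ lie in the normal closure of $\Pi(v,w)$ in $F(v,w)*F(x^1,\dots,x^m)$. An almost positive sentence is $\exists z\,(\Theta(z)\ne1\wedge\psi(z))$ with $\psi$ positive and $\Theta(z)\neq1$ a non-trivial system of inequalities; it is generic if for every formal solution of $\psi(z)$ relative to any diophantine condition $\exists w\,\Pi(w,z)=1$ some word of $\Theta(z)$ lies in the normal closure of $\Pi(w,z)$ in $F(w,z)$. A group has non-trivial positive theory if it satisfies a positive sentence not satisfied by a non-abelian free group. A non-trivial law is a non-trivial word $w(x)$ of a free group such that $\forall x\,w(x)=1$ holds in the group. *)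

(* Defs.v *)
From Stdlib Require Import List Relations Arith.
Import ListNotations.
Set Implicit Arguments.

Record group := Group {
  gcar :> Type;
  gmul : gcar -> gcar -> gcar;
  ginv : gcar -> gcar;
  gone : gcar;
  gmulA : forall x y z, gmul x (gmul y z) = gmul (gmul x y) z;
  gmul1l : forall x, gmul gone x = x;
  gmulVl : forall x, gmul (ginv x) x = gone }.

Arguments gmul {g} _ _.
Arguments ginv {g} _.
Arguments gone {g}.

Definition is_hom {G H : group} (f : G -> H) : Prop :=
  forall x y : G, f (gmul x y) = gmul (f x) (f y).

Definition short_exact {K E Q : group} (i : K -> E) (p : E -> Q) : Prop :=
  is_hom i /\ is_hom p /\
  (forall k1 k2, i k1 = i k2 -> k1 = k2) /\
  (forall q, exists e, p e = q) /\
  (forall e, p e = gone <-> exists k, i k = e).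

Definition closed_under_extensions (C : group -> Prop) : Prop :=
  forall (K E Q : group) (i : K -> E) (p : E -> Q),
    short_exact i p -> C K -> C Q -> C E.

(* a letter (a, false) is a, (a, true) is a^-1 *)
Definition word (X : Type) := list (X * bool).

Definition winv {X} (w : word X) : word X :=
  rev (map (fun c => (fst c, negb (snd c))) w).

Fixpoint eval {X} {G : group} (a : X -> G) (w : word X) : G :=
  match w with
  | [] => gone
  | (x, b) :: w' => gmul (if b then ginv (a x) else a x) (eval a w')
  end.

Definition letters_in {X} (A : X -> Prop) (w : word X) : Prop :=
  Forall (fun c => A (fst c)) w.

Inductive fstep {X} : word X -> word X -> Prop :=
| fstep_intro : forall (u v : word X) (a : X) (b : bool),
    fstep (u ++ (a, b) :: (a, negb b) :: v) (u ++ v).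

Definition freq {X} : word X -> word X -> Prop := clos_refl_sym_trans _ (@fstep X).

Definition free_trivial {X} (w : word X) : Prop := freq w [].

(* w lies in the normal closure of S in the free group F(A) (A a set of
   letters): w is equal in the free group to a product of conjugates
   u s^{+-1} u^{-1} with s in S and u a word in the letters of A. *)
Definition in_ncl {X} (A : X -> Prop) (S : list (word X)) (w : word X) : Prop :=
  exists l : list (word X * word X * bool),
    Forall (fun t : word X * word X * bool => letters_in A (fst (fst t)) /\ In (snd (fst t)) S) l /\
    freq w (concat (map (fun t : word X * word X * bool =>
       fst (fst t) ++ (if snd t then winv (snd (fst t)) else snd (fst t))
                   ++ winv (fst (fst t))) l)).

Inductive pform :=
| PEq  : word nat -> pform
| PAnd : pform -> pform -> pform
| POr  : pform -> pform -> pform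
| PAll : nat -> pform -> pform
| PEx  : nat -> pform -> pform.

Definition upd {T : Type} (a : nat -> T) (n : nat) (g : T) : nat -> T :=
  fun k => if Nat.eqb k n then g else a k.

Fixpoint psat {G : group} (a : nat -> G) (p : pform) : Prop :=
  match p with
  | PEq w => eval a w = gone
  | PAnd p q => psat a p /\ psat a q
  | POr p q => psat a p \/ psat a q
  | PAll n p => forall g : G, psat (upd a n g) p
  | PEx n p => exists g : G, psat (upd a n g) p
  end.

Fixpoint pbound (B : nat -> Prop) (p : pform) : Prop :=
  match p with
  | PEq w => letters_in B w
  | PAnd p q | POr p q => pbound B p /\ pbound B q
  | PAll n p | PEx n p => pbound (fun k => k = n \/ B k) p
  end.

Definition psentence (p : pform) : Prop := pbound (fun _ => False) p.

Definition sat_sentence (G : group) (p : pform) : Prop :=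
  psat (fun _ => (gone : G)) p.

Definition free_on (F : group) {X : Type} (b : X -> F) : Prop :=
  forall (H : group) (f : X -> H),
    exists phi : F -> H, is_hom phi /\ (forall x, phi (b x) = f x) /\
      forall psi : F -> H, is_hom psi -> (forall x, psi (b x) = f x) ->
        forall g, psi g = phi g.

Definition nonabelian_free (F : group) : Prop :=
  (exists (X : Type) (b : X -> F), free_on F b) /\
  (exists g h : F, gmul g h <> gmul h g).

Definition nontrivial_positive_theory (G : group) : Prop :=
  exists p : pform, psentence p /\ sat_sentence G p /\
    forall F : group, nonabelian_free F -> ~ sat_sentence F p.

Definition satisfies_nontrivial_law (G : group) : Prop :=
  exists w : word nat, ~ free_trivial w /\ forall a : nat -> G, eval a w = gone.

(* Variables: z_i (free parameters), x^l_i, y^l_i (levels l = 0..m-1),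
   v_i (variables of a diophantine condition). *)
Inductive nvar :=
| VZ : nat -> nvar
| VX : nat -> nat -> nvar
| VY : nat -> nat -> nvar
| VV : nat -> nvar.

(* psi(z) = forall x^0 exists y^0 ... forall x^(m-1) exists y^(m-1),
            \/_{Sigma in nf_sys} Sigma = 1 *)
Record nfform := NFForm { nf_m : nat; nf_sys : list (list (word nvar)) }.

Definition psi_letter (m : nat) (v : nvar) : Prop :=
  match v with
  | VZ _ => True
  | VX l _ | VY l _ => l < m
  | VV _ => False
  end.

Definition nf_wf (psi : nfform) : Prop :=
  Forall (Forall (letters_in (psi_letter (nf_m psi)))) (nf_sys psi).

Definition nenv {G : group} (z : nat -> G) (xs ys : nat -> nat -> G) (v : nvar) : G :=
  match v with
  | VZ i => z i
  | VX l i => xs l i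
  | VY l i => ys l i
  | VV _ => gone
  end.

Fixpoint qsat {G : group} (sys : list (list (word nvar))) (z : nat -> G)
         (k l : nat) (xs ys : nat -> nat -> G) : Prop :=
  match k with
  | O => Exists (Forall (fun w => eval (nenv z xs ys) w = gone)) sys
  | S k' => forall f : nat -> G, exists g : nat -> G,
              qsat sys z k' (S l) (upd xs l f) (upd ys l g)
  end.

Definition nf_sat (G : group) (psi : nfform) (z : nat -> G) : Prop :=
  qsat (nf_sys psi) z (nf_m psi) 0 (fun _ _ => gone) (fun _ _ => gone).

(* almost positive sentence  exists z (Theta(z) <> 1 /\ psi(z)) *)
Record apsentence := APS { ap_theta : list (word nat); ap_psi : nfform }.

Definition zword (w : word nat) : word nvar := map (fun c => (VZ (fst c), snd c)) w.

Definition ap_wf (phi : apsentence) : Prop :=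
  nf_wf (ap_psi phi) /\ ap_theta phi <> [] /\
  Forall (fun th => ~ free_trivial th) (ap_theta phi).

Definition ap_sat (G : group) (phi : apsentence) : Prop :=
  exists z : nat -> G,
    Forall (fun th => eval z th <> gone) (ap_theta phi) /\ nf_sat G (ap_psi phi) z.

Definition dioph_letter (v : nvar) : Prop :=
  match v with VV _ | VZ _ => True | _ => False end.

Definition alpha_letter (l : nat) (v : nvar) : Prop :=
  match v with VV _ | VZ _ => True | VX l' _ => l' <= l | VY _ _ => False end.

Definition nox_letter (m : nat) (v : nvar) : Prop :=
  match v with VV _ | VZ _ => True | VX l _ => l < m | VY _ _ => False end.

Definition subst_y (alpha : nat -> nat -> word nvar) (w : word nvar) : word nvar :=
  concat (map (fun c : nvar * bool => match fst c with
                        | VY l i => if snd c then winv (alpha l i) else alpha l i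
                        | _ => [c]
                        end) w).

Definition formal_solution (psi : nfform) (Pi : list (word nvar))
           (alpha : nat -> nat -> word nvar) : Prop :=
  (forall l i, l < nf_m psi -> letters_in (alpha_letter l) (alpha l i)) /\
  Exists (Forall (fun w => in_ncl (nox_letter (nf_m psi)) Pi (subst_y alpha w)))
         (nf_sys psi).

Definition generic (phi : apsentence) : Prop :=
  ap_wf phi /\
  forall (Pi : list (word nvar)) (alpha : nat -> nat -> word nvar),
    Forall (letters_in dioph_letter) Pi ->
    formal_solution (ap_psi phi) Pi alpha ->
    Exists (fun th => in_ncl dioph_letter Pi (zword th)) (ap_theta phi).

Definition satisfies_generic_aps (G : group) : Prop :=
  exists phi : apsentence, generic phi /\ ap_sat G phi.

(* Main.v *)
(** Let sentences [psi1] and [psi2] witness the property for [K] and [Q = E/K].  In [psi1] replace every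
    "for all x" by a run of the game [psi2], followed by "for all z_1, ..., z_r", with x := the product of
    the z_q U z_q^-1, where the word U is trivial as soon as the system of [psi2] holds.  In [E] the value of U
    lies in [K], so [E] satisfies the new sentence.  Conversely let it hold in H = C * Z, where C collects
    the coefficients.  If [psi2] fails in H, the universal player can force U <> 1, so that
    x runs through all products of conjugates of some w <> 1.  Choosing the z_q as powers of the generator b
    of Z gives x many syllables b^k with pairwise different large k.  Mapping syllables by an arbitrary odd
    function on the exponents (Rolli's quasi-homomorphisms) violates each multiplication for at most
    one pair of exponents, so when r exceeds the length of the system, every x contains a marker b^k
    on which nothing depends.  Sending these markers to suitable elements turns each x into a free
    generator: this is Merzlyakov's theorem, and yields a formal solution of [psi1].  If [psi2] holds in H,
    the same argument yields a formal solution of [psi2].  A law is the case of universal sentences. *)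
Require Import Defs.
From Stdlib Require Import List Relations Arith Lia ZArith Cantor.
From Stdlib Require Import Classical ClassicalEpsilon FunctionalExtensionality PropExtensionality ProofIrrelevance.
Import ListNotations.
Set Implicit Arguments.
Unset Strict Implicit.

(** A formal solution amounts to a solution at generic x in the group [M] presented by the
    diophantine condition, where y of level l is a word without later x; this makes the syntactic
    notion accessible to homomorphisms. The coefficient group C has two jobs: it must contain [M],
    so that a formal solution of the combined sentence can be evaluated in C * Z, and it must have
    at least three elements, so that every non-trivial element has a conjugate that begins and ends
    with a non-trivial element of C. Hence C is M x Z for generic sentences. For laws and positive
    theories the condition is empty, and C = Z with the trivial map to [M] suffices. The map from C
    to [M] must erase the x-letters, since a coefficient can occur at every level. The obstacle is
    timing: which exponents merge depends on the answers y, and is known only after the whole play.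
    Therefore every x carries r candidate markers, each level uses exponents beyond everything seen
    before, and the choice among the candidates comes last. *)

Section GroupBasics.
Variable G : group.
Implicit Types x y z : G.

Lemma gmul_idem x : gmul x x = x -> x = gone.
Proof.
  intros H. rewrite <- (gmulVl G x) at 1. rewrite <- H at 3.
  rewrite gmulA, gmulVl, gmul1l. reflexivity.
Qed.

Lemma gmulVr x : gmul x (ginv x) = gone.
Proof.
  apply gmul_idem.
  rewrite <- (gmulA G x), (gmulA G (ginv x)), gmulVl, gmul1l. reflexivity.
Qed.

Lemma gmul1r x : gmul x gone = x.
Proof. rewrite <- (gmulVl G x), gmulA, gmulVr. apply gmul1l. Qed.

Lemma gassoc x y z : gmul (gmul x y) z = gmul x (gmul y z).
Proof. symmetry; apply gmulA. Qed.

Lemma gmulKl x y : gmul (ginv x) (gmul x y) = y.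
Proof. rewrite gmulA, gmulVl. apply gmul1l. Qed.

Lemma gmulKr x y : gmul x (gmul (ginv x) y) = y.
Proof. rewrite gmulA, gmulVr. apply gmul1l. Qed.

Lemma gcancel x y z : gmul x y = gmul x z -> y = z.
Proof. intros H. rewrite <- (gmulKl x y), H. apply gmulKl. Qed.

Lemma gcancel_r x y z : gmul y x = gmul z x -> y = z.
Proof.
  intros H. rewrite <- (gmul1r y), <- (gmul1r z), <- (gmulVr x), !gmulA, H.
  reflexivity.
Qed.

Lemma ginv_unique x y : gmul x y = gone -> y = ginv x.
Proof. intros H. apply (@gcancel x). rewrite H, gmulVr. reflexivity. Qed.

Lemma ginvK x : ginv (ginv x) = x.
Proof. symmetry. apply ginv_unique, gmulVl. Qed.

Lemma ginv1 : ginv (gone : G) = gone.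
Proof. symmetry. apply ginv_unique, gmul1l. Qed.

Lemma ginvM x y : ginv (gmul x y) = gmul (ginv y) (ginv x).
Proof. symmetry. apply ginv_unique. rewrite gassoc, gmulKr. apply gmulVr. Qed.
End GroupBasics.

Ltac gsimp :=
  repeat first [ rewrite gassoc | rewrite gmul1l | rewrite gmul1r | rewrite gmulVl
               | rewrite gmulVr | rewrite gmulKl | rewrite gmulKr | rewrite ginvM
               | rewrite ginvK | rewrite ginv1 ].

Lemma hom_one (G H : group) (f : G -> H) : is_hom f -> f gone = gone.
Proof. intros Hf. apply gmul_idem. rewrite <- Hf, gmul1l. reflexivity. Qed.

Lemma hom_inv (G H : group) (f : G -> H) (x : G) :
  is_hom f -> f (ginv x) = ginv (f x).
Proof.
  intros Hf. apply ginv_unique. rewrite <- Hf, gmulVr. apply hom_one; exact Hf.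
Qed.

(** * Words, evaluation and free equality *)

Section Words.
Variable X : Type.
Implicit Types u v w : word X.

Lemma winv_app u v : winv (u ++ v) = winv v ++ winv u.
Proof. unfold winv. rewrite map_app. apply rev_app_distr. Qed.

Lemma winvK w : winv (winv w) = w.
Proof.
  unfold winv. rewrite map_rev, rev_involutive, map_map.
  rewrite <- map_id. apply map_ext. intros [x b]; simpl.
  now rewrite Bool.negb_involutive.
Qed.

Lemma letters_in_app (A : X -> Prop) u v :
  letters_in A (u ++ v) <-> letters_in A u /\ letters_in A v.
Proof. apply Forall_app. Qed.

Lemma letters_in_winv (A : X -> Prop) w : letters_in A w -> letters_in A (winv w).
Proof.
  intros H. apply Forall_rev. apply Forall_map. exact H.
Qed.

Lemma letters_in_impl (A B : X -> Prop) w :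
  (forall x, A x -> B x) -> letters_in A w -> letters_in B w.
Proof. intros H. apply Forall_impl. intros c; apply H. Qed.

Lemma eval_app (G : group) (a : X -> G) u v :
  eval a (u ++ v) = gmul (eval a u) (eval a v).
Proof.
  induction u as [|[x b] u IH]; simpl; [now gsimp|]. rewrite IH. now gsimp.
Qed.

Lemma eval_winv (G : group) (a : X -> G) w : eval a (winv w) = ginv (eval a w).
Proof.
  induction w as [|[x b] w IH]; [now gsimp|].
  change ((x, b) :: w) with ([(x, b)] ++ w).
  rewrite winv_app, !eval_app, IH. destruct b; simpl; now gsimp.
Qed.

Lemma eval_ext (G : group) (A : X -> Prop) (a a' : X -> G) w :
  letters_in A w -> (forall x, A x -> a x = a' x) -> eval a w = eval a' w.
Proof.
  intros Hw H. induction Hw as [|[x b] w Hx Hw IH]; simpl; [reflexivity|].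
  simpl in Hx. now rewrite IH, H.
Qed.

Lemma eval_eq (G : group) (a a' : X -> G) w :
  (forall x, a x = a' x) -> eval a w = eval a' w.
Proof.
  intros H. f_equal. now apply functional_extensionality.
Qed.

Lemma eval_hom (G H : group) (f : G -> H) (a : X -> G) w :
  is_hom f -> f (eval a w) = eval (fun x => f (a x)) w.
Proof.
  intros Hf. induction w as [|[x b] w IH]; simpl; [now apply hom_one|].
  rewrite Hf, IH. destruct b; [now rewrite hom_inv|reflexivity].
Qed.

Lemma freq_refl w : freq w w.
Proof. apply rst_refl. Qed.

Lemma freq_sym u v : freq u v -> freq v u.
Proof. apply rst_sym. Qed.

Lemma freq_trans u v w : freq u v -> freq v w -> freq u w.
Proof. apply rst_trans. Qed.

Lemma freq_app u u' v v' : freq u u' -> freq v v' -> freq (u ++ v) (u' ++ v').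
Proof.
  intros Hu Hv. apply freq_trans with (u' ++ v).
  - induction Hu as [u u' H|u|u u' H IH|u u' u'' H1 IH1 H2 IH2].
    + apply rst_step. destruct H as [p q a b]. rewrite <- !app_assoc. simpl.
      apply (fstep_intro p (q ++ v)).
    + apply freq_refl.
    + now apply freq_sym.
    + eapply freq_trans; eauto.
  - induction Hv as [v v' H|v|v v' H IH|v v' v'' H1 IH1 H2 IH2].
    + apply rst_step. destruct H as [p q a b]. rewrite !app_assoc.
      apply fstep_intro.
    + apply freq_refl.
    + now apply freq_sym.
    + eapply freq_trans; eauto.
Qed.

Lemma freq_winv_r w : freq (w ++ winv w) [].
Proof.
  induction w as [|[x b] w IH]; [apply freq_refl|].
  change ((x, b) :: w) with ([(x, b)] ++ w). rewrite winv_app, <- app_assoc.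
  apply freq_trans with ([(x, b)] ++ [] ++ winv [(x, b)]).
  - apply freq_app; [apply freq_refl|]. rewrite app_assoc.
    apply freq_app; [exact IH|apply freq_refl].
  - apply rst_step. apply (fstep_intro [] []).
Qed.

Lemma freq_winv_l w : freq (winv w ++ w) [].
Proof. rewrite <- (winvK w) at 2. apply freq_winv_r. Qed.

Lemma freq_cancel_mid u w v : freq (u ++ winv w ++ w ++ v) (u ++ v).
Proof.
  apply freq_app; [apply freq_refl|]. rewrite app_assoc.
  apply (freq_app (freq_winv_l w) (freq_refl v)).
Qed.

Lemma eval_freq (G : group) (a : X -> G) u v : freq u v -> eval a u = eval a v.
Proof.
  induction 1 as [u v H|u|u v H IH|u v w H1 IH1 H2 IH2]; try congruence.
  destruct H as [p q x b]. rewrite !eval_app. simpl. destruct b; simpl; now gsimp.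
Qed.
End Words.

(** * Normal closures *)

Section NormalClosure.
Variables (X : Type) (A : X -> Prop) (S : list (word X)).

Lemma ncl_freq u v : in_ncl A S u -> freq u v -> in_ncl A S v.
Proof.
  intros (l & Hl & Hu) H. exists l. split; [exact Hl|].
  eapply freq_trans; [apply freq_sym, H|exact Hu].
Qed.

Lemma ncl_nil : in_ncl A S [].
Proof. exists []. split; [constructor|apply freq_refl]. Qed.

Lemma ncl_app u v : in_ncl A S u -> in_ncl A S v -> in_ncl A S (u ++ v).
Proof.
  intros (l & Hl & Hu) (l' & Hl' & Hv). exists (l ++ l'). split.
  - now apply Forall_app.
  - rewrite map_app, concat_app. now apply freq_app.
Qed.

Lemma ncl_rel s : In s S -> in_ncl A S s.
Proof.
  intros H. exists [([], s, false)]. split.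
  - repeat constructor; exact H.
  - simpl. rewrite !app_nil_r. apply freq_refl.
Qed.

Lemma ncl_conj u w : letters_in A u -> in_ncl A S w -> in_ncl A S (u ++ w ++ winv u).
Proof.
  intros Hu (l & Hl & Hw).
  exists (map (fun t => (u ++ fst (fst t), snd (fst t), snd t)) l). split.
  - apply Forall_map. eapply Forall_impl; [|exact Hl].
    intros [[p s] b]; simpl. rewrite letters_in_app. tauto.
  - eapply freq_trans.
    { apply freq_app; [apply freq_refl|].
      apply freq_app; [exact Hw|apply freq_refl]. }
    clear Hl Hw w. induction l as [|[[p s] b] l IH]; simpl.
    + apply freq_winv_r.
    + set (s' := if b then winv s else s).
      set (r := concat _) in *. set (r' := concat _) in *.
      rewrite winv_app, <- !app_assoc.
      apply freq_trans with ((u ++ p ++ s' ++ winv p) ++ winv u ++ u ++ r ++ winv u).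
      * rewrite <- !app_assoc.
        do 4 (apply freq_app; [apply freq_refl|]).
        apply freq_sym, (freq_cancel_mid [] u).
      * rewrite <- !app_assoc. do 5 (apply freq_app; [apply freq_refl|]). exact IH.
Qed.

Lemma freq_winv (u v : word X) : freq u v -> freq (winv u) (winv v).
Proof.
  intros H.
  apply freq_trans with (winv u ++ v ++ winv v).
  { rewrite <- (app_nil_r (winv u)) at 1.
    apply freq_app; [apply freq_refl|apply freq_sym, freq_winv_r]. }
  rewrite app_assoc. apply (@freq_app _ _ [] (winv v) (winv v)); [|apply freq_refl].
  apply freq_trans with (winv u ++ u).
  - apply freq_app; [apply freq_refl|now apply freq_sym].
  - apply freq_winv_l.
Qed.

Lemma ncl_winv w : in_ncl A S w -> in_ncl A S (winv w).
Proof.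
  intros (l & Hl & Hw). apply freq_winv in Hw.
  apply ncl_freq with (2 := freq_sym Hw). clear Hw w.
  induction Hl as [|[[p s] b] l [Hp Hs] Hl IH]; simpl in *.
  - apply ncl_nil.
  - rewrite winv_app. apply ncl_app; [exact IH|].
    rewrite !winv_app, winvK, <- app_assoc. apply ncl_conj; [exact Hp|].
    exists [([], s, negb b)]. split; [repeat constructor; exact Hs|].
    simpl. rewrite !app_nil_r. destruct b; simpl; rewrite ?winvK; apply freq_refl.
Qed.

Lemma ncl_eval (G : group) (a : X -> G) w :
  Forall (fun s => eval a s = gone) S -> in_ncl A S w -> eval a w = gone.
Proof.
  intros HS (l & Hl & Hw). rewrite (eval_freq a Hw). clear Hw.
  rewrite Forall_forall in HS.
  induction Hl as [|[[p s] b] l [Hp Hs] Hl IH]; simpl in *; [reflexivity|].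
  rewrite eval_app, IH, !eval_app, eval_winv.
  destruct b; rewrite ?eval_winv, (HS s Hs); now gsimp.
Qed.
End NormalClosure.

Lemma ncl_empty_trivial (X : Type) (A : X -> Prop) (w : word X) :
  in_ncl A [] w -> free_trivial w.
Proof.
  intros (l & Hl & Hw). destruct Hl as [|t l [Hp Hs] Hl]; [exact Hw|destruct Hs].
Qed.

(** * Substitution of words for letters *)

Definition subst {X Y : Type} (f : X -> word Y) (w : word X) : word Y :=
  concat (map (fun c : X * bool => if snd c then winv (f (fst c)) else f (fst c)) w).

Section Subst.
Variables (X Y : Type) (f : X -> word Y).

Lemma subst_app u v : subst f (u ++ v) = subst f u ++ subst f v.
Proof. unfold subst. now rewrite map_app, concat_app. Qed.

Lemma subst_winv w : subst f (winv w) = winv (subst f w).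
Proof.
  induction w as [|[x b] w IH]; [reflexivity|].
  change ((x, b) :: w) with ([(x, b)] ++ w).
  rewrite winv_app, !subst_app, winv_app, IH. f_equal.
  unfold subst; simpl. rewrite !app_nil_r. destruct b; simpl; now rewrite ?winvK.
Qed.

Lemma eval_subst (G : group) (a : Y -> G) w :
  eval a (subst f w) = eval (fun x => eval a (f x)) w.
Proof.
  induction w as [|[x b] w IH]; [reflexivity|].
  change (subst f ((x, b) :: w)) with ((if b then winv (f x) else f x) ++ subst f w).
  rewrite eval_app, IH. destruct b; simpl; now rewrite ?eval_winv.
Qed.

Lemma freq_subst u v : freq u v -> freq (subst f u) (subst f v).
Proof.
  induction 1 as [u v H|u|u v H IH|u v w H1 IH1 H2 IH2].
  - destruct H as [p q x b]. rewrite !subst_app.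
    apply freq_app; [apply freq_refl|].
    change (subst f ((x, b) :: (x, negb b) :: q)) with
      ((if b then winv (f x) else f x) ++ (if negb b then winv (f x) else f x) ++ subst f q).
    rewrite app_assoc. apply (@freq_app _ _ []); [|apply freq_refl].
    destruct b; [apply freq_winv_l|apply freq_winv_r].
  - apply freq_refl.
  - now apply freq_sym.
  - eapply freq_trans; eauto.
Qed.

Lemma letters_in_subst (A : X -> Prop) (B : Y -> Prop) w :
  letters_in A w -> (forall x, A x -> letters_in B (f x)) -> letters_in B (subst f w).
Proof.
  intros Hw H. induction Hw as [|[x b] w Hx Hw IH]; [constructor|].
  change (subst f ((x, b) :: w)) with ((if b then winv (f x) else f x) ++ subst f w).
  apply letters_in_app. split; [|exact IH].
  destruct b; [apply letters_in_winv|]; apply H, Hx.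
Qed.

Lemma ncl_subst (A : X -> Prop) (B : Y -> Prop) (S : list (word X)) w :
  (forall x, A x -> letters_in B (f x)) ->
  in_ncl A S w -> in_ncl B (map (subst f) S) (subst f w).
Proof.
  intros HA (l & Hl & Hw).
  apply ncl_freq with (2 := freq_sym (freq_subst Hw)). clear Hw.
  induction Hl as [|[[p s] b] l [Hp Hs] Hl IH]; simpl in *; [apply ncl_nil|].
  rewrite !subst_app, subst_winv. apply ncl_app; [|exact IH].
  apply ncl_conj; [now apply letters_in_subst with A|].
  assert (in_ncl B (map (subst f) S) (subst f s)) by now apply ncl_rel, in_map.
  destruct b; [rewrite subst_winv; now apply ncl_winv|assumption].
Qed.
End Subst.

Lemma subst_letters (X : Type) (A : X -> Prop) (f : X -> word X) (w : word X) :
  letters_in A w -> (forall x, A x -> f x = [(x, false)]) -> subst f w = w.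
Proof.
  intros Hw H. induction Hw as [|[x b] w Hx Hw IH]; [reflexivity|].
  change (subst f ((x, b) :: w)) with ((if b then winv (f x) else f x) ++ subst f w).
  simpl in Hx. rewrite IH, H by exact Hx. now destruct b.
Qed.

Lemma subst_subst (X Y Z : Type) (f : X -> word Y) (g : Y -> word Z) (w : word X) :
  subst g (subst f w) = subst (fun x => subst g (f x)) w.
Proof.
  induction w as [|[x b] w IH]; [reflexivity|].
  change (subst f ((x, b) :: w)) with ((if b then winv (f x) else f x) ++ subst f w).
  rewrite subst_app, IH.
  change (subst (fun x => subst g (f x)) ((x, b) :: w)) with
    ((if b then winv (subst g (f x)) else subst g (f x)) ++
     subst (fun x => subst g (f x)) w).
  f_equal. destruct b; [apply subst_winv|reflexivity].
Qed.

(** The retraction that deletes all letters outside [A] fixes [S] and [w] and moves the conjugators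
    into [A]. Presented groups can therefore use all letters, although formal solutions restrict the
    conjugators. *)
Lemma ncl_restrict (X : Type) (A B : X -> Prop) (S : list (word X)) w :
  Forall (letters_in A) S -> letters_in A w -> in_ncl B S w -> in_ncl A S w.
Proof.
  intros HS Hw H.
  set (f := fun x => if excluded_middle_informative (A x) then [(x, false)] else []).
  assert (Hf : forall x, A x -> f x = [(x, false)]).
  { intros x Hx. unfold f. now destruct (excluded_middle_informative (A x)). }
  rewrite <- (subst_letters Hw Hf).
  replace S with (map (subst f) S).
  - apply ncl_subst with (2 := H). intros x _. unfold f.
    destruct (excluded_middle_informative (A x)); repeat constructor; assumption.
  - clear -HS Hf. induction HS as [|s S Hs HS IH]; [reflexivity|].
    simpl. now rewrite IH, (subst_letters Hs Hf).
Qed.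

(** * Groups given by a presentation *)

Section Presentation.
Variables (X : Type) (S : list (word X)).
Let N := in_ncl (fun _ : X => True) S.
Let letters_all (w : word X) : letters_in (fun _ => True) w.
Proof. apply Forall_forall. intros; exact I. Qed.

Definition pres_rel (u v : word X) : Prop := N (u ++ winv v).

Lemma pres_rel_refl u : pres_rel u u.
Proof.
  apply ncl_freq with []; [apply ncl_nil|apply freq_sym, freq_winv_r].
Qed.

Lemma pres_rel_sym u v : pres_rel u v -> pres_rel v u.
Proof.
  intros H. apply ncl_winv in H. rewrite winv_app, winvK in H. exact H.
Qed.

Lemma pres_rel_trans u v w : pres_rel u v -> pres_rel v w -> pres_rel u w.
Proof.
  intros H1 H2. apply ncl_freq with (1 := ncl_app H1 H2).
  rewrite <- app_assoc. apply freq_cancel_mid.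
Qed.

Lemma pres_rel_app u u' v v' :
  pres_rel u u' -> pres_rel v v' -> pres_rel (u ++ v) (u' ++ v').
Proof.
  intros H1 H2. unfold pres_rel. rewrite winv_app.
  apply ncl_freq with ((u ++ (v ++ winv v') ++ winv u) ++ (u ++ winv u')).
  - apply ncl_app; [|exact H1]. now apply ncl_conj.
  - rewrite <- !app_assoc. do 3 (apply freq_app; [apply freq_refl|]).
    apply (freq_cancel_mid []).
Qed.

Lemma pres_rel_winv u v : pres_rel u v -> pres_rel (winv u) (winv v).
Proof.
  intros H. apply pres_rel_sym in H.
  apply ncl_freq with (1 := ncl_conj (letters_all (winv u)) H).
  rewrite !winvK, <- !app_assoc. apply freq_app; [apply freq_refl|].
  rewrite <- (app_nil_r v) at 2. apply freq_app; [apply freq_refl|].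
  apply freq_winv_l.
Qed.

(** The quotient is the set of equivalence classes; by extensionality, equivalent words give equal
    elements. *)
Definition pres_car : Type := { P : word X -> Prop | exists w, P = pres_rel w }.

Definition pres_cls (w : word X) : pres_car :=
  exist _ (pres_rel w) (ex_intro _ w eq_refl).

Definition pres_rep (x : pres_car) : word X :=
  proj1_sig (constructive_indefinite_description _ (proj2_sig x)).

Lemma pres_cls_rep x : pres_cls (pres_rep x) = x.
Proof.
  unfold pres_rep. destruct (constructive_indefinite_description _ _) as [w Hw]; simpl.
  destruct x as [P HP]; simpl in *. apply subset_eq_compat. now symmetry.
Qed.

Lemma pres_cls_eq u v : pres_cls u = pres_cls v <-> pres_rel u v.
Proof.
  split.
  - intros H. apply (f_equal (@proj1_sig _ _)) in H. simpl in H.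
    rewrite H. apply pres_rel_refl.
  - intros H. apply subset_eq_compat. apply functional_extensionality. intros w.
    apply propositional_extensionality. split; intros H'.
    + eapply pres_rel_trans; [apply pres_rel_sym, H|exact H'].
    + eapply pres_rel_trans; eauto.
Qed.

Lemma pres_rep_cls w : pres_rel (pres_rep (pres_cls w)) w.
Proof. apply pres_cls_eq, pres_cls_rep. Qed.

Definition pres_mul (x y : pres_car) := pres_cls (pres_rep x ++ pres_rep y).
Definition pres_inv (x : pres_car) := pres_cls (winv (pres_rep x)).

Lemma pres_mul_cls u v : pres_mul (pres_cls u) (pres_cls v) = pres_cls (u ++ v).
Proof. apply pres_cls_eq, pres_rel_app; apply pres_rep_cls. Qed.

Lemma pres_inv_cls u : pres_inv (pres_cls u) = pres_cls (winv u).
Proof. apply pres_cls_eq, pres_rel_winv, pres_rep_cls. Qed.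

Lemma pres_mulA x y z : pres_mul x (pres_mul y z) = pres_mul (pres_mul x y) z.
Proof.
  rewrite <- (pres_cls_rep x), <- (pres_cls_rep y), <- (pres_cls_rep z).
  now rewrite !pres_mul_cls, app_assoc.
Qed.

Lemma pres_mul1l x : pres_mul (pres_cls []) x = x.
Proof. rewrite <- (pres_cls_rep x). apply pres_mul_cls. Qed.

Lemma pres_mulVl x : pres_mul (pres_inv x) x = pres_cls [].
Proof.
  rewrite <- (pres_cls_rep x), pres_inv_cls, pres_mul_cls. apply pres_cls_eq.
  apply ncl_freq with []; [apply ncl_nil|]. simpl. rewrite app_nil_r.
  apply freq_sym, freq_winv_l.
Qed.

Definition presented : group := @Group pres_car pres_mul pres_inv (pres_cls []) pres_mulA pres_mul1l pres_mulVl.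

Definition pgen (x : X) : presented := pres_cls [(x, false)].

Lemma eval_pgen w : eval pgen w = pres_cls w.
Proof.
  induction w as [|[x b] w IH]; [reflexivity|]. simpl. rewrite IH.
  destruct b; simpl; [unfold pgen; rewrite pres_inv_cls|]; apply pres_mul_cls.
Qed.

Lemma eval_pgen_one w : eval pgen w = gone <-> in_ncl (fun _ => True) S w.
Proof.
  rewrite eval_pgen.
  change (@gone presented) with (pres_cls []). rewrite pres_cls_eq.
  unfold pres_rel. simpl. now rewrite app_nil_r.
Qed.

Lemma presented_word (x : presented) : exists w, eval pgen w = x.
Proof. exists (pres_rep x). rewrite eval_pgen. apply pres_cls_rep. Qed.

Lemma presented_lift (G : group) (a : X -> G) :
  Forall (fun s => eval a s = gone) S ->
  exists h : presented -> G, is_hom h /\ forall w, h (eval pgen w) = eval a w.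
Proof.
  intros HS. set (h := fun x : presented => eval a (pres_rep x)).
  assert (Hh : forall w, h (pres_cls w) = eval a w).
  { intros w. pose proof (pres_rep_cls w) as H.
    apply (@ncl_eval _ _ _ _ a _ HS) in H. rewrite eval_app, eval_winv in H.
    apply (@gcancel_r _ (ginv (eval a w))). rewrite gmulVr. exact H. }
  exists h. split.
  - intros x y. rewrite <- (pres_cls_rep x), <- (pres_cls_rep y).
    change (@gmul presented) with pres_mul. rewrite pres_mul_cls, !Hh. apply eval_app.
  - intros w. rewrite eval_pgen. apply Hh.
Qed.
End Presentation.

(** * The free product of a group with the integers *)

Section FreeProduct.
Variable C : group.

(* [(c0, [(n1, c1); ...; (nr, cr)])] stands for c0 b^n1 c1 ... b^nr cr. *)
Definition syl : Type := list (Z * C).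
Definition raw : Type := (C * syl)%type.

(** A trivial coefficient between two powers of b would let them merge, so only the last one may be
    trivial. *)
Fixpoint tred (l : syl) : Prop :=
  match l with
  | [] => True
  | (n, c) :: l' => n <> 0%Z /\ (l' = [] \/ c <> gone) /\ tred l'
  end.

Definition red (g : raw) : Prop := tred (snd g).

Definition cact (c : C) (g : raw) : raw := (gmul c (fst g), snd g).

(** Left multiplication by b^n. When two powers cancel, the coefficient behind them becomes the
    leading one, so one step restores the normal form. *)
Definition bact (n : Z) (g : raw) : raw :=
  if Z.eq_dec n 0 then g
  else if excluded_middle_informative (fst g = gone) then
    match snd g with
    | [] => (gone, [(n, gone)])
    | (m, c) :: l => if Z.eq_dec (n + m) 0 then (c, l) else (gone, (n + m, c)%Z :: l)
    end
  else (gone, (n, fst g) :: snd g).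

Fixpoint tact (l : syl) (h : raw) : raw :=
  match l with
  | [] => h
  | (n, c) :: l' => bact n (cact c (tact l' h))
  end.

Definition rmul (g h : raw) : raw := cact (fst g) (tact (snd g) h).
Definition rone : raw := (gone, []).

Ltac bcase :=
  repeat match goal with
  | |- context [Z.eq_dec ?a ?b] => destruct (Z.eq_dec a b); try lia
  | |- context [excluded_middle_informative ?P] =>
      destruct (excluded_middle_informative P); try tauto; try congruence
  end.

Lemma cact_cact c d g : cact c (cact d g) = cact (gmul c d) g.
Proof. unfold cact; simpl. now rewrite gmulA. Qed.

Lemma cact1 g : cact gone g = g.
Proof. destruct g; unfold cact; simpl. now rewrite gmul1l. Qed.

Lemma bact0 g : bact 0 g = g.
Proof. unfold bact. now bcase. Qed.

Lemma bact_red n g : red g -> red (bact n g).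
Proof.
  destruct g as [d [|[m c] l]]; unfold bact, red; simpl; intros H;
    bcase; simpl; intuition.
Qed.

Lemma bact_ne n d l : n <> 0%Z -> d <> gone -> bact n (d, l) = (gone, (n, d) :: l).
Proof. intros; unfold bact; simpl. now bcase. Qed.

Lemma bact_nil n : n <> 0%Z -> bact n rone = (gone, [(n, gone)]).
Proof. intros; unfold bact; simpl. now bcase. Qed.

Lemma bact_merge n m c l : n <> 0%Z ->
  bact n (gone, (m, c) :: l) =
  if Z.eq_dec (n + m) 0 then (c, l) else (gone, (n + m, c)%Z :: l).
Proof. intros; unfold bact; simpl. now bcase. Qed.

(** Van der Waerden's method: with [cact_cact], both factors act on normal forms, and associativity
    of [rmul] follows from these two actions. *)
Lemma bact_bact n m g : red g -> bact n (bact m g) = bact (n + m) g.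
Proof.
  intros H.
  destruct (Z.eq_dec m 0) as [->|Hm]; [now rewrite bact0, Z.add_0_r|].
  destruct (Z.eq_dec n 0) as [->|Hn]; [now rewrite bact0|].
  destruct g as [d l].
  destruct (classic (d = gone)) as [->|Hd].
  2:{ rewrite bact_ne, bact_merge by assumption. destruct (Z.eq_dec (n + m) 0) as [e|e].
      - now rewrite e, bact0.
      - now rewrite bact_ne. }
  destruct l as [|[k c] l].
  - fold rone. rewrite bact_nil, bact_merge by assumption.
    destruct (Z.eq_dec (n + m) 0) as [e|e].
    + now rewrite e, bact0.
    + now rewrite bact_nil.
  - rewrite (bact_merge _ _ _ Hm). destruct H as (Hk & Hc & Hl); simpl in *.
    assert (Hnm : forall x, (n + m)%Z <> 0%Z -> (n + m + k)%Z = x -> x <> 0%Z ->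
              bact (n + m) (gone, (k, c) :: l) = (gone, (x, c) :: l)).
    { intros x H1 <- H2. rewrite bact_merge by assumption.
      destruct (Z.eq_dec (n + m + k) 0); [lia|reflexivity]. }
    destruct (Z.eq_dec (m + k) 0) as [e|e].
    + assert (E : bact n (c, l) = (gone, (n, c) :: l)).
      { destruct (classic (c = gone)) as [->|Hc1]; [|now apply bact_ne].
        destruct Hc as [->|[]]; [now apply bact_nil|reflexivity]. }
      rewrite E. destruct (Z.eq_dec (n + m) 0) as [e'|e'].
      * rewrite e', bact0. do 2 f_equal. f_equal. lia.
      * symmetry. apply Hnm; lia.
    + rewrite bact_merge by assumption. destruct (Z.eq_dec (n + (m + k)) 0) as [e'|e'].
      * assert (n + m <> 0)%Z by lia. rewrite bact_merge by assumption.
        destruct (Z.eq_dec (n + m + k) 0); [reflexivity|lia].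
      * destruct (Z.eq_dec (n + m) 0) as [e''|e''].
        -- rewrite e'', bact0. do 2 f_equal. f_equal. lia.
        -- symmetry. apply Hnm; lia.
Qed.

Lemma tact_red l h : red h -> red (tact l h).
Proof.
  intros H. induction l as [|[n c] l IH]; simpl; [exact H|]. now apply bact_red.
Qed.

Lemma rmul_red g h : red h -> red (rmul g h).
Proof. apply tact_red. Qed.

Lemma rmul_cact c g h : rmul (cact c g) h = cact c (rmul g h).
Proof. unfold rmul. now rewrite cact_cact. Qed.

Lemma rmul_bact n g h : red g -> red h -> rmul (bact n g) h = bact n (rmul g h).
Proof.
  intros Hg Hh.
  destruct (Z.eq_dec n 0) as [->|Hn]; [now rewrite !bact0|].
  destruct g as [d l]. destruct (classic (d = gone)) as [->|Hd].
  - destruct l as [|[m c] l].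
    + fold rone. rewrite bact_nil by assumption. unfold rmul; simpl.
      now rewrite !cact1.
    + rewrite bact_merge by assumption. unfold rmul; simpl.
      rewrite cact1, bact_bact by now apply tact_red.
      destruct (Z.eq_dec (n + m) 0) as [e|e]; simpl.
      * now rewrite e, bact0.
      * now rewrite cact1.
  - rewrite bact_ne by assumption. unfold rmul; simpl. now rewrite cact1.
Qed.

Ltac redtac := repeat first [exact I | assumption | apply bact_red | apply rmul_red | apply tact_red].

Lemma rmul_assoc g h k : red h -> red k -> rmul g (rmul h k) = rmul (rmul g h) k.
Proof.
  intros Hh Hk. destruct g as [c l].
  change (cact c (tact l (rmul h k)) = rmul (cact c (tact l h)) k).
  rewrite rmul_cact. f_equal. induction l as [|[n d] l IH]; simpl; [reflexivity|].
  rewrite IH, rmul_bact, rmul_cact; auto. now apply tact_red.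
Qed.

Lemma tact_one l : tred l -> tact l rone = (gone, l).
Proof.
  induction l as [|[n c] l IH]; simpl; [reflexivity|]. intros (Hn & Hc & Hl).
  rewrite IH by assumption. unfold cact; simpl. rewrite gmul1r.
  destruct (classic (c = gone)) as [->|Hc1]; [|now apply bact_ne].
  destruct Hc as [->|[]]; [now apply bact_nil|reflexivity].
Qed.

Lemma red_one : red rone.
Proof. exact I. Qed.

(** A product of inverted syllables rather than an explicit normal form: it is reduced because
    [rmul] preserves reducedness. *)
Fixpoint tinv (l : syl) : raw :=
  match l with
  | [] => rone
  | (n, c) :: l' => rmul (rmul (tinv l') (ginv c, [])) (bact (- n) rone)
  end.

Lemma tinv_tact l h : red h -> rmul (tinv l) (tact l h) = h.
Proof.
  intros Hh. induction l as [|[n c] l IH]; simpl; [apply cact1|].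
  assert (Ht := tact_red l Hh). assert (R1 : red (bact (- n) rone)) by now apply bact_red.
  rewrite <- !rmul_assoc by redtac.
  rewrite rmul_bact by redtac.
  change (rmul rone (bact n (cact c (tact l h)))) with (cact gone (bact n (cact c (tact l h)))).
  rewrite cact1, bact_bact by exact Ht. rewrite Z.add_opp_diag_l, bact0.
  change (rmul (ginv c, []) (cact c (tact l h))) with (cact (ginv c) (cact c (tact l h))).
  now rewrite cact_cact, gmulVl, cact1.
Qed.

Definition rinv (g : raw) : raw := rmul (tinv (snd g)) (ginv (fst g), []).

Lemma rinv_red g : red (rinv g).
Proof. now apply rmul_red. Qed.

Lemma rmulVl g : red g -> rmul (rinv g) g = rone.
Proof.
  destruct g as [c l]. intros H. unfold rinv; simpl. rewrite <- rmul_assoc; auto; [|exact I].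
  replace (rmul (ginv c, []) (c, l)) with (tact l rone).
  - apply tinv_tact, red_one.
  - rewrite tact_one by exact H. unfold rmul, cact; simpl. now rewrite gmulVl.
Qed.

Definition fp_car : Type := { g : raw | red g }.
Definition fp_mul (g h : fp_car) : fp_car :=
  exist _ (rmul (proj1_sig g) (proj1_sig h)) (rmul_red _ (proj2_sig h)).
Definition fp_inv (g : fp_car) : fp_car := exist _ (rinv (proj1_sig g)) (rinv_red _).
Definition fp_one : fp_car := exist _ rone red_one.

Lemma fp_eq (g h : fp_car) : proj1_sig g = proj1_sig h -> g = h.
Proof. destruct g, h; simpl. intros H. now apply subset_eq_compat. Qed.

Lemma fp_mulA g h k : fp_mul g (fp_mul h k) = fp_mul (fp_mul g h) k.
Proof. apply fp_eq; simpl. apply rmul_assoc; apply proj2_sig. Qed.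

Lemma fp_mul1l g : fp_mul fp_one g = g.
Proof. apply fp_eq; simpl. apply cact1. Qed.

Lemma fp_mulVl g : fp_mul (fp_inv g) g = fp_one.
Proof. apply fp_eq; simpl. apply rmulVl, proj2_sig. Qed.

Definition fp : group := @Group fp_car fp_mul fp_inv fp_one fp_mulA fp_mul1l fp_mulVl.

Definition fpC (c : C) : fp := exist _ ((c, []) : raw) I.
Definition fpB (n : Z) : fp := exist _ (bact n rone) (bact_red n red_one).

Lemma fpC_hom : is_hom fpC.
Proof. intros x y. now apply fp_eq. Qed.

Lemma fpB_add n m : gmul (fpB n) (fpB m) = fpB (n + m).
Proof.
  apply fp_eq; simpl. rewrite rmul_bact; [|exact I|now apply bact_red].
  change (rmul rone (bact m rone)) with (cact gone (bact m rone)).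
  rewrite cact1. apply bact_bact, red_one.
Qed.

Lemma fpB0 : fpB 0 = gone.
Proof. apply fp_eq, bact0. Qed.

Lemma fpB_inv n : ginv (fpB n) = fpB (- n).
Proof.
  symmetry. apply ginv_unique. rewrite fpB_add, Z.add_opp_diag_r. apply fpB0.
Qed.

Lemma fpC_mul_raw c (g : fp) : proj1_sig (gmul (fpC c) g) = cact c (proj1_sig g).
Proof. reflexivity. Qed.

Lemma fpB_mul_raw n (g : fp) : proj1_sig (gmul (fpB n) g) = bact n (proj1_sig g).
Proof.
  simpl. rewrite rmul_bact; [|exact I|apply proj2_sig]. f_equal. apply cact1.
Qed.

Lemma fp_ind (P : fp -> Prop) :
  P gone -> (forall c g, P g -> P (gmul (fpC c) g)) ->
  (forall n g, P g -> P (gmul (fpB n) g)) -> forall g, P g.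
Proof.
  intros H1 HC HB.
  assert (Ht : forall l (H : tred l), P (exist _ ((gone, l) : raw) H)).
  { induction l as [|[n c] l IH]; intros H.
    - match goal with |- P ?g => replace g with (gone : fp) end; [exact H1|now apply fp_eq].
    - pose proof H as (Hn & Hc & Hl).
      match goal with |- P ?g =>
        replace g with (gmul (fpB n) (gmul (fpC c) (exist _ ((gone, l) : raw) Hl : fp)))
      end; [now apply HB, HC|].
      apply fp_eq. rewrite fpB_mul_raw, fpC_mul_raw.
      change (bact n (cact c (gone, l)) = (gone, (n, c) :: l)).
      replace ((gone, l) : raw) with (tact l rone) by exact (tact_one Hl).
      exact (tact_one H). }
  intros [[c l] H].
  match goal with |- P ?g =>
    replace g with (gmul (fpC c) (exist _ ((gone, l) : raw) H : fp))
  end; [apply HC, Ht|].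
  apply fp_eq. simpl. unfold rmul, cact; simpl. now rewrite gmul1r.
Qed.

(** * Substitution of syllables *)

Section Rho.
Variables (M : group) (theta : C -> M).
Hypothesis theta_hom : is_hom theta.

Definition odd_map (lam : Z -> M) : Prop := forall n, lam (- n)%Z = ginv (lam n).

Fixpoint trho (lam : Z -> M) (l : syl) : M :=
  match l with
  | [] => gone
  | (n, c) :: l' => gmul (lam n) (gmul (theta c) (trho lam l'))
  end.

Definition rrho (lam : Z -> M) (g : raw) : M := gmul (theta (fst g)) (trho lam (snd g)).
Definition rho (lam : Z -> M) (g : fp) : M := rrho lam (proj1_sig g).

Lemma rrho_cact lam c g : rrho lam (cact c g) = gmul (theta c) (rrho lam g).
Proof. unfold rrho; simpl. rewrite theta_hom. now gsimp. Qed.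

Lemma rrho_eta lam g : fst g = gone -> rrho lam g = trho lam (snd g).
Proof. intros H. unfold rrho. rewrite H, (hom_one theta_hom). now gsimp. Qed.

Lemma rho_fpC lam c : rho lam (fpC c) = theta c.
Proof. unfold rho, rrho; simpl. now gsimp. Qed.

(* All multiplicativity failures of [rho] in a product g h come from one pair of merging syllables. *)
Lemma tact_defect (l : syl) (h : raw) : tred l -> red h ->
  exists n m : Z,
    (forall lam, odd_map lam -> lam 0%Z = gone -> gmul (lam n) (lam m) = lam (n + m)%Z ->
      rrho lam (tact l h) = gmul (trho lam l) (rrho lam h)) /\
    ((n = 0%Z /\ m = 0%Z) \/ (l <> [] /\ fst (tact l h) = gone)).
Proof.
  intros Hl Hh. induction l as [|[k c] l IH]; simpl.
  - exists 0%Z, 0%Z. split; [|now left]. intros. now gsimp.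
  - destruct Hl as (Hk & Hc & Hl). destruct (IH Hl) as (n & m & Hnm & Hd). clear IH.
    assert (Hr := tact_red l Hh).
    destruct (tact l h) as [d s] eqn:E. unfold cact; simpl in *.
    destruct (classic (gmul c d = gone)) as [e|e].
    (* If an earlier merge left a syllable behind, then [d] is trivial while [c] is not, since [l]
       is non-empty and the word is reduced. So [c d = 1] is impossible: a merge that leaves a
       syllable is the last one. *)
    + assert (Hnm0 : n = 0%Z /\ m = 0%Z).
      { destruct Hd as [Hd|[Hl0 Hd]]; [exact Hd|]. subst d. rewrite gmul1r in e.
        destruct Hc; congruence. }
      destruct Hnm0 as [-> ->]. rewrite e.
      assert (Hin : forall lam, odd_map lam -> lam 0%Z = gone ->
        gmul (lam k) (gmul (theta c) (gmul (trho lam l) (rrho lam h))) =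
        gmul (lam k) (trho lam s)).
      { intros lam Ho H0. rewrite <- (Hnm lam Ho H0) by (rewrite H0; now gsimp).
        unfold rrho; simpl. f_equal. rewrite !gmulA, <- theta_hom, e, (hom_one theta_hom).
        now gsimp. }
      destruct s as [|[m' c'] s].
      * exists 0%Z, 0%Z. split; [|now left]. intros lam Ho H0 _.
        gsimp. rewrite Hin by assumption. fold rone. rewrite bact_nil by assumption.
        rewrite rrho_eta by reflexivity. simpl. rewrite (hom_one theta_hom). now gsimp.
      * rewrite bact_merge by assumption. destruct (Z.eq_dec (k + m') 0) as [e'|e'].
        (* Complete cancellation produces no defect, because [lam] is odd; merging may go on. *)
        -- exists 0%Z, 0%Z. split; [|now left]. intros lam Ho H0 _.
           gsimp. rewrite Hin by assumption. simpl. replace m' with (- k)%Z by lia.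
           rewrite Ho. gsimp. reflexivity.
        -- exists k, m'. split; [|right; split; [discriminate|reflexivity]].
           intros lam Ho H0 Hlam. gsimp. rewrite Hin by assumption.
           rewrite rrho_eta by reflexivity. simpl. rewrite <- Hlam. now gsimp.
    + exists n, m. rewrite bact_ne by assumption. split; [|right; split; [discriminate|reflexivity]].
      intros lam Ho H0 Hlam. specialize (Hnm lam Ho H0 Hlam).
      unfold rrho in *; simpl in *. rewrite hom_one, theta_hom by assumption.
      gsimp. rewrite Hnm. now gsimp.
Qed.

Lemma rho_defect (g h : fp) : exists n m : Z,
  forall lam, odd_map lam -> lam 0%Z = gone -> gmul (lam n) (lam m) = lam (n + m)%Z ->
    rho lam (gmul g h) = gmul (rho lam g) (rho lam h).
Proof.
  destruct g as [[c l] Hl], h as [h Hh].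
  destruct (tact_defect Hl Hh) as (n & m & H & _). exists n, m.
  intros lam Ho H0 Hlam. unfold rho; simpl.
  change (rmul (c, l) h) with (cact c (tact l h)). rewrite rrho_cact, H by assumption.
  unfold rrho; simpl. now gsimp.
Qed.

Lemma rho_one lam : rho lam gone = gone.
Proof. unfold rho, rrho; simpl. rewrite (hom_one theta_hom). now gsimp. Qed.

(** A letter costs at most two products: the multiplication itself, and [ginv (e x)] times [e x],
    which controls the image of the inverse. Each product is harmless once [lam] vanishes at n, m
    and n + m; this gives the constant 6. *)
Lemma eval_defect (X : Type) (e : X -> fp) (w : word X) : exists L : list Z,
  length L <= 6 * length w /\
  forall lam, odd_map lam -> lam 0%Z = gone -> (forall n, In n L -> lam n = gone) ->
    rho lam (eval e w) = eval (fun x => rho lam (e x)) w.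
Proof.
  induction w as [|[x b] w (L & HL & IH)].
  - exists []. split; [simpl; lia|]. intros. apply rho_one.
  - destruct (rho_defect (if b then ginv (e x) else e x) (eval e w)) as (n & m & H1).
    destruct (rho_defect (ginv (e x)) (e x)) as (n' & m' & H2).
    exists ([n; m; (n + m)%Z; n'; m'; (n' + m')%Z] ++ L). split; [simpl; lia|].
    intros lam Ho H0 HL'. simpl. rewrite H1, IH; auto.
    + f_equal. destruct b; [|reflexivity]. apply (@gcancel_r _ (rho lam (e x))).
      rewrite <- H2; auto; [rewrite !gmulVl; apply rho_one|].
      rewrite !HL' by (simpl; tauto). now gsimp.
    + intros k Hk. apply HL', in_or_app. now right.
    + rewrite !HL' by (simpl; tauto). now gsimp.
Qed.

Definition exp_bound (E : Z) (g : fp) : Prop :=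
  Forall (fun s : Z * C => (Z.abs (fst s) <= E)%Z) (snd (proj1_sig g)).

Lemma exp_bound_le E E' g : (E <= E')%Z -> exp_bound E g -> exp_bound E' g.
Proof. intros H. apply Forall_impl. intros s; lia. Qed.

Lemma exp_bound_ex g : exists E, exp_bound E g.
Proof.
  unfold exp_bound. induction (snd (proj1_sig g)) as [|[n c] l (E & IH)].
  - exists 0%Z. constructor.
  - exists (Z.max E (Z.abs n)). constructor; simpl; [lia|].
    eapply Forall_impl; [|exact IH]. intros s; simpl; lia.
Qed.

Lemma rho_ext E lam lam' g : exp_bound E g ->
  (forall n, (Z.abs n <= E)%Z -> lam n = lam' n) -> rho lam g = rho lam' g.
Proof.
  intros H Hl. unfold rho, rrho. f_equal. unfold exp_bound in H.
  induction H as [|[n c] l Hn _ IH]; simpl; [reflexivity|]. now rewrite IH, Hl.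
Qed.

Lemma rho_closed (P : M -> Prop) lam g :
  P gone -> (forall x y, P x -> P y -> P (gmul x y)) -> (forall c, P (theta c)) ->
  (forall n, P (lam n)) -> P (rho lam g).
Proof.
  intros P1 PM PC PL. unfold rho, rrho. apply PM; [apply PC|].
  induction (snd (proj1_sig g)) as [|[n c] l IH]; simpl; auto.
Qed.

(** * Products without cancellation *)

Definition lastC (g : raw) : C := last (map snd (snd g)) (fst g).

Lemma tact_clean (l : syl) (h : raw) : tred l -> red h -> l <> [] ->
  gmul (last (map snd l) gone) (fst h) <> gone ->
  fst (tact l h) = gone /\
  forall lam, rrho lam (tact l h) = gmul (trho lam l) (rrho lam h).
Proof.
  intros Hl Hh. induction l as [|[n c] l IH]; [congruence|]. intros _ Hlast.
  destruct Hl as (Hn & Hc & Hl). change (tact ((n, c) :: l) h) with (bact n (cact c (tact l h))).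
  assert (H : gmul c (fst (tact l h)) <> gone /\
    forall lam, rrho lam (tact l h) = gmul (trho lam l) (rrho lam h)).
  { destruct l as [|s l].
    - split; [exact Hlast|]. intros lam. simpl. now gsimp.
    - destruct IH as [H1 H2]; [exact Hl|discriminate|exact Hlast|].
      rewrite H1, gmul1r. split; [|exact H2]. destruct Hc; congruence. }
  destruct H as [H1 H2]. destruct (tact l h) as [d s] eqn:E.
  unfold cact; simpl in *. rewrite bact_ne by assumption. split; [reflexivity|].
  intros lam. rewrite rrho_eta by reflexivity. simpl. rewrite theta_hom.
  gsimp. f_equal. f_equal. apply H2.
Qed.

(* Such an element begins and ends with a non-trivial element of [C]. *)
Definition nice (g : fp) : Prop :=
  fst (proj1_sig g) <> gone /\ lastC (proj1_sig g) <> gone.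

Definition starts_b (g : fp) : Prop := fst (proj1_sig g) = gone.

Lemma nice_mul (g h : fp) : nice g -> starts_b h ->
  fst (proj1_sig (gmul g h)) <> gone /\
  forall lam, rho lam (gmul g h) = gmul (rho lam g) (rho lam h).
Proof.
  destruct g as [[c l] Hl], h as [h Hh]. unfold nice, starts_b, rho, lastC; simpl.
  intros [Hc Hlast] Hs. change (rmul (c, l) h) with (cact c (tact l h)).
  destruct l as [|s l].
  - simpl. rewrite Hs, gmul1r. split; [exact Hc|]. intros lam.
    rewrite rrho_cact. unfold rrho; simpl. now gsimp.
  - destruct (@tact_clean (s :: l) h Hl Hh) as [H1 H2]; [discriminate| |].
    + rewrite Hs, gmul1r. intros H0; apply Hlast.
      rewrite <- H0. clear. revert s. induction l as [|s' l IH]; intros s; [reflexivity|apply (IH s')].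
    + split.
      * simpl. change (tact (s :: l) h) with (let (n, c) := s in bact n (cact c (tact l h))) in H1.
        rewrite H1, gmul1r. exact Hc.
      * intros lam. rewrite rrho_cact, H2. unfold rrho at 2. simpl. now gsimp.
Qed.

Lemma fpB_mul_clean n (g : fp) : n <> 0%Z -> fst (proj1_sig g) <> gone ->
  starts_b (gmul (fpB n) g) /\
  forall lam, rho lam (gmul (fpB n) g) = gmul (lam n) (rho lam g).
Proof.
  intros Hn Hg. unfold starts_b, rho. rewrite fpB_mul_raw.
  destruct (proj1_sig g) as [d l]. rewrite bact_ne by assumption.
  split; [reflexivity|]. intros lam. now rewrite rrho_eta.
Qed.

Lemma rho_fpB lam n : n <> 0%Z -> rho lam (fpB n) = lam n.
Proof.
  intros Hn. unfold rho; simpl. rewrite bact_nil by assumption.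
  rewrite rrho_eta by reflexivity. simpl. rewrite (hom_one theta_hom). now gsimp.
Qed.

Lemma starts_b_fpB n : starts_b (fpB n).
Proof.
  unfold starts_b; simpl. unfold bact. simpl. bcase. reflexivity.
Qed.
End Rho.

(** Conjugation by [c] multiplies the first coefficient by [c] on the left and the last one by its
    inverse on the right, so only two values of [c] are forbidden. An element of [C] needs no
    conjugation. *)
Lemma nice_conj (Cbig : forall c1 c2 : C, exists c, c <> c1 /\ c <> c2) (g : fp) :
  g <> gone -> exists c, nice (gmul (fpC c) (gmul g (ginv (fpC c)))).
Proof.
  intros Hg.
  assert (E : forall c, proj1_sig (gmul (fpC c) (gmul g (ginv (fpC c)))) =
     cact c (rmul (proj1_sig g) (ginv c, []))).
  { intros c. rewrite fpC_mul_raw. f_equal. simpl. f_equal.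
    unfold rinv. simpl. apply cact1. }
  cut (exists c, fst (cact c (rmul (proj1_sig g) (ginv c, []))) <> gone /\
                 lastC (cact c (rmul (proj1_sig g) (ginv c, []))) <> gone).
  { intros [c H]. exists c. unfold nice. rewrite E. exact H. }
  clear E. destruct g as [[c0 l] Hl]; simpl proj1_sig.
  assert (Ht : forall l d, tred l -> l <> [] -> exists l',
     tact l (d, []) = (gone, l') /\ last (map snd l') gone = gmul (last (map snd l) gone) d /\ l' <> []).
  { clear. intros l d. induction l as [|[n c] l IH]; [congruence|]. intros (Hn & Hc & Hl) _.
    destruct l as [|s l].
    - exists [(n, gmul c d)]. simpl. split; [|split; [reflexivity|discriminate]].
      unfold cact; simpl.
      destruct (classic (gmul c d = gone)) as [->|H]; [now apply bact_nil|now apply bact_ne].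
    - destruct IH as (l' & H1 & H2 & H3); [exact Hl|discriminate|].
      exists ((n, c) :: l'). split; [|split; [|discriminate]].
      + change (tact ((n, c) :: s :: l) (d, [])) with (bact n (cact c (tact (s :: l) (d, [])))).
        rewrite H1. unfold cact; simpl. rewrite gmul1r. apply bact_ne; [exact Hn|].
        destruct Hc; congruence.
      + destruct l' as [|s' l']; [congruence|]. exact H2. }
  destruct l as [|s l].
  - exists gone. unfold lastC, rmul, cact; simpl. gsimp.
    assert (c0 <> gone); [|tauto]. intros ->. apply Hg. now apply fp_eq.
  - destruct (Cbig (ginv c0) (last (map snd (s :: l)) gone)) as (c & H1 & H2).
    exists c. unfold rmul, lastC.
    destruct (Ht (s :: l) (ginv c) Hl) as (l' & E1 & E2 & E3); [discriminate|].
    change (snd (c0, s :: l)) with (s :: l). rewrite E1. unfold cact; simpl. split.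
    + gsimp. intros H. apply H1. apply (@gcancel_r _ c0). now rewrite H, gmulVl.
    + destruct l' as [|s' l']; [congruence|].
      assert (D : forall x y, last (map snd (s' :: l')) x = last (map snd (s' :: l')) y).
      { clear. revert s'. induction l' as [|s l IH]; intros s' x y; [reflexivity|apply (IH s)]. }
      rewrite (D _ gone), E2. intros H. apply H2.
      apply ginv_unique in H. rewrite <- (ginvK c), H. now gsimp.
Qed.
End FreeProduct.

(** * Merzlyakov's theorem *)

Definition gconj {G : group} (g x : G) : G := gmul g (gmul x (ginv g)).

Definition big (C : group) : Prop := forall c1 c2 : C, exists c, c <> c1 /\ c <> c2.

Lemma trivial_hom (G H : group) : is_hom (fun _ : G => gone : H).
Proof. intros x y. now gsimp. Qed.

(** After x and y have been conjugated to nice elements x' and y', the product x' b y' b^-1 starts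
    with a non-trivial element of [C], whereas b y' b^-1 x' starts with b. *)
Lemma fp_noncommute (C : group) (x y : fp C) : big C -> x <> gone -> y <> gone ->
  exists g, gmul x (gconj g y) <> gmul (gconj g y) x.
Proof.
  intros HC Hx Hy.
  destruct (nice_conj HC Hx) as [c Hc], (nice_conj HC Hy) as [d Hd].
  fold (gconj (fpC c) x) in Hc. fold (gconj (fpC d) y) in Hd.
  set (x' := gconj (fpC c) x) in *. set (y' := gconj (fpC d) y) in *.
  exists (gmul (ginv (fpC c)) (gmul (fpB C 1) (fpC d))). intros H.
  assert (H' : gmul x' (gmul (fpB C 1) (gmul y' (fpB C (-1)))) =
               gmul (fpB C 1) (gmul y' (gmul (fpB C (-1)) x'))).
  { apply (f_equal (fun u => gconj (fpC c) u)) in H. unfold x', y', gconj in *.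
    replace (fpB C (-1)) with (ginv (fpB C 1)) by apply fpB_inv. revert H. gsimp. auto. }
  pose proof (@trivial_hom C C) as Ht.
  destruct (nice_mul Ht Hd (starts_b_fpB C (-1))) as [H1 _].
  destruct (fpB_mul_clean Ht (n := 1%Z) ltac:(lia) H1) as [H2 _].
  destruct (nice_mul Ht Hc H2) as [H3 _].
  apply H3. rewrite H'.
  assert (H4 : starts_b (gmul (fpB C (-1)) x')) by (apply (fpB_mul_clean Ht); [lia|apply Hc]).
  destruct (nice_mul Ht Hd H4) as [H5 _].
  apply (fpB_mul_clean Ht (n := 1%Z) ltac:(lia) H5).
Qed.

Fixpoint conjprod {G : group} (r : nat) (w : G) (zeta : nat -> G) : G :=
  match r with
  | O => gone
  | S r' => gmul (gconj (zeta 0) w) (conjprod r' w (fun q => zeta (S q)))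
  end.

(** * Products of conjugates with pairwise different exponents *)

Section Markers.
Variables (C M : group) (theta : C -> M).
Hypothesis theta_hom : is_hom theta.

(** In closed form prev + step (2^(q+1) - 1): the successive differences step 2^q are pairwise
    different, and they become the markers. *)
Fixpoint kseq (prev step : Z) (q : nat) : Z :=
  match q with
  | O => prev + step
  | S q' => kseq (prev + step) (2 * step) q'
  end%Z.

Fixpoint cprod (w : fp C) (r : nat) (prev step : Z) : fp C :=
  match r with
  | O => fpB C (- prev)
  | S r' => gmul (fpB C step) (gmul w (cprod w r' (prev + step) (2 * step)))
  end.

Fixpoint mprod (lam : Z -> M) (x : M) (r : nat) (prev step : Z) : M :=
  match r with
  | O => lam (- prev)%Z
  | S r' => gmul (lam step) (gmul x (mprod lam x r' (prev + step) (2 * step)))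
  end.

(* The conjugators telescope: only the differences of the exponents survive as syllables. *)
Lemma conjprod_cprod (w : fp C) (c : C) r prev step :
  conjprod r w (fun q => gmul (fpB C (kseq prev step q)) (fpC c)) =
  gmul (fpB C prev) (cprod (gconj (fpC c) w) r prev step).
Proof.
  revert prev step. induction r as [|r IH]; intros prev step; cbn [conjprod cprod kseq].
  - rewrite fpB_add, Z.add_opp_diag_r. now rewrite fpB0.
  - rewrite IH, (gmulA (fp C) (fpB C prev)), fpB_add. unfold gconj. now gsimp.
Qed.

Lemma rho_cprod (w : fp C) r prev step : nice w -> (0 <= prev)%Z -> (0 < step)%Z ->
  (r = 0 -> prev <> 0%Z) ->
  starts_b (cprod w r prev step) /\
  forall lam, rho theta lam (cprod w r prev step) = mprod lam (rho theta lam w) r prev step.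
Proof.
  intros Hw. revert prev step. induction r as [|r IH]; intros prev step Hp Hs Hr.
  - split; [apply starts_b_fpB|]. intros lam. cbn [cprod mprod]. apply (rho_fpB theta_hom).
    specialize (Hr eq_refl). lia.
  - destruct (IH (prev + step)%Z (2 * step)%Z) as [H1 H2]; [lia|lia|lia|].
    cbn [cprod mprod].
    destruct (nice_mul theta_hom Hw H1) as [H3 H4].
    destruct (fpB_mul_clean theta_hom (n := step) ltac:(lia) H3) as [H5 H6].
    split; [exact H5|]. intros lam. now rewrite H6, H4, H2.
Qed.

(** When [lam] vanishes at all syllables but the j-th, the product collapses to x^j v x^(r-j), and
    the equation with [X] is solved for v. The value v is fixed before [lam], since it is needed to
    define [lam]. *)
Lemma mprod_solve (P : M -> Prop) (x X : M) r j prev step :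
  P gone -> (forall u v, P u -> P v -> P (gmul u v)) -> (forall u, P u -> P (ginv u)) ->
  P x -> P X -> j < r ->
  exists v, P v /\ forall lam,
    lam (step * 2 ^ Z.of_nat j)%Z = v ->
    (forall j', j' < r -> j' <> j -> lam (step * 2 ^ Z.of_nat j')%Z = gone) ->
    lam (- (prev + step * (2 ^ Z.of_nat r - 1)))%Z = gone ->
    mprod lam x r prev step = X.
Proof.
  intros P1 PM PI Px. revert X j prev step.
  assert (Hpow : forall k, (2 ^ Z.of_nat (S k) = 2 * 2 ^ Z.of_nat k)%Z).
  { intros k. rewrite Nat2Z.inj_succ, Z.pow_succ_r; lia. }
  assert (Hones : forall r, exists u, P u /\ forall prev step lam,
    (forall j', j' < r -> lam (step * 2 ^ Z.of_nat j')%Z = gone) ->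
    lam (- (prev + step * (2 ^ Z.of_nat r - 1)))%Z = gone -> mprod lam x r prev step = u).
  { clear -P1 PM Px Hpow. induction r as [|r (u & Pu & IH)].
    - exists gone. split; [exact P1|]. intros prev step lam _ H. simpl in *.
      rewrite <- H. f_equal. lia.
    - exists (gmul x u). split; [now apply PM|]. intros prev step lam H1 H2. cbn [mprod].
      rewrite (IH (prev + step)%Z (2 * step)%Z).
      + specialize (H1 0 ltac:(lia)). change (2 ^ Z.of_nat 0)%Z with 1%Z in H1.
        rewrite Z.mul_1_r in H1. rewrite H1. now gsimp.
      + intros j' Hj'. rewrite <- (H1 (S j')) by lia. rewrite Hpow. f_equal. lia.
      + rewrite <- H2. rewrite Hpow. f_equal. lia. }
  induction r as [|r IH]; intros X j prev step PX Hj; [lia|].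
  destruct j as [|j].
  - destruct (Hones r) as (u & Pu & Hu).
    exists (gmul X (ginv (gmul x u))). split; [auto|].
    intros lam H1 H2 H3. cbn [mprod]. change (2 ^ Z.of_nat 0)%Z with 1%Z in H1.
    rewrite Z.mul_1_r in H1. rewrite H1, (Hu (prev + step)%Z (2 * step)%Z); [now gsimp| |].
    + intros j' Hj'. rewrite <- (H2 (S j')) by lia. rewrite Hpow. f_equal. lia.
    + rewrite <- H3. rewrite Hpow. f_equal. lia.
  - destruct (IH (gmul (ginv x) X) j (prev + step)%Z (2 * step)%Z) as (v & Pv & Hv);
      [auto|lia|].
    exists v. split; [exact Pv|]. intros lam H1 H2 H3. cbn [mprod].
    rewrite (Hv lam).
    + pose proof (H2 0 ltac:(lia) ltac:(lia)) as H0. change (2 ^ Z.of_nat 0)%Z with 1%Z in H0.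
      rewrite Z.mul_1_r in H0. rewrite H0. now gsimp.
    + rewrite <- H1, Hpow. f_equal. lia.
    + intros j' Hj' Hne. rewrite <- (H2 (S j')) by lia. rewrite Hpow. f_equal. lia.
    + rewrite <- H3, Hpow. f_equal. lia.
Qed.
End Markers.

Lemma bound_family (C : group) (N : nat) (f : nat -> fp C) :
  exists E, forall i, i < N -> exp_bound E (f i).
Proof.
  induction N as [|N (E & IH)].
  - exists 0%Z. intros; lia.
  - destruct (exp_bound_ex (f N)) as [E' H']. exists (Z.max E E'). intros i Hi.
    destruct (Nat.eq_dec i N) as [->|Hne].
    + apply exp_bound_le with (2 := H'). lia.
    + apply exp_bound_le with (2 := IH i ltac:(lia)). lia.
Qed.

(** * Marked positions and the induction over the levels *)

Section Merzlyakov.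
Variables (C M : group) (theta : C -> M).
Hypothesis theta_hom : is_hom theta.
Hypothesis C_big : big C.
Variable X : nat -> nat -> M.
(* [P l] is a subgroup of [M] containing the image of [C] and the generics of the levels below [l]. *)
Variable P : nat -> M -> Prop.
Hypothesis P_one : forall l, P l gone.
Hypothesis P_mul : forall l x y, P l x -> P l y -> P l (gmul x y).
Hypothesis P_inv : forall l x, P l x -> P l (ginv x).
Hypothesis P_theta : forall l c, P l (theta c).
Hypothesis P_X : forall l i, P (S l) (X l i).
Hypothesis P_S : forall l x, P l x -> P (S l) x.
Variables (r N : nat).
Hypothesis r_ge2 : 2 <= r.

(** The invariant of a position after l levels. The candidates [mu] are fixed during the play, but
    the selection [kappa] is quantified after them, because the exponents to be avoided are known
    only at the end. The clauses on [P] record that an answer depends on no later generic. *)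
Definition marked (l : nat) (x y : nat -> nat -> fp C) : Prop :=
  exists (E : Z) (mu : nat -> nat -> nat -> Z),
    (forall l' i, l' < l -> i < N -> exp_bound E (x l' i) /\ exp_bound E (y l' i)) /\
    (forall l' i j, l' < l -> i < N -> j < r -> (0 < mu l' i j <= E)%Z) /\
    (forall l' i j j', l' < l -> i < N -> j < r -> j' < r ->
       mu l' i j = mu l' i j' -> j = j') /\
    forall kappa : nat -> nat -> nat, (forall l' i, kappa l' i < r) ->
      exists lam : Z -> M, odd_map lam /\ lam 0%Z = gone /\
        (forall n, lam n <> gone ->
           exists l' i, l' < l /\ i < N /\ Z.abs n = mu l' i (kappa l' i)) /\
        (forall n, P l (lam n)) /\
        forall l' i, l' < l -> i < N ->
          rho theta lam (x l' i) = X l' i /\ P (S l') (rho theta lam (y l' i)).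

Lemma marked_0 x y : marked 0 x y.
Proof.
  exists 0%Z, (fun _ _ _ => 0%Z). repeat split; try (intros; lia).
  intros kappa _. exists (fun _ => gone). split; [|split; [reflexivity|split; [congruence|split]]].
  - intros n. now gsimp.
  - intros n. apply P_one.
  - intros; lia.
Qed.

Lemma pow2_inj a b : (2 ^ Z.of_nat a = 2 ^ Z.of_nat b)%Z -> a = b.
Proof. intros H. apply Z.pow_inj_r in H; lia. Qed.

Lemma marker_inj (E : Z) i j i' j' : (0 < E)%Z -> j < r -> j' < r ->
  (E * 2 ^ Z.of_nat (S r * i + j) = E * 2 ^ Z.of_nat (S r * i' + j'))%Z -> i = i' /\ j = j'.
Proof.
  intros HE Hj Hj' H. apply Z.mul_reg_l in H; [|lia]. apply pow2_inj in H.
  assert (i = i') by nia. subst. lia.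
Qed.

(** The closing syllable of x_i has an exponent with factor 2^r - 1, which is not a power of two for
    r at least 2; so it never coincides with a marker. *)
Lemma marker_end (E : Z) i i' j' : (0 < E)%Z ->
  (E * 2 ^ Z.of_nat (S r * i) * (2 ^ Z.of_nat r - 1) <> E * 2 ^ Z.of_nat (S r * i' + j'))%Z.
Proof.
  intros HE H. rewrite <- Z.mul_assoc in H. apply Z.mul_reg_l in H; [|lia].
  set (a := S r * i) in *. set (b := S r * i' + j') in *. clearbody a b.
  assert (H4 : (4 <= 2 ^ Z.of_nat r)%Z).
  { change 4%Z with (2 ^ 2)%Z. apply Z.pow_le_mono_r; lia. }
  assert (Ha : (0 < 2 ^ Z.of_nat a)%Z) by (apply Z.pow_pos_nonneg; lia).
  assert (Hlt : (b < a + r)).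
  { apply Nat2Z.inj_lt, (Z.pow_lt_mono_r_iff 2); [lia|lia|].
    rewrite <- H, Nat2Z.inj_add, Z.pow_add_r by lia. nia. }
  assert (Hr : (2 ^ Z.of_nat r = 2 * 2 ^ Z.of_nat (r - 1))%Z).
  { rewrite <- Z.pow_succ_r by lia. f_equal. lia. }
  assert (Hle : (2 ^ Z.of_nat b <= 2 ^ Z.of_nat (a + (r - 1)))%Z)
    by (apply Z.pow_le_mono_r; lia).
  rewrite <- H, Nat2Z.inj_add, Z.pow_add_r in Hle by lia. nia.
Qed.

(** The new markers lie beyond all exponents of the position and of the conjugated [w i]. Redefining
    [lam] there leaves earlier levels solved, and the image of [w' i] is a constant in the equation
    for the new value. *)
Lemma marked_step l x y (w : nat -> fp C) :
  marked l x y -> (forall i, w i <> gone) ->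
  exists zeta : nat -> nat -> fp C, forall g,
    marked (S l) (upd x l (fun i => conjprod r (w i) (zeta i))) (upd y l g).
Proof.
  intros (E & mu & HE & Hmu & Hinj & Hlam) Hw.
  assert (Hc : forall i, exists c, nice (gconj (fpC c) (w i))) by (intros i; now apply nice_conj).
  apply choice in Hc. destruct Hc as [c Hc].
  set (w' := fun i => gconj (fpC (c i)) (w i)) in *.
  destruct (bound_family N w') as [Ew HEw].
  (* The added 1 makes [E0] positive and strictly larger than all exponents seen so far. *)
  set (E0 := (Z.max (Z.max E Ew) 0 + 1)%Z).
  set (e := fun i => (E0 * 2 ^ Z.of_nat (S r * i))%Z).
  assert (He : forall i, (0 < 2 ^ Z.of_nat i)%Z) by (intros; apply Z.pow_pos_nonneg; lia).
  exists (fun i q => gmul (fpB C (kseq 0 (e i) q)) (fpC (c i))). intros g.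
  set (x' := fun i => conjprod _ _ _).
  assert (Hx' : forall i, x' i = cprod (w' i) r 0 (e i)).
  { intros i. unfold x'. rewrite conjprod_cprod, fpB0. apply gmul1l. }
  set (mu' := fun l' i j => if Nat.eqb l' l then (E0 * 2 ^ Z.of_nat (S r * i + j))%Z else mu l' i j).
  destruct (bound_family N x') as [Ex HEx]. destruct (bound_family N g) as [Eg HEg].
  (* The answer [g] may have arbitrarily large exponents; they only raise this bound, which the next
     level exceeds. *)
  set (E' := Z.max (Z.max E (E0 * 2 ^ Z.of_nat (S r * N + r))) (Z.max Ex Eg)).
  exists E', mu'. split; [|split; [|split]].
  - intros l' i Hl' Hi. unfold upd. destruct (Nat.eqb_spec l' l) as [->|Hne].
    + split; [apply exp_bound_le with (2 := HEx i Hi)|apply exp_bound_le with (2 := HEg i Hi)]; lia.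
    + destruct (HE l' i ltac:(lia) Hi) as [H1 H2].
      split; [apply exp_bound_le with (2 := H1)|apply exp_bound_le with (2 := H2)]; lia.
  - intros l' i j Hl' Hi Hj. unfold mu'. destruct (Nat.eqb_spec l' l) as [->|Hne].
    + assert (2 ^ Z.of_nat (S r * i + j) <= 2 ^ Z.of_nat (S r * N + r))%Z
        by (apply Z.pow_le_mono_r; nia).
      specialize (He (S r * i + j)). split; [nia|]. unfold E'. nia.
    + specialize (Hmu l' i j ltac:(lia) Hi Hj). lia.
  - intros l' i j j' Hl' Hi Hj Hj'. unfold mu'. destruct (Nat.eqb_spec l' l) as [->|Hne].
    + intros H. apply marker_inj in H; lia.
    + apply Hinj; lia.
  - intros kappa Hk. destruct (Hlam kappa Hk) as (lam & Ho & H0 & Hsupp & HP & Hxy).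
    set (mk := fun i => (E0 * 2 ^ Z.of_nat (S r * i + kappa l i))%Z).
    assert (Hmk : forall i, (E0 <= mk i)%Z).
    { intros i. unfold mk. specialize (He (S r * i + kappa l i)). nia. }
    (* The image of [w' i] is taken under the old [lam], which avoids circularity: the new map
       agrees with it on all exponents below [E0]. *)
    assert (Hv : forall i, exists v, P (S l) v /\ forall lam',
      lam' (e i * 2 ^ Z.of_nat (kappa l i))%Z = v ->
      (forall j', j' < r -> j' <> kappa l i -> lam' (e i * 2 ^ Z.of_nat j')%Z = gone) ->
      lam' (- (0 + e i * (2 ^ Z.of_nat r - 1)))%Z = gone ->
      mprod lam' (rho theta lam (w' i)) r 0 (e i) = X l i).
    { intros i. apply mprod_solve; auto. apply rho_closed; auto. }
    apply choice in Hv. destruct Hv as [v Hv].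
    set (is_mk := fun (n : Z) (i : nat) => i < N /\ Z.abs n = mk i).
    set (lam' := fun n => if excluded_middle_informative (exists i, is_mk n i) then
       let i := epsilon (inhabits 0) (is_mk n) in
       if Z_lt_dec 0 n then v i else ginv (v i)
       else lam n).
    assert (Hmki : forall i i', mk i = mk i' -> i = i').
    { intros i i' H. apply marker_inj in H; [tauto|lia|apply Hk|apply Hk]. }
    assert (Hlam'1 : forall i, i < N -> lam' (mk i) = v i).
    { intros i Hi. assert (Hm : is_mk (mk i) i) by (split; [exact Hi|specialize (Hmk i); lia]).
      unfold lam'. destruct (excluded_middle_informative _) as [Hex|Hex]; [|exfalso; eauto].
      assert (Heps := epsilon_spec (inhabits 0) (is_mk (mk i)) Hex).
      destruct Heps as [_ Heps]. destruct Hm as [_ Hm]. rewrite Hm in Heps.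
      apply Hmki in Heps. rewrite <- Heps.
      destruct (Z_lt_dec 0 (mk i)); [reflexivity|specialize (Hmk i); lia]. }
    assert (Hlam'2 : forall n, (forall i, i < N -> Z.abs n <> mk i) -> lam' n = lam n).
    { intros n Hn. unfold lam'. destruct (excluded_middle_informative _) as [[i [Hi Hm]]|Hex]; [|reflexivity].
      exfalso. exact (Hn i Hi Hm). }
    assert (Hlow : forall n, (Z.abs n < E0)%Z -> lam' n = lam n).
    { intros n Hn. apply Hlam'2. intros i _. specialize (Hmk i). lia. }
    assert (Hhigh : forall n, (E0 <= Z.abs n)%Z -> lam n = gone).
    { intros n Hn. apply NNPP. intros H. apply Hsupp in H. destruct H as (l' & i & Hl' & Hi & H).
      specialize (Hmu l' i (kappa l' i) Hl' Hi (Hk l' i)). lia. }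
    exists lam'. split; [|split; [|split; [|split]]].
    + intros n. unfold lam'.
      replace (is_mk (- n)%Z) with (is_mk n)
        by (apply functional_extensionality; intros i; unfold is_mk; now rewrite Z.abs_opp).
      destruct (excluded_middle_informative _) as [[i [Hi Hm]]|Hex]; [|apply Ho].
      specialize (Hmk i). cbv zeta.
      destruct (Z_lt_dec 0 n), (Z_lt_dec 0 (- n)); try lia; now gsimp.
    + rewrite Hlow by (simpl; lia). exact H0.
    + intros n Hn. destruct (classic (exists i, is_mk n i)) as [[i [Hi Hm]]|Hex].
      * exists l, i. split; [lia|split; [exact Hi|]]. unfold mu'. now rewrite Nat.eqb_refl.
      * rewrite Hlam'2 in Hn by (intros i Hi Hm; apply Hex; exists i; split; assumption).
        destruct (Hsupp n Hn) as (l' & i & Hl' & Hi & Hm). exists l', i.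
        split; [lia|split; [exact Hi|]]. unfold mu'.
        destruct (Nat.eqb_spec l' l); [lia|exact Hm].
    + intros n. unfold lam'. destruct (excluded_middle_informative _) as [Hex|Hex]; [|auto].
      cbv zeta. assert (PV := proj1 (Hv (epsilon (inhabits 0) (is_mk n)))).
      destruct (Z_lt_dec 0 n); auto.
    + assert (PL : forall n, P (S l) (lam' n)).
      { intros n. unfold lam'. destruct (excluded_middle_informative _) as [Hex|Hex]; [|auto].
        cbv zeta. assert (PV := proj1 (Hv (epsilon (inhabits 0) (is_mk n)))).
        destruct (Z_lt_dec 0 n); auto. }
      intros l' i Hl' Hi. unfold upd. destruct (Nat.eqb_spec l' l) as [->|Hne].
      * split; [|apply rho_closed; auto].
        rewrite Hx'.
        assert (Hei : (0 < e i)%Z) by (unfold e; specialize (He (S r * i)); nia).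
        destruct (rho_cprod theta_hom (Hc i) (r := r) (prev := 0%Z) (step := e i)) as [_ Hr];
          [lia|exact Hei|lia|].
        rewrite Hr.
        replace (rho theta lam' (gconj (fpC (c i)) (w i))) with (rho theta lam (w' i)).
        2:{ apply rho_ext with Ew; [now apply HEw|]. intros n Hn. symmetry. apply Hlow. lia. }
        assert (Hpow : forall j, (e i * 2 ^ Z.of_nat j = E0 * 2 ^ Z.of_nat (S r * i + j))%Z).
        { intros j. unfold e. rewrite Nat2Z.inj_add, Z.pow_add_r by lia. lia. }
        apply (proj2 (Hv i)).
        -- rewrite Hpow. now apply Hlam'1.
        -- intros j' Hj' Hne. rewrite Hpow.
           assert (E0 <= E0 * 2 ^ Z.of_nat (S r * i + j'))%Z by (specialize (He (S r * i + j')); nia).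
           rewrite Hlam'2; [apply Hhigh; lia|].
           intros i' Hi'. rewrite Z.abs_eq by lia. intros Hm.
           apply marker_inj in Hm; [|lia|exact Hj'|apply Hk]. destruct Hm; subst; auto.
        -- assert (H4 : (2 <= 2 ^ Z.of_nat r)%Z).
           { change 2%Z with (2 ^ 1)%Z at 1. apply Z.pow_le_mono_r; lia. }
           assert (Hge : (E0 <= e i)%Z) by (unfold e; specialize (He (S r * i)); nia).
           assert (E0 <= e i * (2 ^ Z.of_nat r - 1))%Z by nia.
           rewrite Hlam'2; [apply Hhigh; lia|].
           intros i' Hi'. rewrite Z.add_0_l, Z.abs_opp, Z.abs_eq by lia.
           apply marker_end. lia.
      * assert (Hl : l' < l) by lia. destruct (HE l' i Hl Hi) as [B1 B2].
        rewrite <- (rho_ext theta (lam := lam) B1), <- (rho_ext theta (lam := lam) B2).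
        -- now apply Hxy.
        -- intros n Hn. symmetry. apply Hlow. lia.
        -- intros n Hn. symmetry. apply Hlow. lia.
Qed.

Lemma defect_list (e : nvar -> fp C) (S : list (word nvar)) : exists L : list Z,
  length L <= 6 * list_sum (map (@length _) S) /\
  forall lam, odd_map lam -> lam 0%Z = gone -> (forall n, In n L -> lam n = gone) ->
    Forall (fun w => rho theta lam (eval e w) = eval (fun v => rho theta lam (e v)) w) S.
Proof.
  induction S as [|w S (L & HL & IH)].
  - exists []. split; [simpl; lia|constructor].
  - destruct (eval_defect theta_hom e w) as (L' & HL' & H').
    exists (L' ++ L). rewrite length_app. split; [simpl; lia|].
    intros lam Ho H0 H. constructor.
    + apply H'; auto. intros n Hn. apply H, in_or_app. now left.
    + apply IH; auto. intros n Hn. apply H, in_or_app. now right.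
Qed.

(** Pigeonhole principle for the r candidate markers of one variable. *)
Lemma avoid (f : nat -> Z) (L : list Z) :
  (forall j j', j < r -> j' < r -> f j = f j' -> j = j') -> length L < r ->
  exists j, j < r /\ ~ In (f j) L.
Proof.
  intros Hf HL. apply NNPP. intros Hno.
  assert (Hincl : incl (map f (seq 0 r)) L).
  { intros n Hn. apply in_map_iff in Hn. destruct Hn as (j & <- & Hj).
    apply in_seq in Hj. apply NNPP. intros H. apply Hno. exists j. split; [lia|exact H]. }
  apply NoDup_incl_length in Hincl; [rewrite length_map, length_seq in Hincl; lia|].
  apply (@NoDup_nth _ _ (f 0)). rewrite length_map, length_seq. intros i j Hi Hj H.
  rewrite !(map_nth f), !seq_nth in H by assumption. now apply Hf.
Qed.

Variable sys : list (list (word nvar)).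

(** A weakening of [qsat]: the universal moves are confined to products of r conjugates of
    non-trivial elements that the position supplies. Both cases, [psi2] true or false in the free
    product, provide this much. *)
Fixpoint wgame (z : nat -> fp C) (k l : nat) (x y : nat -> nat -> fp C) : Prop :=
  match k with
  | O => Exists (Forall (fun w => eval (nenv z x y) w = gone)) sys
  | S k' => exists w : nat -> fp C, (forall i, w i <> gone) /\
      forall zeta : nat -> nat -> fp C, exists g : nat -> fp C,
        wgame z k' (S l) (upd x l (fun i => conjprod r (w i) (zeta i))) (upd y l g)
  end.

Lemma marked_play z k l x y : wgame z k l x y -> marked l x y ->
  exists x' y', marked (k + l) x' y' /\
    Exists (Forall (fun w => eval (nenv z x' y') w = gone)) sys.
Proof.
  revert l x y. induction k as [|k IH]; intros l x y Hg Hm.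
  - exists x, y. split; assumption.
  - destruct Hg as (w & Hw & Hg). destruct (marked_step Hm Hw) as [zeta Hz].
    destruct (Hg zeta) as [g Hg']. destruct (IH _ _ _ Hg' (Hz g)) as (x' & y' & H1 & H2).
    exists x', y'. split; [|exact H2]. replace (S k + l) with (k + S l) by lia. exact H1.
Qed.

Definition index_lt (v : nvar) : Prop :=
  match v with VX _ i | VY _ i => i < N | _ => True end.

Definition total_length (s : list (list (word nvar))) : nat :=
  list_sum (map (fun S => list_sum (map (@length _) S)) s).

Lemma total_length_in S s : In S s -> list_sum (map (@length _) S) <= total_length s.
Proof.
  unfold total_length. induction s as [|S' s IH]; simpl; [tauto|].
  intros [->|H]; [lia|]. specialize (IH H). lia.
Qed.

(** The satisfied system produces at most 6 [total_length sys] critical exponents, fewer than the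
    candidates of each variable. A map [lam] supported on uncritical candidates is multiplicative
    along all words of the system, so [rho] carries the equations to [M], with every relevant x sent
    to its generic. *)
Lemma merzlyakov (zc : nat -> C) m x y :
  Forall (Forall (letters_in (fun v => psi_letter m v /\ index_lt v))) sys ->
  6 * total_length sys < r ->
  wgame (fun i => fpC (zc i)) m 0 x y ->
  exists Y : nat -> nat -> M, (forall l i, P (S l) (Y l i)) /\
    Exists (Forall (fun w => eval (nenv (fun i => theta (zc i)) X Y) w = gone)) sys.
Proof.
  intros Hwf Hr Hg. destruct (marked_play Hg (marked_0 x y)) as (x' & y' & Hm & Hex).
  rewrite Nat.add_0_r in Hm. clear Hg x y. apply Exists_exists in Hex.
  destruct Hex as (S & HS & Hsat). rewrite Forall_forall in Hwf. specialize (Hwf S HS).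
  set (e := nenv _ x' y') in *.
  destruct (defect_list e S) as (L & HL & Hdef).
  assert (HLr : length (map Z.abs L) < r).
  { rewrite length_map. pose proof (total_length_in HS). lia. }
  destruct Hm as (E & mu & HE & Hmu & Hinj & Hlam).
  assert (Hk : forall l, exists ki : nat -> nat, forall i, ki i < r /\
            (l < m -> i < N -> ~ In (mu l i (ki i)) (map Z.abs L))).
  { intros l. apply (choice (fun i j => j < r /\
      (l < m -> i < N -> ~ In (mu l i j) (map Z.abs L)))). intros i.
    destruct (classic (l < m /\ i < N)) as [[Hl Hi]|Hno].
    - destruct (@avoid (mu l i) (map Z.abs L)) as (j & Hj & Hav); [|exact HLr|].
      + intros j j'. now apply Hinj.
      + exists j. auto.
    (* Any default below r will do for a variable outside the system. *)
    - exists 0. split; [lia|]. intros H1 H2. tauto. }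
  apply choice in Hk. destruct Hk as [kappa Hk].
  destruct (Hlam kappa) as (lam & Ho & H0 & Hsupp & HP & Hxy); [intros; apply Hk|].
  assert (HLl : forall n, In n L -> lam n = gone).
  { intros n Hn. apply NNPP. intros Hne. destruct (Hsupp n Hne) as (l & i & Hl & Hi & Ha).
    apply (proj2 (Hk l i) Hl Hi). rewrite <- Ha. now apply in_map. }
  specialize (Hdef lam Ho H0 HLl).
  exists (fun l i => if excluded_middle_informative (l < m /\ i < N)
                     then rho theta lam (y' l i) else gone).
  split.
  - intros l i. destruct (excluded_middle_informative _) as [[Hl Hi]|]; [|apply P_one].
    now apply Hxy.
  - apply Exists_exists. exists S. split; [exact HS|].
    rewrite Forall_forall in *. intros w Hw. specialize (Hdef w Hw). rewrite (Hsat w Hw) in Hdef.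
    rewrite rho_one in Hdef by exact theta_hom. rewrite Hdef.
    eapply eval_ext; [exact (Hwf w Hw)|].
    intros [i|l i|l i|i] [Hv Hi]; simpl in *.
    + symmetry. apply rho_fpC.
    + symmetry. now apply Hxy.
    + destruct (excluded_middle_informative _); [reflexivity|tauto].
    + destruct Hv.
Qed.
End Merzlyakov.

(** * One word encoding a positive system *)

Definition wcomm {X : Type} (u v : word X) : word X := u ++ v ++ winv u ++ winv v.

Lemma eval_wcomm (X : Type) (G : group) (a : X -> G) u v :
  eval a (wcomm u v) = gone <-> gmul (eval a u) (eval a v) = gmul (eval a v) (eval a u).
Proof.
  unfold wcomm. rewrite !eval_app, !eval_winv. split; intros H.
  - apply (@gcancel_r _ (gmul (ginv (eval a u)) (ginv (eval a v)))). gsimp. exact H.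
  - rewrite (gmulA G (eval a u)), H. now gsimp.
Qed.

Definition senv {G : group} (e : nvar -> G) (zeta : nat -> G) (v : nvar + nat) : G :=
  match v with inl v => e v | inr c => zeta c end.

Definition wleft (w : word nvar) : word (nvar + nat) := subst (fun v => [(inl v, false)]) w.

(** Every equation gets a letter of its own, and the value 1 of that letter switches its commutator
    off. *)
Fixpoint conj_word (n : nat) (s : list (word nvar)) : word (nvar + nat) :=
  match s with
  | [] => []
  | w :: s' => wcomm [(inr n, false)] (wleft w) ++ conj_word (S n) s'
  end.

(** A commutator is trivial as soon as one entry is; the fresh conjugator [k] makes the converse
    true in the free product, by [fp_noncommute]. The empty disjunction becomes a free letter, which
    can take a non-trivial value. *)
Fixpoint disj_word (n : nat) (sys : list (list (word nvar))) : word (nvar + nat) :=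
  match sys with
  | [] => [(inr n, false)]
  | s :: rest => let k := n + length s in
      wcomm (conj_word n s) ([(inr k, false)] ++ disj_word (S k) rest ++ [(inr k, true)])
  end.

Fixpoint conjprod_word (q r : nat) (u : word (nvar + nat)) : word (nvar + nat) :=
  match r with
  | O => []
  | S r' => [(inr q, false)] ++ u ++ [(inr q, true)] ++ conjprod_word (S q) r' u
  end.

(* Trivial wherever the system holds; if the system fails in [fp C], its values include
   [conjprod r w zeta] for some [w <> 1] and all [zeta]. *)
Definition test_word (r : nat) (sys : list (list (word nvar))) : word (nvar + nat) :=
  conjprod_word 0 r (disj_word r sys).

Definition holds {G : group} (sys : list (list (word nvar))) (e : nvar -> G) : Prop :=
  Exists (Forall (fun w => eval e w = gone)) sys.

Lemma eval_wleft (G : group) (e : nvar -> G) zeta w : eval (senv e zeta) (wleft w) = eval e w.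
Proof. unfold wleft. rewrite eval_subst. apply eval_eq. intros v; simpl. now gsimp. Qed.

Lemma conj_word_true (G : group) (e : nvar -> G) zeta n s :
  Forall (fun w => eval e w = gone) s -> eval (senv e zeta) (conj_word n s) = gone.
Proof.
  intros H. revert n. induction H as [|w s Hw Hs IH]; intros n; [reflexivity|].
  cbn [conj_word]. rewrite eval_app, IH.
  replace (eval _ (wcomm _ _)) with (gone : G); [now gsimp|].
  symmetry. apply eval_wcomm. rewrite eval_wleft, Hw. now gsimp.
Qed.

Lemma disj_word_true (G : group) (e : nvar -> G) zeta n sys :
  holds sys e -> eval (senv e zeta) (disj_word n sys) = gone.
Proof.
  intros H. revert n. induction H as [s sys H|s sys H IH]; intros n; cbn [disj_word];
    apply eval_wcomm.
  - rewrite conj_word_true by exact H. now gsimp.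
  - rewrite !eval_app, IH. simpl. now gsimp.
Qed.

Lemma eval_conjprod_word (G : group) (a : nvar + nat -> G) q r u :
  eval a (conjprod_word q r u) = conjprod r (eval a u) (fun c => a (inr (q + c))).
Proof.
  revert q. induction r as [|r IH]; intros q; [reflexivity|].
  cbn [conjprod_word conjprod]. rewrite !eval_app, IH. simpl. rewrite Nat.add_0_r.
  unfold gconj. gsimp. do 4 f_equal. apply functional_extensionality. intros c.
  now rewrite Nat.add_succ_r.
Qed.

Lemma conjprod_one (G : group) r (zeta : nat -> G) : conjprod r gone zeta = gone.
Proof.
  revert zeta. induction r as [|r IH]; intros zeta; simpl; [reflexivity|].
  rewrite IH. unfold gconj. now gsimp.
Qed.

Lemma test_word_true (G : group) (e : nvar -> G) zeta r sys :
  holds sys e -> eval (senv e zeta) (test_word r sys) = gone.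
Proof.
  intros H. unfold test_word. rewrite eval_conjprod_word, disj_word_true by exact H.
  apply conjprod_one.
Qed.

Definition sletter (A : nvar -> Prop) (B : nat -> Prop) (v : nvar + nat) : Prop :=
  match v with inl v => A v | inr c => B c end.

Lemma letters_wcomm (X : Type) (A : X -> Prop) u v :
  letters_in A u -> letters_in A v -> letters_in A (wcomm u v).
Proof.
  intros Hu Hv. unfold wcomm. rewrite !letters_in_app.
  repeat split; auto using letters_in_winv.
Qed.

Lemma letters_conj_word (A : nvar -> Prop) (B : nat -> Prop) n s : Forall (letters_in A) s ->
  (forall c, n <= c < n + length s -> B c) -> letters_in (sletter A B) (conj_word n s).
Proof.
  intros H. revert n. induction H as [|w s Hw Hs IH]; intros n HB; [constructor|].
  cbn [conj_word]. apply letters_in_app. split.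
  - apply letters_wcomm.
    + repeat constructor. simpl. apply HB. simpl. lia.
    + apply letters_in_subst with A; [exact Hw|]. intros v Hv. repeat constructor. exact Hv.
  - apply IH. intros c Hc. apply HB. simpl. lia.
Qed.

Lemma letters_disj_word (A : nvar -> Prop) (B : nat -> Prop) n sys :
  Forall (Forall (letters_in A)) sys ->
  (forall c, n <= c -> B c) -> letters_in (sletter A B) (disj_word n sys).
Proof.
  intros H. revert n. induction H as [|s sys Hs Hsys IH]; intros n HB; cbn [disj_word].
  - repeat constructor. simpl. auto.
  - apply letters_wcomm.
    + apply letters_conj_word; [exact Hs|]. intros c Hc. apply HB. lia.
    + rewrite !letters_in_app. repeat split.
      * repeat constructor. simpl. apply HB. lia.
      * apply IH. intros c Hc. apply HB. lia.
      * repeat constructor. simpl. apply HB. lia.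
Qed.

Lemma letters_test_word (A : nvar -> Prop) r sys :
  Forall (Forall (letters_in A)) sys ->
  letters_in (sletter A (fun _ => True)) (test_word r sys).
Proof.
  intros H. unfold test_word.
  assert (Hu : letters_in (sletter A (fun _ => True)) (disj_word r sys))
    by (apply letters_disj_word; auto).
  generalize 0. revert Hu. generalize (disj_word r sys). intros u Hu.
  induction r as [|r IH]; intros q; cbn [conjprod_word]; [constructor|].
  rewrite !letters_in_app. repeat split; auto; repeat constructor.
Qed.

Section TestWord.
Variable C : group.
Hypothesis C_big : big C.
Variable e : nvar -> fp C.

Let trivially_in (S : list (list (word nvar))) : Forall (Forall (letters_in (fun _ => True))) S.
Proof. repeat (apply Forall_forall; intros); exact I. Qed.

(** The last failing equation is isolated: earlier letters are set to 1, later commutators are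
    trivial anyway, and its own letter becomes a conjugate of its value that does not commute with
    it. *)
Lemma conj_word_nontrivial n s : ~ Forall (fun w => eval e w = gone) s ->
  exists zeta, eval (senv e zeta) (conj_word n s) <> gone.
Proof.
  revert n. induction s as [|w s IH]; intros n Hn; [exfalso; apply Hn; constructor|].
  cbn [conj_word]. destruct (classic (Forall (fun w => eval e w = gone) s)) as [Hs|Hs].
  - assert (Hw : eval e w <> gone) by (intros Hw; apply Hn; now constructor).
    destruct (fp_noncommute C_big Hw Hw) as [g Hg].
    exists (fun _ => gconj g (eval e w)). rewrite eval_app, (conj_word_true _ _ Hs), gmul1r.
    rewrite eval_wcomm, eval_wleft. cbn [eval senv]. rewrite gmul1r. congruence.
  - destruct (IH (S n) Hs) as [zeta Hz]. exists (upd zeta n gone). rewrite eval_app.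
    replace (eval _ (wcomm _ _)) with (gone : fp C).
    + rewrite gmul1l. intros H. apply Hz. rewrite <- H.
      apply eval_ext with (A := sletter (fun _ => True) (fun c => n < c)).
      * apply letters_conj_word; [|intros; lia].
        apply Forall_forall; intros; apply Forall_forall; intros; exact I.
      * intros [v|c] Hc; simpl in *; [reflexivity|]. unfold upd.
        destruct (Nat.eqb_spec c n); [lia|reflexivity].
    + symmetry. apply eval_wcomm. cbn [eval senv]. unfold upd. rewrite Nat.eqb_refl. now gsimp.
Qed.

Lemma disj_word_nontrivial n sys : ~ holds sys e ->
  exists zeta, eval (senv e zeta) (disj_word n sys) <> gone.
Proof.
  revert n. induction sys as [|s sys IH]; intros n Hn; cbn [disj_word].
  - exists (fun _ => fpB C 1). cbn [eval senv]. intros H.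
    rewrite gmul1r in H. apply (f_equal (@proj1_sig _ _)) in H. simpl in H.
    rewrite bact_nil in H by lia. discriminate.
  - set (k := n + length s).
    destruct (@conj_word_nontrivial n s) as [z1 H1];
      [intros H; apply Hn; now constructor|].
    destruct (IH (S k)) as [z2 H2]; [intros H; apply Hn; now constructor|].
    destruct (fp_noncommute C_big H1 H2) as [g Hg].
    exists (fun c => if Nat.ltb c k then z1 c else if Nat.eqb c k then g else z2 c).
    set (z := fun c => _). intros H. apply eval_wcomm in H. apply Hg.
    assert (E1 : eval (senv e z) (conj_word n s) = eval (senv e z1) (conj_word n s)).
    { apply eval_ext with (A := sletter (fun _ => True) (fun c => c < k)).
      - apply letters_conj_word; [|intros; lia].
        apply Forall_forall; intros; apply Forall_forall; intros; exact I.
      - intros [v|c] Hc; simpl in *; [reflexivity|]. unfold z.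
        destruct (Nat.ltb_spec c k); [reflexivity|lia]. }
    assert (E2 : eval (senv e z) (disj_word (S k) sys) = eval (senv e z2) (disj_word (S k) sys)).
    { apply eval_ext with (A := sletter (fun _ => True) (fun c => k < c)).
      - apply letters_disj_word; [apply trivially_in|intros; lia].
      - intros [v|c] Hc; simpl in *; [reflexivity|]. unfold z.
        destruct (Nat.ltb_spec c k); [lia|]. destruct (Nat.eqb_spec c k); [lia|reflexivity]. }
    rewrite E1, !eval_app, E2 in H.
    assert (E3 : z k = g).
    { unfold z. rewrite Nat.ltb_irrefl. now rewrite Nat.eqb_refl. }
    cbn [eval senv] in H. rewrite E3, !gmul1r in H. exact H.
Qed.

(** The letters below r are the conjugators and those from r on belong to [disj_word]. Since the two
    sets are disjoint, w is fixed before the conjugators are chosen. *)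
Lemma test_word_generic r sys : ~ holds sys e ->
  exists w, w <> gone /\ forall zeta, exists zeta',
    eval (senv e zeta') (test_word r sys) = conjprod r w zeta.
Proof.
  intros H. destruct (disj_word_nontrivial r H) as [z0 H0].
  exists (eval (senv e z0) (disj_word r sys)). split; [exact H0|]. intros zeta.
  exists (fun c => if Nat.ltb c r then zeta c else z0 c).
  unfold test_word. rewrite eval_conjprod_word.
  replace (eval _ (disj_word r sys)) with (eval (senv e z0) (disj_word r sys)).
  - generalize (eval (senv e z0) (disj_word r sys)). intros w. cbn [senv].
    assert (Hext : forall r' (a b : nat -> fp C), (forall c, c < r' -> a c = b c) ->
              conjprod r' w a = conjprod r' w b).
    { clear. induction r' as [|r' IH]; intros a b Hab; [reflexivity|]. cbn [conjprod].
      rewrite (Hab 0) by lia. f_equal. apply IH. intros c Hc. apply Hab. lia. }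
    apply Hext. intros c Hc. change (0 + c) with c. destruct (Nat.ltb_spec c r); [reflexivity|lia].
  - symmetry. apply eval_ext with (A := sletter (fun _ => True) (fun c => r <= c)).
    + apply letters_disj_word; [apply trivially_in|intros; lia].
    + intros [v|c] Hc; simpl in *; [reflexivity|].
      destruct (Nat.ltb_spec c r); [lia|reflexivity].
Qed.
End TestWord.

(** * Games *)

(** An arbitrary winning condition in place of the system of [qsat] allows games to be
    concatenated. *)
Fixpoint game {G : group} (k l : nat) (xs ys : nat -> nat -> G)
    (W : (nat -> nat -> G) -> (nat -> nat -> G) -> Prop) : Prop :=
  match k with
  | O => W xs ys
  | S k' => forall f, exists g, game k' (S l) (upd xs l f) (upd ys l g) W
  end.

Lemma qsat_game (G : group) sys (z : nat -> G) k l xs ys :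
  qsat sys z k l xs ys <-> game k l xs ys (fun xs ys => holds sys (nenv z xs ys)).
Proof.
  revert l xs ys. induction k as [|k IH]; intros l xs ys; simpl; [reflexivity|].
  split; intros H f; destruct (H f) as [g Hg]; exists g; now apply IH.
Qed.

Lemma game_add (G : group) k k' l (xs ys : nat -> nat -> G) W :
  game (k + k') l xs ys W <-> game k l xs ys (fun xs ys => game k' (k + l) xs ys W).
Proof.
  revert l xs ys. induction k as [|k IH]; intros l xs ys; simpl; [reflexivity|].
  split; intros H f; destruct (H f) as [g Hg]; exists g.
  - apply IH in Hg. now rewrite <- Nat.add_succ_r.
  - apply IH. now rewrite Nat.add_succ_r.
Qed.

Definition agree {T : Type} (l : nat) (xs xs' : nat -> T) : Prop :=
  forall l', l' < l -> xs' l' = xs l'.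

Lemma upd_eq (T : Type) (a : nat -> T) n g : upd a n g n = g.
Proof. unfold upd. now rewrite Nat.eqb_refl. Qed.

Lemma upd_ne (T : Type) (a : nat -> T) n k g : k <> n -> upd a n g k = a k.
Proof. intros H. unfold upd. destruct (Nat.eqb_spec k n); [lia|reflexivity]. Qed.

Lemma agree_upd (T : Type) l (xs xs' : nat -> T) f :
  agree l xs xs' -> agree (S l) (upd xs l f) (upd xs' l f).
Proof.
  intros H l' Hl'. unfold upd. destruct (Nat.eqb_spec l' l); [reflexivity|apply H; lia].
Qed.

Lemma holds_ext (G : group) (A : nvar -> Prop) sys (e e' : nvar -> G) :
  Forall (Forall (letters_in A)) sys -> (forall v, A v -> e v = e' v) ->
  holds sys e -> holds sys e'.
Proof.
  intros Hwf He H. unfold holds in *. rewrite Exists_exists in *.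
  destruct H as (s & Hs & H). exists s. split; [exact Hs|].
  rewrite Forall_forall in *. specialize (Hwf s Hs). rewrite Forall_forall in Hwf.
  intros w Hw. rewrite <- (H w Hw). symmetry. now apply eval_ext with (1 := Hwf w Hw).
Qed.

Lemma holds_hom (G H : group) (f : G -> H) sys (e : nvar -> G) :
  is_hom f -> holds sys e -> holds sys (fun v => f (e v)).
Proof.
  intros Hf. apply Exists_impl. intros s. apply Forall_impl. intros w Hw.
  now rewrite <- (eval_hom _ _ Hf), Hw, (hom_one Hf).
Qed.

Lemma qsat_indep (G : group) (psi : nfform) (z : nat -> G) k l xs ys xs' ys' :
  nf_wf psi -> k + l = nf_m psi -> agree l xs xs' -> agree l ys ys' ->
  qsat (nf_sys psi) z k l xs ys -> qsat (nf_sys psi) z k l xs' ys'.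
Proof.
  intros Hwf. revert l xs ys xs' ys'. induction k as [|k IH]; intros l xs ys xs' ys' Hk Hx Hy.
  - apply (holds_ext Hwf). intros [i|l' i|l' i|i] Hv; simpl in *; try reflexivity.
    + rewrite Hx by lia. reflexivity.
    + rewrite Hy by lia. reflexivity.
  - intros H f. destruct (H f) as [g Hg]. exists g.
    apply IH with (4 := Hg); [lia|now apply agree_upd|now apply agree_upd].
Qed.

Definition pair (i c : nat) : nat := Cantor.to_nat (i, c).
Definition unpair (n : nat) : nat * nat := Cantor.of_nat n.

Lemma unpair_pair i c : unpair (pair i c) = (i, c).
Proof. apply Cantor.cancel_of_to. Qed.

(* The [i]-th of the copies of a game that are played in parallel from level [base] on. *)
Definition copy {T : Type} (base i : nat) (xs : nat -> nat -> T) : nat -> nat -> T :=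
  fun s c => xs (base + s) (pair i c).

Lemma copy_upd (T : Type) base i s (xs : nat -> nat -> T) f :
  copy base i (upd xs (base + s) f) = upd (copy base i xs) s (fun c => f (pair i c)).
Proof.
  apply functional_extensionality; intros s'. apply functional_extensionality; intros c.
  unfold copy, upd. destruct (Nat.eqb_spec s' s) as [->|H].
  - now rewrite Nat.eqb_refl.
  - destruct (Nat.eqb_spec (base + s') (base + s)); [lia|reflexivity].
Qed.

Definition lmap {S T : Type} (f : S -> T) (xs : nat -> nat -> S) : nat -> nat -> T :=
  fun l i => f (xs l i).

Lemma lmap_upd (S T : Type) (h : S -> T) xs l f :
  lmap h (upd xs l f) = upd (lmap h xs) l (fun i => h (f i)).
Proof.
  apply functional_extensionality; intros s'. apply functional_extensionality; intros c.
  unfold lmap, upd. now destruct (Nat.eqb s' l).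
Qed.

(** A level quantifies a tuple indexed by all natural numbers, so infinitely many copies fit into
    the same levels. The strategy in [Q] runs in every copy, and its answers are lifted along
    [p]. *)
Lemma parallel_win (E Q : group) (p : E -> Q) (sys : list (list (word nvar))) (zq : nat -> Q)
    base k s (xs ys : nat -> nat -> E) W :
  (forall q, exists e, p e = q) ->
  (forall i, qsat sys zq k s (lmap p (copy base i xs)) (lmap p (copy base i ys))) ->
  (forall xs' ys', agree (base + s) xs xs' -> agree (base + s) ys ys' ->
    (forall i, holds sys (nenv zq (lmap p (copy base i xs')) (lmap p (copy base i ys')))) ->
    W xs' ys') ->
  game k (base + s) xs ys W.
Proof.
  intros Hp. revert s xs ys. induction k as [|k IH]; intros s xs ys Hq HW.
  - apply HW; [intros l' _; reflexivity|intros l' _; reflexivity|exact Hq].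
  - intros f.
    assert (Hg : forall i, exists g : nat -> E,
      qsat sys zq k (S s) (lmap p (copy base i (upd xs (base + s) f)))
        (upd (lmap p (copy base i ys)) s (fun c => p (g c)))).
    { intros i. destruct (Hq i (fun c => p (f (pair i c)))) as [g Hg].
      assert (Hl : forall c, exists e, p e = g c) by (intros; apply Hp).
      apply choice in Hl. destruct Hl as [g' Hg']. exists g'.
      rewrite copy_upd, lmap_upd.
      replace (fun c => p (g' c)) with g; [exact Hg|].
      apply functional_extensionality. intros c. now rewrite Hg'. }
    apply choice in Hg. destruct Hg as [g Hg].
    set (g0 := fun n => g (fst (unpair n)) (snd (unpair n))). exists g0.
    rewrite <- Nat.add_succ_r. apply IH.
    + intros i. specialize (Hg i).
      rewrite (copy_upd _ _ _ ys), (lmap_upd _ (copy base i ys)).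
      replace (fun c => p (g0 (pair i c))) with (fun c => p (g i c)); [exact Hg|].
      apply functional_extensionality. intros c. unfold g0. now rewrite unpair_pair.
    + intros xs' ys' Hx Hy H. apply HW; [| |exact H]; intros l' Hl'.
      * rewrite Hx by lia. apply upd_ne. lia.
      * rewrite Hy by lia. apply upd_ne. lia.
Qed.

(** Classically, a game that is not won has a refuting strategy; the strategies of all copies are
    merged into one tuple per level. *)
Lemma parallel_refute (H : group) (sys : list (list (word nvar))) (z : nat -> H)
    base k s (xs ys : nat -> nat -> H) W :
  (forall i, ~ qsat sys z k s (copy base i xs) (copy base i ys)) ->
  game k (base + s) xs ys W ->
  exists xs' ys', W xs' ys' /\ agree (base + s) xs xs' /\ agree (base + s) ys ys' /\
    forall i, ~ holds sys (nenv z (copy base i xs') (copy base i ys')).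
Proof.
  revert s xs ys. induction k as [|k IH]; intros s xs ys Hq Hg.
  - exists xs, ys. repeat split; auto.
  - assert (Hf : forall i, exists f, forall g,
      ~ qsat sys z k (S s) (upd (copy base i xs) s f) (upd (copy base i ys) s g)).
    { intros i. apply NNPP. intros Hn. apply (Hq i). intros f. apply NNPP. intros Hn'.
      apply Hn. exists f. intros g Hg'. apply Hn'. now exists g. }
    apply choice in Hf. destruct Hf as [f Hf].
    destruct (Hg (fun n => f (fst (unpair n)) (snd (unpair n)))) as [g Hg'].
    rewrite <- Nat.add_succ_r in Hg'. apply IH in Hg'.
    + destruct Hg' as (xs' & ys' & HW & Hx & Hy & Hh). exists xs', ys'.
      split; [exact HW|split; [|split; [|exact Hh]]]; intros l' Hl'.
      * rewrite Hx by lia. apply upd_ne. lia.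
      * rewrite Hy by lia. apply upd_ne. lia.
    + intros i. rewrite !copy_upd.
      replace (fun c => f _ _) with (f i); [apply Hf|].
      apply functional_extensionality. intros c. now rewrite unpair_pair.
Qed.

(** * The combined formula *)

Section Combine.
Variables (r : nat) (psi1 psi2 : nfform).
Hypotheses (wf1 : nf_wf psi1) (wf2 : nf_wf psi2).

Let m1 := nf_m psi1.
Let m2 := nf_m psi2.
(** One level of [psi1] becomes a block: [m2] levels for the parallel runs of [psi2], then one level
    whose universal part holds the extra letters of the test words and whose existential part holds
    the answers y of [psi1]. *)
Let B := S m2.

(** All copies of [psi2] share the odd parameters; [placed] gives the even ones to [psi1]. *)
Definition place (l i : nat) (v : nvar + nat) : nvar :=
  match v with
  | inl (VZ k) => VZ (2 * k + 1)
  | inl (VX s c) => VX (l * B + s) (pair i c)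
  | inl (VY s c) => VY (l * B + s) (pair i c)
  | inl (VV k) => VV k
  | inr c => VX (l * B + m2) (pair i c)
  end.

Definition placed (v : nvar) : word nvar :=
  match v with
  | VZ k => [(VZ (2 * k), false)]
  | VX l i => subst (fun u => [(place l i u, false)]) (test_word r (nf_sys psi2))
  | VY l i => [(VY (l * B + m2) i, false)]
  | VV k => [(VV k, false)]
  end.

Definition combine : nfform :=
  NFForm (m1 * B) (map (map (subst placed)) (nf_sys psi1)).

Lemma letters_single (X : Type) (A : X -> Prop) x b : A x -> letters_in A [(x, b)].
Proof. intros H. now constructor. Qed.

Lemma combine_wf : nf_wf combine.
Proof.
  unfold nf_wf. simpl. apply Forall_map. eapply Forall_impl; [|exact wf1].
  intros s Hs. apply Forall_map. eapply Forall_impl; [|exact Hs].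
  intros w Hw. apply letters_in_subst with (1 := Hw).
  intros [k|l i|l i|k] Hv; simpl in Hv; fold m1 in Hv.
  - now apply letters_single.
  - apply letters_in_subst with (1 := letters_test_word r wf2).
    intros [[k|t c|t c|k]|c] Hu; simpl in Hu; apply letters_single; simpl;
      try fold m2 in Hu; try exact Hu; unfold B; nia.
  - apply letters_single. simpl. unfold B. nia.
  - destruct Hv.
Qed.

Section Values.
Variables (G : group) (z : nat -> G).
Let zeven (k : nat) := z (2 * k).
Let zodd (k : nat) := z (2 * k + 1).

Definition xval (xs ys : nat -> nat -> G) (l i : nat) : G :=
  eval (senv (nenv zodd (copy (l * B) i xs) (copy (l * B) i ys))
          (fun c => xs (l * B + m2) (pair i c))) (test_word r (nf_sys psi2)).

Definition yval (ys : nat -> nat -> G) (l i : nat) : G := ys (l * B + m2) i.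

Lemma eval_placed xs ys w :
  eval (nenv z xs ys) (subst placed w) = eval (nenv zeven (xval xs ys) (yval ys)) w.
Proof.
  rewrite eval_subst. apply eval_eq. intros [k|l i|l i|k]; cbn [placed nenv].
  - apply gmul1r.
  - rewrite eval_subst. apply eval_eq.
    intros [[k|t c|t c|k]|c]; simpl; apply gmul1r.
  - apply gmul1r.
  - apply gmul1r.
Qed.

Lemma holds_placed xs ys :
  holds (nf_sys combine) (nenv z xs ys) <-> holds (nf_sys psi1) (nenv zeven (xval xs ys) (yval ys)).
Proof.
  unfold holds. simpl. rewrite Exists_map.
  split; apply Exists_impl; intros s; rewrite Forall_map; apply Forall_impl; intros w;
    now rewrite eval_placed.
Qed.

Lemma xval_ext xs ys xs' ys' l i : agree (S l * B) xs xs' -> agree (l * B + m2) ys ys' ->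
  xval xs' ys' l i = xval xs ys l i.
Proof.
  intros Hx Hy. apply eval_ext with (1 := letters_test_word r wf2).
  intros [[k|t c|t c|k]|c] Hu; simpl in Hu; simpl; try reflexivity; unfold copy.
  - rewrite Hx; [reflexivity|]. fold m2 in Hu. unfold B. nia.
  - rewrite Hy; [reflexivity|]. fold m2 in Hu. unfold B. nia.
  - rewrite Hx; [reflexivity|]. unfold B. nia.
Qed.

Lemma block_split k l (xs ys : nat -> nat -> G) W :
  game (S k * B) (l * B) xs ys W <->
  game m2 (l * B + 0) xs ys (fun xs ys : nat -> nat -> G => forall f, exists g,
    game (k * B) (S l * B) (upd xs (l * B + m2) f) (upd ys (l * B + m2) g) W).
Proof.
  replace (S k * B) with (m2 + S (k * B)) by (unfold B; lia).
  rewrite game_add, Nat.add_0_r. rewrite (Nat.add_comm m2 (l * B)). simpl game.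
  replace (S (l * B + m2)) with (S l * B) by (unfold B; lia). reflexivity.
Qed.
End Values.

Lemma combine_sat (K E Q : group) (i : K -> E) (p : E -> Q) (z : nat -> E) (zk : nat -> K) :
  short_exact i p -> (forall k, i (zk k) = z (2 * k)) ->
  nf_sat K psi1 zk -> nf_sat Q psi2 (fun k => p (z (2 * k + 1))) -> nf_sat E combine z.
Proof.
  intros (Hi & Hp & Hinj & Hsurj & Hker) Hzk H1 H2.
  unfold nf_sat. apply qsat_game. cbn [nf_m combine].
  assert (Main : forall k l (x y : nat -> nat -> K) (xs ys : nat -> nat -> E),
    k + l = m1 -> qsat (nf_sys psi1) zk k l x y ->
    (forall l' j, l' < l -> xval z xs ys l' j = i (x l' j) /\ yval ys l' j = i (y l' j)) ->
    game (k * B) (l * B) xs ys (fun xs ys => holds (nf_sys combine) (nenv z xs ys))).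
  { induction k as [|k IH]; intros l x y xs ys Hk Hq Hxy.
    - apply holds_placed. apply (holds_ext wf1) with (2 := holds_hom Hi Hq).
      intros [c|l' c|l' c|c] Hv; simpl in Hv; fold m1 in Hv; cbn [nenv].
      + apply Hzk.
      + symmetry. apply Hxy. lia.
      + symmetry. apply Hxy. lia.
      + destruct Hv.
    - apply block_split.
      apply (parallel_win (p := p) (sys := nf_sys psi2) (zq := fun k => p (z (2 * k + 1)))); [exact Hsurj| |].
      + intros j. apply qsat_indep with (5 := H2); [exact wf2|lia| |]; intros l' Hl'; lia.
      + intros xs1 ys1 Hx1 Hy1 Hh f. rewrite Nat.add_0_r in Hx1, Hy1.
        set (xs2 := upd xs1 (l * B + m2) f).
        assert (Hxl : forall j, exists c, i c = xval z xs2 ys1 l j).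
        { intros j. apply Hker. unfold xval. rewrite (eval_hom _ _ Hp).
          erewrite eval_eq; [apply (test_word_true
            (e := nenv (fun k => p (z (2 * k + 1))) (lmap p (copy (l * B) j xs2)) (lmap p (copy (l * B) j ys1)))
            (fun c => p (xs2 (l * B + m2) (pair j c))))|].
          - apply (holds_ext wf2) with (2 := Hh j).
            intros [v|t v|t v|v] Hv; simpl in Hv; fold m2 in Hv; try reflexivity.
            simpl. unfold lmap, copy, xs2. rewrite upd_ne by lia. reflexivity.
          - intros [[v|t v|t v|v]|v]; simpl; try reflexivity. now apply hom_one. }
        apply choice in Hxl. destruct Hxl as [c Hc].
        destruct (Hq c) as [g Hg]. exists (fun j => i (g j)).
        apply IH with (2 := Hg); [lia|]. intros l' j Hl'.
        destruct (Nat.eq_dec l' l) as [->|Hne].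
        * rewrite !upd_eq, Hc. split; [|unfold yval; now rewrite upd_eq].
          apply xval_ext; intros t Ht; [reflexivity|]. apply upd_ne. lia.
        * rewrite !upd_ne by assumption. destruct (Hxy l' j ltac:(lia)) as [<- <-].
          assert (S l' * B <= l * B) by (unfold B; nia). split.
          -- apply xval_ext; intros t Ht.
             ++ unfold xs2. rewrite upd_ne by lia. apply Hx1. lia.
             ++ rewrite upd_ne by (unfold B in *; lia). apply Hy1. unfold B in *; lia.
          -- unfold yval. rewrite upd_ne by (unfold B in *; lia). rewrite Hy1; [reflexivity|].
             unfold B in *; lia. }
  apply (Main m1 0 (fun _ _ => gone) (fun _ _ => gone) (fun _ _ => gone) (fun _ _ => gone));
    [lia|exact H1|intros; lia].
Qed.

Lemma combine_wgame (C : group) (z : nat -> fp C) : big C ->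
  ~ nf_sat (fp C) psi2 (fun k => z (2 * k + 1)) -> nf_sat (fp C) combine z ->
  exists x y, wgame r (nf_sys psi1) (fun k => z (2 * k)) m1 0 x y.
Proof.
  intros HC Hno Hsat.
  assert (Main : forall k l (x y xs ys : nat -> nat -> fp C), k + l = m1 ->
    game (k * B) (l * B) xs ys (fun xs ys => holds (nf_sys combine) (nenv z xs ys)) ->
    (forall l' j, l' < l -> xval z xs ys l' j = x l' j /\ yval ys l' j = y l' j) ->
    wgame r (nf_sys psi1) (fun k => z (2 * k)) k l x y).
  { induction k as [|k IH]; intros l x y xs ys Hk Hg Hxy.
    - apply holds_placed in Hg. apply (holds_ext wf1) with (2 := Hg).
      intros [c|l' c|l' c|c] Hv; simpl in Hv; fold m1 in Hv; cbn [nenv].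
      + reflexivity.
      + apply Hxy. lia.
      + apply Hxy. lia.
      + destruct Hv.
    - apply block_split in Hg.
      apply (parallel_refute (sys := nf_sys psi2) (z := fun k => z (2 * k + 1))) in Hg.
      2:{ intros j Hq. apply Hno.
          apply qsat_indep with (5 := Hq); [exact wf2|fold m2; lia| |]; intros l' Hl'; lia. }
      destruct Hg as (xs1 & ys1 & Hg & Hx1 & Hy1 & Hh). rewrite Nat.add_0_r in Hx1, Hy1.
      (* The refuted runs determine the elements [w], and the conjugators come on the next level, as
         [wgame] demands. *)
      assert (Hw := fun j => test_word_generic HC r (Hh j)).
      apply choice in Hw. destruct Hw as [w Hw]. exists w. split; [intros j; apply Hw|].
      intros zeta.
      assert (Hz : forall j, exists zeta', eval (senv (nenv (fun k => z (2 * k + 1))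
          (copy (l * B) j xs1) (copy (l * B) j ys1)) zeta') (test_word r (nf_sys psi2)) =
          conjprod r (w j) (zeta j)) by (intros j; apply Hw).
      apply choice in Hz. destruct Hz as [zeta' Hz].
      destruct (Hg (fun n => zeta' (fst (unpair n)) (snd (unpair n)))) as [g Hg'].
      exists g. apply IH with (2 := Hg'); [lia|]. intros l' j Hl'.
      set (f := fun n => _).
      destruct (Nat.eq_dec l' l) as [->|Hne].
      + rewrite !upd_eq. split; [|unfold yval; now rewrite upd_eq].
        rewrite <- Hz. apply eval_ext with (1 := letters_test_word r wf2).
        intros [[v|t v|t v|v]|v] Hv; simpl in Hv; try fold m2 in Hv; simpl; try reflexivity;
          unfold copy.
        * now rewrite upd_ne by lia.
        * now rewrite upd_ne by lia.
        * rewrite upd_eq. unfold f. now rewrite unpair_pair.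
      + rewrite !upd_ne by assumption. destruct (Hxy l' j ltac:(lia)) as [<- <-].
        assert (S l' * B <= l * B) by (unfold B; nia). split.
        -- apply xval_ext; intros t Ht.
           ++ rewrite upd_ne by lia. apply Hx1. lia.
           ++ rewrite upd_ne by (unfold B in *; lia). apply Hy1. unfold B in *; lia.
        -- unfold yval. rewrite upd_ne by (unfold B in *; lia). rewrite Hy1; [reflexivity|].
           unfold B in *; lia. }
  unfold nf_sat in Hsat. apply qsat_game in Hsat.
  exists (fun _ _ => gone), (fun _ _ => gone).
  apply (Main m1 0 _ _ (fun _ _ => gone) (fun _ _ => gone)); [lia|exact Hsat|intros; lia].
Qed.
End Combine.

(** * Formal solutions as solutions in a presented group *)

Lemma subst_eq (X Y : Type) (f g : X -> word Y) w : (forall x, f x = g x) -> subst f w = subst g w.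
Proof. intros H. f_equal. now apply functional_extensionality. Qed.

Lemma letters_all (X : Type) (w : word X) : letters_in (fun _ => True) w.
Proof. apply Forall_forall. intros; exact I. Qed.

Definition ren {X Y : Type} (f : X -> Y) (w : word X) : word Y := subst (fun x => [(f x, false)]) w.

Lemma map_ren (X Y : Type) (f : X -> Y) (w : word X) : map (fun c => (f (fst c), snd c)) w = ren f w.
Proof.
  induction w as [|[x b] w IH]; [reflexivity|]. simpl. rewrite IH. now destruct b.
Qed.

Lemma zword_ren w : zword w = ren VZ w.
Proof. apply (map_ren VZ). Qed.

Lemma eval_ren (X Y : Type) (G : group) (f : X -> Y) (a : Y -> G) w :
  eval a (ren f w) = eval (fun x => a (f x)) w.
Proof. unfold ren. rewrite eval_subst. apply eval_eq. intros x. apply gmul1r. Qed.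

Lemma subst_ren (X Y Z : Type) (f : X -> Y) (g : Y -> word Z) w :
  subst g (ren f w) = subst (fun x => g (f x)) w.
Proof.
  unfold ren. rewrite subst_subst. apply subst_eq. intros x. unfold subst; simpl.
  apply app_nil_r.
Qed.

Lemma ren_ren (X Y Z : Type) (f : X -> Y) (g : Y -> Z) w : ren g (ren f w) = ren (fun x => g (f x)) w.
Proof. apply subst_ren. Qed.

Lemma ren_id (X : Type) (f : X -> X) w : (forall x, f x = x) -> ren f w = w.
Proof. intros H. apply subst_letters with (1 := letters_all w). intros x _. now rewrite H. Qed.

Lemma letters_ren (X Y : Type) (A : X -> Prop) (B : Y -> Prop) (f : X -> Y) w :
  letters_in A w -> (forall x, A x -> B (f x)) -> letters_in B (ren f w).
Proof. intros Hw H. apply letters_in_subst with (1 := Hw). intros x Hx. apply letters_single; auto. Qed.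

Lemma free_trivial_ren (X Y : Type) (f : X -> Y) (g : Y -> X) w :
  (forall x, g (f x) = x) -> free_trivial (ren f w) -> free_trivial w.
Proof.
  intros H Hw. apply (freq_subst (fun y => [(g y, false)])) in Hw.
  change (freq (ren g (ren f w)) []) in Hw. rewrite ren_ren, ren_id in Hw; assumption.
Qed.

Lemma subst_y_subst alpha w :
  subst_y alpha w = subst (fun v => match v with VY l i => alpha l i | _ => [(v, false)] end) w.
Proof.
  unfold subst_y, subst. f_equal. apply map_ext. intros [[k|l i|l i|k] []]; reflexivity.
Qed.

Section FormalSolutions.
Variable Pi : list (word nvar).
Hypothesis Pi_dioph : Forall (letters_in dioph_letter) Pi.
Let M := presented Pi.

(** [Pi] mentions only the letters z and v, so no relation constrains these generators. *)
Definition gX (l i : nat) : presented Pi := pgen Pi (VX l i).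

(** The parameters are arbitrary elements [zM], because each half of a combined sentence sees only
    the even or only the odd letters z. *)
Definition solves (psi : nfform) (zM : nat -> M) (alpha : nat -> nat -> word nvar) : Prop :=
  (forall l i, l < nf_m psi -> letters_in (alpha_letter l) (alpha l i)) /\
  holds (nf_sys psi) (nenv zM gX (fun l i => eval (pgen Pi) (alpha l i))).

Lemma eval_subst_y (psi_m : nat) alpha w : letters_in (psi_letter psi_m) w ->
  eval (nenv (fun k => pgen Pi (VZ k)) gX (fun l i => eval (pgen Pi) (alpha l i))) w =
  eval (pgen Pi) (subst_y alpha w).
Proof.
  intros Hw. rewrite subst_y_subst, eval_subst. apply eval_ext with (1 := Hw).
  intros [k|l i|l i|k] Hv; cbn [nenv].
  - symmetry; apply gmul1r.
  - symmetry; apply gmul1r.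
  - reflexivity.
  - destruct Hv.
Qed.

Lemma formal_solution_solves psi alpha : nf_wf psi ->
  formal_solution psi Pi alpha <-> solves psi (fun k => pgen Pi (VZ k)) alpha.
Proof.
  intros Hwf. unfold formal_solution, solves, holds. rewrite !Exists_exists.
  unfold nf_wf in Hwf. rewrite Forall_forall in Hwf.
  split; intros [Ha (s & Hs & H)]; (split; [exact Ha|]); exists s; (split; [exact Hs|]);
    specialize (Hwf s Hs); rewrite Forall_forall in *; intros w Hw; specialize (H w Hw).
  - rewrite (eval_subst_y (psi_m := nf_m psi)) by auto. apply ncl_eval with (2 := H).
    apply Forall_forall. intros t Ht. apply eval_pgen_one. now apply ncl_rel.
  - rewrite (eval_subst_y (psi_m := nf_m psi)) in H by auto. apply eval_pgen_one in H.
    apply ncl_restrict with (3 := H).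
    + apply Forall_impl with (2 := proj2 (Forall_forall _ _) Pi_dioph). intros t.
      apply letters_in_impl. intros [k|l i|l i|k]; simpl; tauto.
    + rewrite subst_y_subst. apply letters_in_subst with (1 := Hwf w Hw).
      intros [k|l i|l i|k] Hv; simpl in Hv; try (apply letters_single; exact Hv); [|destruct Hv].
      apply letters_in_impl with (2 := Ha l i Hv).
      intros [k'|l' i'|l' i'|k']; simpl; lia || tauto.
Qed.

(** A formal solution is a strategy: answer with the value of [alpha] at the moves made so far. At
    the end the moves define a homomorphism from [M], which carries the generic solution to the
    play. It depends on the play, so the condition on [z] ranges over all [h] that agree with [e] on
    the letters of [Pi]. *)
Lemma solves_sat psi zM alpha (G : group) (e : nvar -> G) (z : nat -> G) :
  nf_wf psi -> solves psi zM alpha ->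
  Forall (fun s => eval e s = gone) Pi ->
  (forall h : M -> G, is_hom h -> (forall v, dioph_letter v -> h (pgen Pi v) = e v) ->
     forall k, h (zM k) = z k) ->
  nf_sat G psi z.
Proof.
  intros Hwf [Ha Hsol] He Hz. unfold nf_sat. apply qsat_game.
  set (env := fun (xs : nat -> nat -> G) v =>
    match v with VX l i => xs l i | VY _ _ => gone | _ => e v end).
  assert (Main : forall k l (xs ys : nat -> nat -> G), k + l = nf_m psi ->
    (forall l' i, l' < l -> ys l' i = eval (env xs) (alpha l' i)) ->
    game k l xs ys (fun xs ys => holds (nf_sys psi) (nenv z xs ys))).
  { induction k as [|k IH]; intros l xs ys Hk Hy.
    - destruct (presented_lift (S := Pi) (a := env xs)) as (h & Hh & Hw).
      { rewrite Forall_forall in *. intros s Hs. rewrite <- (He s Hs).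
        apply eval_ext with (1 := Pi_dioph s Hs).
        intros [v|t v|t v|v] Hv; simpl in *; tauto. }
      assert (Hg : forall v, h (pgen Pi v) = env xs v).
      { intros v. specialize (Hw [(v, false)]). cbn [eval] in Hw. now rewrite !gmul1r in Hw. }
      apply (holds_ext Hwf) with (2 := holds_hom Hh Hsol).
      intros [v|t v|t v|v] Hv; simpl in Hv; cbn [nenv].
      + apply Hz; [exact Hh|]. intros [u|t u|t u|u] Hu; simpl in Hu; try tauto; apply Hg.
      + apply Hg.
      + rewrite Hw. symmetry. apply Hy. lia.
      + destruct Hv.
    - intros f. exists (fun i => eval (env (upd xs l f)) (alpha l i)).
      apply IH; [lia|]. intros l' i Hl'. destruct (Nat.eq_dec l' l) as [->|Hne].
      + now rewrite upd_eq.
      + rewrite upd_ne, Hy by lia. apply eval_ext with (1 := Ha l' i ltac:(lia)).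
        intros [v|t v|t v|v] Hv; simpl in *; try reflexivity.
        rewrite upd_ne by lia. reflexivity. }
  apply Main; [lia|]. intros; lia.
Qed.

Lemma index_bound sys : exists N, Forall (Forall (letters_in (index_lt N))) sys.
Proof.
  assert (Hmono : forall N N' w, N <= N' -> letters_in (index_lt N) w -> letters_in (index_lt N') w).
  { intros N N' w H. apply letters_in_impl. intros [v|t v|t v|v]; simpl; lia || tauto. }
  assert (Hw : forall w, exists N, letters_in (index_lt N) w).
  { induction w as [|[v b] w (N & IH)]; [exists 0; constructor|].
    exists (N + S (match v with VX _ i | VY _ i => i | _ => 0 end)). constructor.
    - destruct v; simpl; lia || tauto.
    - apply Hmono with (2 := IH). lia. }
  assert (Hs : forall s, exists N, Forall (letters_in (index_lt N)) s).
  { induction s as [|w s (N & IH)]; [exists 0; constructor|]. destruct (Hw w) as [N' H'].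
    exists (N + N'). constructor; [apply Hmono with (2 := H'); lia|].
    eapply Forall_impl; [|exact IH]. intros u. apply Hmono. lia. }
  induction sys as [|s sys (N & IH)]; [exists 0; constructor|]. destruct (Hs s) as [N' H'].
  exists (N + N'). constructor.
  - eapply Forall_impl; [|exact H']. intros u. apply Hmono. lia.
  - eapply Forall_impl; [|exact IH]. intros s'. apply Forall_impl. intros u. apply Hmono. lia.
Qed.

Lemma qsat_wgame (C : group) r sys (z : nat -> fp C) k l x y :
  qsat sys z k l x y -> wgame r sys z k l x y.
Proof.
  revert l x y. induction k as [|k IH]; intros l x y; [exact (fun H => H)|].
  intros H. exists (fun _ => fpB C 1). split.
  - intros _ Hb. apply (f_equal (@proj1_sig _ _)) in Hb. simpl in Hb.
    rewrite bact_nil in Hb by lia. discriminate.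
  - intros zeta. destruct (H (fun i => conjprod r (fpB C 1) (zeta i))) as [g Hg].
    exists g. now apply IH.
Qed.

(** [below (S l)] coincides with [alpha_letter l]; the strict bound leaves no x-letters at level
    0. *)
Definition below (l : nat) (v : nvar) : Prop :=
  match v with VV _ | VZ _ => True | VX l' _ => l' < l | VY _ _ => False end.

Section Dichotomy.
Variables (C : group) (theta : C -> M) (z : nat -> C).
Hypothesis theta_hom : is_hom theta.
Hypothesis C_big : big C.
(** Coefficients may occur in answers of every level, so their images have to avoid all
    x-letters. *)
Hypothesis theta_dioph : forall c, exists w, letters_in dioph_letter w /\ eval (pgen Pi) w = theta c.

Lemma wgame_solves r psi (zc : nat -> C) x y : nf_wf psi -> 2 <= r ->
  6 * total_length (nf_sys psi) < r ->
  wgame r (nf_sys psi) (fun i => fpC (zc i)) (nf_m psi) 0 x y ->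
  exists alpha, solves psi (fun i => theta (zc i)) alpha.
Proof.
  intros Hwf Hr Hr' Hg. destruct (index_bound (nf_sys psi)) as [N HN].
  set (P := fun l (u : M) => exists w, letters_in (below l) w /\ eval (pgen Pi) w = u).
  destruct (@merzlyakov C M theta theta_hom C_big gX P) with
    (r := r) (N := N) (sys := nf_sys psi) (zc := zc) (m := nf_m psi) (x := x) (y := y)
    as (Y & HY & Hex).
  - intros l. exists []. split; [constructor|reflexivity].
  - intros l u v (w & Hw & <-) (w' & Hw' & <-). exists (w ++ w').
    split; [now apply letters_in_app|apply eval_app].
  - intros l u (w & Hw & <-). exists (winv w). split; [now apply letters_in_winv|apply eval_winv].
  - intros l c. destruct (theta_dioph c) as (w & Hw & Hc). exists w. split; [|exact Hc].
    apply letters_in_impl with (2 := Hw). intros [k|t k|t k|k]; simpl; tauto.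
  - intros l i. exists [(VX l i, false)]. split; [|apply gmul1r].
    apply letters_single. simpl. lia.
  - intros l u (w & Hw & Hu). exists w. split; [|exact Hu].
    apply letters_in_impl with (2 := Hw). intros [k|t k|t k|k]; simpl; lia || tauto.
  - exact Hr.
  - unfold nf_wf in Hwf. rewrite Forall_forall in Hwf, HN. apply Forall_forall. intros s Hs.
    specialize (Hwf s Hs). specialize (HN s Hs).
    rewrite Forall_forall in Hwf, HN. apply Forall_forall. intros w Hw.
    specialize (Hwf w Hw). specialize (HN w Hw). unfold letters_in in *.
    now apply Forall_and.
  - exact Hr'.
  - exact Hg.
  - assert (Ha : forall l, exists al : nat -> word nvar, forall i,
              letters_in (alpha_letter l) (al i) /\ eval (pgen Pi) (al i) = Y l i).
    { intros l.
      apply (choice (fun i w => letters_in (alpha_letter l) w /\ eval (pgen Pi) w = Y l i)).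
      intros i. destruct (HY l i) as (w & Hw & Hu). exists w. split; [|exact Hu].
      apply letters_in_impl with (2 := Hw). intros [k|t k|t k|k]; simpl; lia || tauto. }
    apply choice in Ha. destruct Ha as [alpha Ha]. exists alpha. split; [intros; apply Ha|].
    apply (holds_ext Hwf) with (2 := Hex). intros [k|t k|t k|k] _; try reflexivity.
    symmetry. apply Ha.
Qed.

Lemma combine_dichotomy r psi1 psi2 : nf_wf psi1 -> nf_wf psi2 ->
  2 + 6 * total_length (nf_sys psi1) + 6 * total_length (nf_sys psi2) <= r ->
  nf_sat (fp C) (combine r psi1 psi2) (fun i => fpC (z i)) ->
  (exists alpha, solves psi1 (fun k => theta (z (2 * k))) alpha) \/
  (exists alpha, solves psi2 (fun k => theta (z (2 * k + 1))) alpha).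
Proof.
  intros H1 H2 Hr Hsat.
  destruct (classic (nf_sat (fp C) psi2 (fun k => fpC (z (2 * k + 1))))) as [Hs|Hs].
  - right. apply (@wgame_solves r psi2 (fun k => z (2 * k + 1)) (fun _ _ => gone) (fun _ _ => gone));
      [exact H2|lia|lia|]. apply qsat_wgame. exact Hs.
  - left. destruct (combine_wgame H1 H2 C_big Hs Hsat) as (x & y & Hg).
    apply (@wgame_solves r psi1 (fun k => z (2 * k)) x y); [exact H1|lia|lia|exact Hg].
Qed.
End Dichotomy.
End FormalSolutions.

(** * Large coefficient groups *)

Definition Zgroup : group :=
  @Group Z Z.add Z.opp 0%Z Z.add_assoc Z.add_0_l Z.add_opp_diag_l.

Lemma Zgroup_big : big Zgroup.
Proof. intros a b. exists (Z.abs a + Z.abs b + 1)%Z. simpl in *. lia. Qed.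

Section Product.
Variables G H : group.
Definition prod_mul (x y : G * H) : G * H := (gmul (fst x) (fst y), gmul (snd x) (snd y)).
Definition prod_inv (x : G * H) : G * H := (ginv (fst x), ginv (snd x)).

Lemma prod_mulA x y z : prod_mul x (prod_mul y z) = prod_mul (prod_mul x y) z.
Proof. unfold prod_mul; simpl. now rewrite !gmulA. Qed.

Lemma prod_mul1l x : prod_mul (gone, gone) x = x.
Proof. unfold prod_mul; simpl. rewrite !gmul1l. now destruct x. Qed.

Lemma prod_mulVl x : prod_mul (prod_inv x) x = (gone, gone).
Proof. unfold prod_mul; simpl. now rewrite !gmulVl. Qed.

Definition prodg : group := @Group (G * H) prod_mul prod_inv (gone, gone) prod_mulA prod_mul1l prod_mulVl.
End Product.

(** The factor Z enlarges a possibly tiny group; the map to [M] simply forgets it. *)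
Lemma prodZ_big (G : group) : big (prodg G Zgroup).
Proof.
  intros [a1 a2] [b1 b2]. destruct (Zgroup_big a2 b2) as (c & H1 & H2).
  exists (gone, c). split; congruence.
Qed.

(** * Generic almost positive sentences *)

Definition even_var (k : nat) : nat := 2 * k.
Definition odd_var (k : nat) : nat := 2 * k + 1.

Lemma div2_even k : Nat.div2 (even_var k) = k.
Proof. apply Nat.div2_double. Qed.

Lemma div2_odd k : Nat.div2 (odd_var k) = k.
Proof. unfold odd_var. rewrite Nat.add_1_r. apply Nat.div2_succ_double. Qed.

Lemma even_even k : Nat.even (even_var k) = true.
Proof. unfold even_var. now rewrite Nat.even_mul. Qed.

Lemma even_odd k : Nat.even (odd_var k) = false.
Proof. unfold odd_var. rewrite Nat.add_1_r, Nat.even_succ, <- Nat.negb_even, Nat.even_mul. reflexivity. Qed.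

(* The parameters outside the image of [iota] become variables of the diophantine condition. *)
Lemma generic_relative phi Pi alpha (iota iota' : nat -> nat) :
  (forall k, iota' (iota k) = k) -> generic phi ->
  Forall (letters_in dioph_letter) Pi ->
  solves (ap_psi phi) (fun k => pgen Pi (VZ (iota k))) alpha ->
  Exists (fun th => in_ncl dioph_letter Pi (zword (ren iota th))) (ap_theta phi).
Proof.
  intros Hio [[Hwf _] Hgen] HPi [Ha Hsol].
  (* The test detects the image of [iota]. Foreign parameters and old variables both become
     variables v, kept apart by parity, so that [mu] can undo the renaming. *)
  set (nu := fun v => match v with
    | VZ n => if Nat.eqb (iota (iota' n)) n then VZ (iota' n) else VV (even_var n)
    | VV n => VV (odd_var n)
    | _ => v end).
  set (mu := fun v => match v with
    | VZ k => VZ (iota k)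
    | VV n => if Nat.even n then VZ (Nat.div2 n) else VV (Nat.div2 n)
    | _ => v end).
  assert (Hmn : forall v, mu (nu v) = v).
  { intros [n|t n|t n|n]; simpl; try reflexivity.
    - destruct (Nat.eqb_spec (iota (iota' n)) n) as [e|e].
      + cbn [mu]. now rewrite e.
      + cbn [mu]. now rewrite even_even, div2_even.
    - now rewrite even_odd, div2_odd. }
  assert (Hnz : forall k, nu (VZ (iota k)) = VZ k).
  { intros k. simpl. now rewrite Hio, Nat.eqb_refl. }
  set (Pi' := map (ren nu) Pi).
  assert (HPi' : Forall (letters_in dioph_letter) Pi').
  { apply Forall_map. eapply Forall_impl; [|exact HPi]. intros s Hs.
    apply letters_ren with (1 := Hs).
    intros [n|t n|t n|n]; simpl; try tauto. now destruct (Nat.eqb _ _). }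
  destruct (presented_lift (S := Pi) (a := fun v => pgen Pi' (nu v))) as (h & Hh & Hw).
  { apply Forall_forall. intros s Hs. rewrite <- (eval_ren nu (pgen Pi')).
    apply eval_pgen_one, ncl_rel. now apply in_map. }
  assert (Hg : forall v, h (pgen Pi v) = pgen Pi' (nu v)).
  { intros v. specialize (Hw [(v, false)]). cbn [eval] in Hw. now rewrite !gmul1r in Hw. }
  specialize (Hgen Pi' (fun l i => ren nu (alpha l i)) HPi').
  rewrite (formal_solution_solves HPi' _ Hwf) in Hgen.
  assert (Hsol' : solves (ap_psi phi) (fun k => pgen Pi' (VZ k)) (fun l i => ren nu (alpha l i))).
  { split.
    - intros l i Hl. apply letters_ren with (1 := Ha l i Hl).
      intros [n|t n|t n|n]; simpl; try tauto. now destruct (Nat.eqb _ _).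
    - apply (holds_ext Hwf) with (2 := holds_hom Hh Hsol).
      intros [n|t n|t n|n] Hv; cbn [nenv].
      + rewrite Hg. now rewrite Hnz.
      + apply Hg.
      + rewrite Hw. symmetry. apply eval_ren.
      + destruct Hv. }
  eapply Exists_impl; [|exact (Hgen Hsol')]. intros th Hth.
  apply (@ncl_subst _ _ (fun v => [(mu v, false)]) _ dioph_letter) in Hth.
  - replace Pi with (map (subst (fun v => [(mu v, false)])) Pi').
    + rewrite zword_ren, ren_ren. rewrite zword_ren in Hth.
      change (subst (fun v => [(mu v, false)]) (ren VZ th)) with (ren mu (ren VZ th)) in Hth.
      now rewrite ren_ren in Hth.
    + unfold Pi'. rewrite map_map. rewrite <- map_id. apply map_ext. intros s.
      change (ren mu (ren nu s) = s). rewrite ren_ren. now apply ren_id.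
  - intros [n|t n|t n|n] Hv; simpl in Hv; try tauto; apply letters_single; simpl; auto.
    now destruct (Nat.even n).
Qed.

(** The bound involves only the two given systems, not the longer words of the combined one, so
    choosing r first is not circular. *)
Definition rank (psi1 psi2 : nfform) : nat :=
  2 + 6 * total_length (nf_sys psi1) + 6 * total_length (nf_sys psi2).

Definition combine_aps (phi1 phi2 : apsentence) : apsentence :=
  APS (map (ren even_var) (ap_theta phi1) ++ map (ren odd_var) (ap_theta phi2))
      (combine (rank (ap_psi phi1) (ap_psi phi2)) (ap_psi phi1) (ap_psi phi2)).

(** A formal solution of the combined sentence is a strategy in the free product over M x Z with
    generic parameters. The dichotomy turns it into a formal solution of one of the two sentences,
    and the genericity of that one yields the required word. *)
Lemma combine_aps_generic phi1 phi2 : generic phi1 -> generic phi2 -> generic (combine_aps phi1 phi2).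
Proof.
  intros G1 G2. pose proof G1 as [(W1 & N1 & T1) _]. pose proof G2 as [(W2 & N2 & T2) _].
  split.
  - split; [now apply combine_wf|split].
    + simpl. destruct (ap_theta phi1); [congruence|discriminate].
    + simpl. apply Forall_app. split; apply Forall_map.
      * eapply Forall_impl; [|exact T1]. intros th Hth H. apply Hth.
        apply free_trivial_ren with (2 := H) (1 := div2_even).
      * eapply Forall_impl; [|exact T2]. intros th Hth H. apply Hth.
        apply free_trivial_ren with (2 := H) (1 := div2_odd).
  - intros Pi alpha HPi Hsol. cbn [ap_psi combine_aps] in Hsol.
    apply (formal_solution_solves HPi) in Hsol; [|now apply combine_wf].
    set (M := presented Pi). set (C := prodg M Zgroup).
    set (emb := fun v => fpC ((pgen Pi v, 0%Z) : C)).
    assert (Hemb : is_hom (fun u : M => fpC ((u, 0%Z) : C))).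
    { intros u v. rewrite <- fpC_hom. reflexivity. }
    assert (Hsat : nf_sat (fp C) (combine (rank (ap_psi phi1) (ap_psi phi2)) (ap_psi phi1) (ap_psi phi2))
        (fun k => fpC ((pgen Pi (VZ k), 0%Z) : C))).
    { apply (@solves_sat Pi HPi _ _ _ (fp C) emb) with (2 := Hsol).
      - now apply combine_wf.
      - apply Forall_forall. intros s Hs. unfold emb.
        transitivity (fpC ((eval (pgen Pi) s, 0%Z) : C)); [symmetry; exact (eval_hom _ _ Hemb)|].
        replace (eval (pgen Pi) s) with (gone : M); [exact (hom_one Hemb)|].
        symmetry. apply eval_pgen_one. now apply ncl_rel.
      - intros h Hh Hv k. now apply (Hv (VZ k)). }
    (* Erasing the letters x and y respects [Pi] and fixes its parameters; this endomorphism of [M]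
       gives the coefficients images as required by [theta_dioph]. *)
    set (kw := fun v => match v with VV _ | VZ _ => [(v, false)] | _ => [] : word nvar end).
    destruct (presented_lift (S := Pi) (a := fun v => eval (pgen Pi) (kw v))) as (kill & Hkill & Hkw).
    { rewrite Forall_forall in *. intros s Hs. rewrite <- eval_subst.
      rewrite (subst_letters (HPi s Hs)); [apply eval_pgen_one; now apply ncl_rel|].
      intros [n|t n|t n|n] Hv; simpl in *; tauto. }
    assert (Hkz : forall k, kill (pgen Pi (VZ k)) = pgen Pi (VZ k)).
    { intros k. specialize (Hkw [(VZ k, false)]). cbn [eval kw] in Hkw. now rewrite !gmul1r in Hkw. }
    destruct (@combine_dichotomy Pi C (fun c => kill (fst c)) (fun k => (pgen Pi (VZ k), 0%Z)))
      with (7 := Hsat) as [[al Hal]|[al Hal]].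
    + intros u v. exact (Hkill (fst u) (fst v)).
    + apply prodZ_big.
    + intros [u n]. cbn [fst]. destruct (presented_word u) as [w <-]. exists (subst kw w).
      rewrite Hkw, eval_subst. split; [|reflexivity].
      apply letters_in_subst with (1 := letters_all w).
      intros [k|t k|t k|k] _; simpl; try constructor; try apply Forall_nil; exact I.
    + exact W1.
    + exact W2.
    + unfold rank. lia.
    + cbn [ap_theta combine_aps]. apply Exists_app. left. apply Exists_map.
      apply (generic_relative (alpha := al) div2_even G1 HPi).
      destruct Hal as [Ha1 Ha2]. split; [exact Ha1|].
      apply (holds_ext W1) with (2 := Ha2). intros [k|t k|t k|k] _; try reflexivity. apply Hkz.
    + cbn [ap_theta combine_aps]. apply Exists_app. right. apply Exists_map.
      apply (generic_relative (alpha := al) div2_odd G2 HPi).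
      destruct Hal as [Ha1 Ha2]. split; [exact Ha1|].
      apply (holds_ext W2) with (2 := Ha2). intros [k|t k|t k|k] _; try reflexivity. apply Hkz.
Qed.

Lemma mixed_lift (K E Q : group) (i : K -> E) (p : E -> Q) (zk : nat -> K) (zq : nat -> Q) :
  short_exact i p -> exists z : nat -> E,
    (forall k, i (zk k) = z (even_var k)) /\ (forall k, p (z (odd_var k)) = zq k).
Proof.
  intros (_ & _ & _ & Hsurj & _).
  assert (Hl : forall k, exists e, p e = zq k) by (intros; apply Hsurj).
  apply choice in Hl. destruct Hl as [l Hl].
  exists (fun n => if Nat.even n then i (zk (Nat.div2 n)) else l (Nat.div2 n)).
  split; intros k.
  - now rewrite even_even, div2_even.
  - now rewrite even_odd, div2_odd.
Qed.

Lemma generic_aps_extension : closed_under_extensions satisfies_generic_aps.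
Proof.
  intros K E Q i p Hse (phi1 & G1 & z1 & T1 & S1) (phi2 & G2 & z2 & T2 & S2).
  exists (combine_aps phi1 phi2). split; [now apply combine_aps_generic|].
  destruct (mixed_lift z1 z2 Hse) as (z & Hz1 & Hz2). exists z.
  pose proof Hse as (Hi & Hp & Hinj & _). split.
  - cbn [ap_theta combine_aps]. apply Forall_app. split; apply Forall_map.
    + eapply Forall_impl; [|exact T1]. intros th Hth H. apply Hth. apply Hinj.
      rewrite (eval_hom _ _ Hi), (hom_one Hi), <- H, eval_ren. now apply eval_eq.
    + eapply Forall_impl; [|exact T2]. intros th Hth H. apply Hth.
      apply (f_equal p) in H. rewrite (eval_hom _ _ Hp), (hom_one Hp), eval_ren in H.
      rewrite <- H. apply eval_eq. intros k. now rewrite Hz2.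
  - destruct G1 as [[W1 _] _], G2 as [[W2 _] _].
    apply (combine_sat (rank _ _) W1 W2 Hse (zk := z1)); [exact Hz1|exact S1|].
    replace (fun k => p (z (2 * k + 1))) with z2; [exact S2|].
    apply functional_extensionality. intros k. symmetry. apply Hz2.
Qed.

(** * Laws *)

Definition law_form (w : word nat) : nfform := NFForm 1 [[ren (VX 0) w]].

Lemma law_form_wf w : nf_wf (law_form w).
Proof.
  repeat constructor. apply letters_ren with (1 := letters_all w). simpl. lia.
Qed.

Lemma law_form_sat (G : group) w z : (forall a : nat -> G, eval a w = gone) -> nf_sat G (law_form w) z.
Proof.
  intros H f. exists (fun _ => gone). repeat constructor.
  rewrite eval_ren. apply H.
Qed.

(** The formula contains no y, so without relations its only equation says that [w] is trivial at
    free generators. *)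
Lemma law_form_solves Pi w zM alpha : Pi = [] -> solves (Pi := Pi) (law_form w) zM alpha -> free_trivial w.
Proof.
  intros -> [_ H]. apply Exists_cons in H. destruct H as [H|H]; [|now apply Exists_nil in H].
  apply Forall_inv in H. rewrite eval_ren in H.
  rewrite <- (eval_ren (VX 0) (pgen (@nil (word nvar)))) in H.
  apply eval_pgen_one, ncl_empty_trivial in H.
  apply free_trivial_ren with (2 := H) (g := fun v => match v with VX _ k => k | _ => 0 end).
  reflexivity.
Qed.

(** The combined law has one block of two levels, the run of the second law and the extra letters;
    parity keeps them apart. *)
Definition law_code (v : nvar) : nat :=
  match v with VX 0 c => even_var c | VX _ c => odd_var c | _ => 0 end.

Definition law_decode (n : nat) : nvar :=
  if Nat.even n then VX 0 (Nat.div2 n) else VX 1 (Nat.div2 n).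

Definition law_letter (v : nvar) : Prop := match v with VX l _ => l < 2 | _ => False end.

Lemma law_decode_code v : law_letter v -> law_decode (law_code v) = v.
Proof.
  unfold law_decode. destruct v as [k|[|[|l]] k|l k|k]; simpl law_letter; try lia; simpl law_code.
  - now rewrite even_even, div2_even.
  - now rewrite even_odd, div2_odd.
Qed.

Definition combined_law (r : nat) (w1 w2 : word nat) : word nvar :=
  subst (placed r (law_form w2)) (ren (VX 0) w1).

Lemma combined_law_letters r w1 w2 : letters_in law_letter (combined_law r w1 w2).
Proof.
  unfold combined_law. rewrite subst_ren. apply letters_in_subst with (1 := letters_all w1).
  intros i _. cbn [placed].
  apply letters_in_subst with (A := sletter (fun v => match v with VX 0 _ => True | _ => False end) (fun _ => True)).
  - apply letters_test_word. repeat constructor. apply letters_ren with (1 := letters_all w2). auto.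
  - intros [[k|[|t] k|t k|k]|k] Hv; simpl in Hv; try tauto; apply letters_single; simpl; lia.
Qed.

(** If the combined word were freely trivial, the combined sentence would hold in Z * Z, and the
    dichotomy over the empty condition would make one of the two given words trivial. *)
Lemma law_extension : closed_under_extensions satisfies_nontrivial_law.
Proof.
  intros K E Q i p Hse (w1 & N1 & L1) (w2 & N2 & L2).
  set (r := rank (law_form w1) (law_form w2)).
  set (W := combined_law r w1 w2).
  pose proof (combined_law_letters r w1 w2) as HW. fold W in HW.
  exists (ren law_code W). split.
  - intros Htriv.
    assert (HWt : free_trivial W).
    { apply (freq_subst (fun n => [(law_decode n, false)])) in Htriv.
      rewrite subst_ren in Htriv. rewrite (subst_letters HW) in Htriv; [exact Htriv|].
      intros v Hv. now rewrite law_decode_code. }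
    assert (Hsat : nf_sat (fp Zgroup) (combine r (law_form w1) (law_form w2)) (fun _ => fpC (0%Z : Zgroup))).
    { intros f. exists (fun _ => gone). intros f'. exists (fun _ => gone). repeat constructor.
      change (eval (nenv (fun _ => fpC (0%Z : Zgroup)) (upd (upd (fun _ _ => gone) 0 f) 1 f')
               (upd (upd (fun _ _ => gone) 0 (fun _ => gone)) 1 (fun _ => gone))) W = gone).
      now rewrite (eval_freq _ HWt). }
    destruct (@combine_dichotomy [] Zgroup (fun _ => gone) (fun _ => 0%Z)) with (7 := Hsat)
      as [[al Hal]|[al Hal]].
    + apply trivial_hom.
    + apply Zgroup_big.
    + intros _. exists []. split; [constructor|reflexivity].
    + apply law_form_wf.
    + apply law_form_wf.
    + unfold r, rank. lia.
    + apply N1. exact (law_form_solves eq_refl Hal).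
    + apply N2. exact (law_form_solves eq_refl Hal).
  - intros a.
    assert (Hsat : nf_sat E (combine r (law_form w1) (law_form w2)) (fun _ => gone)).
    { apply (combine_sat r (law_form_wf w1) (law_form_wf w2) Hse (zk := fun _ => gone)).
      - intros _. apply hom_one. apply Hse.
      - now apply law_form_sat.
      - now apply law_form_sat. }
    destruct (Hsat (fun c => a (even_var c))) as [g0 Hsat0].
    destruct (Hsat0 (fun c => a (odd_var c))) as [g1 Hsat1].
    apply Exists_cons in Hsat1. destruct Hsat1 as [H|H]; [|now apply Exists_nil in H].
    apply Forall_inv in H. rewrite <- H, eval_ren. apply eval_ext with (1 := HW).
    intros [k|[|[|l]] k|l k|k] Hv; simpl in Hv; try lia; reflexivity.
Qed.

(** * Prenex normal forms of positive formulas *)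

Section GameFacts.
Variable G : group.
Implicit Types xs ys : nat -> nat -> G.

Lemma agree_refl (T : Type) l (xs : nat -> T) : agree l xs xs.
Proof. intros l' _. reflexivity. Qed.

Lemma game_impl k l xs ys (W W' : (nat -> nat -> G) -> (nat -> nat -> G) -> Prop) :
  (forall xs' ys', agree l xs xs' -> agree l ys ys' -> W xs' ys' -> W' xs' ys') ->
  game k l xs ys W -> game k l xs ys W'.
Proof.
  revert l xs ys. induction k as [|k IH]; intros l xs ys H.
  - apply H; apply agree_refl.
  - intros Hg f. destruct (Hg f) as [g Hg']. exists g.
    apply IH with (2 := Hg'). intros xs' ys' Hx Hy. apply H; intros l' Hl'.
    + rewrite Hx by lia. apply upd_ne. lia.
    + rewrite Hy by lia. apply upd_ne. lia.
Qed.

Lemma game_const k l xs ys (A : Prop) : game k l xs ys (fun _ _ => A) <-> A.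
Proof.
  revert l xs ys. induction k as [|k IH]; intros l xs ys; [reflexivity|]. split.
  - intros H. destruct (H (fun _ => gone)) as [g Hg]. now apply IH in Hg.
  - intros H f. exists f. now apply IH.
Qed.

Lemma game_or_const k l xs ys (A : Prop) W :
  game k l xs ys (fun xs ys => A \/ W xs ys) -> A \/ game k l xs ys W.
Proof.
  intros H. destruct (classic A) as [HA|HA]; [now left|]. right.
  apply game_impl with (2 := H). intros; tauto.
Qed.

Definition dropl (d : nat) (xs : nat -> nat -> G) : nat -> nat -> G := fun l => xs (d + l).

Lemma dropl_upd d l xs f : dropl d (upd xs (d + l) f) = upd (dropl d xs) l f.
Proof.
  apply functional_extensionality. intros t. unfold dropl, upd.
  destruct (Nat.eqb_spec t l), (Nat.eqb_spec (d + t) (d + l)); try lia; reflexivity.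
Qed.

Lemma game_drop d k l xs ys W :
  game k (d + l) xs ys (fun xs ys => W (dropl d xs) (dropl d ys)) <->
  game k l (dropl d xs) (dropl d ys) W.
Proof.
  revert l xs ys. induction k as [|k IH]; intros l xs ys; [reflexivity|].
  simpl game. rewrite <- Nat.add_succ_r.
  split; intros H f; destruct (H f) as [g Hg]; exists g.
  - rewrite <- !dropl_upd. now apply IH.
  - apply IH. now rewrite !dropl_upd.
Qed.

Lemma nf_sat_any (psi : nfform) (z : nat -> G) xs ys : nf_wf psi ->
  game (nf_m psi) 0 xs ys (fun xs ys => holds (nf_sys psi) (nenv z xs ys)) <-> nf_sat G psi z.
Proof.
  intros Hwf. unfold nf_sat. rewrite <- qsat_game.
  split; apply qsat_indep; try exact Hwf; try lia; intros l Hl; lia.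
Qed.
End GameFacts.

Definition shift_levels (d : nat) (v : nvar) : nvar :=
  match v with VX l i => VX (d + l) i | VY l i => VY (d + l) i | _ => v end.

(* The parameter [n] becomes the variable [v] of a new outermost level. *)
Definition bind_level (n : nat) (v0 : nvar) (v : nvar) : nvar :=
  match v with
  | VZ k => if Nat.eqb k n then v0 else VZ k
  | _ => shift_levels 1 v
  end.

Definition ren_sys (f : nvar -> nvar) (sys : list (list (word nvar))) : list (list (word nvar)) :=
  map (map (ren f)) sys.

Definition conj_sys (s t : list (list (word nvar))) : list (list (word nvar)) :=
  flat_map (fun a => map (fun b => a ++ b) t) s.

(** A quantified variable takes index 0 of a level of its own, where the tuple of the other player
    is ignored. For a connective the two games are played one after the other on disjoint levels. *)
Fixpoint prenex (p : pform) : nfform :=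
  match p with
  | PEq w => NFForm 0 [[ren VZ w]]
  | PAnd p q => NFForm (nf_m (prenex p) + nf_m (prenex q))
      (conj_sys (nf_sys (prenex p)) (ren_sys (shift_levels (nf_m (prenex p))) (nf_sys (prenex q))))
  | POr p q => NFForm (nf_m (prenex p) + nf_m (prenex q))
      (nf_sys (prenex p) ++ ren_sys (shift_levels (nf_m (prenex p))) (nf_sys (prenex q)))
  | PAll n p => NFForm (S (nf_m (prenex p))) (ren_sys (bind_level n (VX 0 0)) (nf_sys (prenex p)))
  | PEx n p => NFForm (S (nf_m (prenex p))) (ren_sys (bind_level n (VY 0 0)) (nf_sys (prenex p)))
  end.

Lemma holds_ren_sys (G : group) f sys (e : nvar -> G) :
  holds (ren_sys f sys) e <-> holds sys (fun v => e (f v)).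
Proof.
  unfold holds, ren_sys. rewrite Exists_map.
  split; apply Exists_impl; intros s; rewrite Forall_map; apply Forall_impl; intros w;
    now rewrite eval_ren.
Qed.

Lemma holds_conj_sys (G : group) s t (e : nvar -> G) :
  holds (conj_sys s t) e <-> holds s e /\ holds t e.
Proof.
  unfold holds, conj_sys. rewrite !Exists_exists. split.
  - intros (u & Hu & H). apply in_flat_map in Hu. destruct Hu as (a & Ha & Hb).
    apply in_map_iff in Hb. destruct Hb as (b & <- & Hb). apply Forall_app in H. firstorder.
  - intros [(a & Ha & H) (b & Hb & H')]. exists (a ++ b). split; [|now apply Forall_app].
    apply in_flat_map. exists a. split; [exact Ha|]. now apply in_map.
Qed.

Lemma wf_ren_sys (A B : nvar -> Prop) f sys : (forall v, A v -> B (f v)) ->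
  Forall (Forall (letters_in A)) sys -> Forall (Forall (letters_in B)) (ren_sys f sys).
Proof.
  intros Hf H. apply Forall_map. eapply Forall_impl; [|exact H]. intros s Hs.
  apply Forall_map. eapply Forall_impl; [|exact Hs]. intros w Hw. now apply letters_ren with (1 := Hw).
Qed.

Lemma prenex_wf p : nf_wf (prenex p).
Proof.
  assert (Hmono : forall m m' sys, m <= m' -> Forall (Forall (letters_in (psi_letter m))) sys ->
            Forall (Forall (letters_in (psi_letter m'))) sys).
  { intros m m' sys Hm. apply Forall_impl. intros s. apply Forall_impl. intros w.
    apply letters_in_impl. intros [k|l i|l i|k]; simpl; lia || tauto. }
  unfold nf_wf. induction p as [w|p IHp q IHq|p IHp q IHq|n p IH|n p IH]; simpl.
  - repeat constructor. apply letters_ren with (1 := letters_all w). simpl. auto.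
  - apply (Hmono _ (nf_m (prenex p) + nf_m (prenex q))) in IHp; [|lia].
    apply wf_ren_sys with (f := shift_levels (nf_m (prenex p)))
      (B := psi_letter (nf_m (prenex p) + nf_m (prenex q))) in IHq.
    2:{ intros [k|l i|l i|k]; simpl; lia || tauto. }
    apply Forall_forall. intros u Hu. apply in_flat_map in Hu. destruct Hu as (a & Ha & Hb).
    apply in_map_iff in Hb. destruct Hb as (b & <- & Hb). rewrite Forall_forall in IHp, IHq.
    apply Forall_app. auto.
  - apply Forall_app. split; [apply Hmono with (2 := IHp); lia|].
    apply wf_ren_sys with (2 := IHq). intros [k|l i|l i|k]; simpl; lia || tauto.
  - apply wf_ren_sys with (2 := IH).
    intros [k|l i|l i|k]; simpl; try tauto; try lia. destruct (Nat.eqb k n); simpl; lia || tauto.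
  - apply wf_ren_sys with (2 := IH).
    intros [k|l i|l i|k]; simpl; try tauto; try lia. destruct (Nat.eqb k n); simpl; lia || tauto.
Qed.

Section Prenex.
Variable G : group.

Lemma holds_shift d sys (z : nat -> G) xs ys :
  holds (ren_sys (shift_levels d) sys) (nenv z xs ys) <->
  holds sys (nenv z (dropl d xs) (dropl d ys)).
Proof.
  rewrite holds_ren_sys.
  replace (fun v => nenv z xs ys (shift_levels d v)) with (nenv z (dropl d xs) (dropl d ys));
    [reflexivity|].
  apply functional_extensionality. now intros [k|l i|l i|k].
Qed.

Lemma holds_agree m sys (z : nat -> G) xs ys xs' ys' :
  Forall (Forall (letters_in (psi_letter m))) sys -> agree m xs xs' -> agree m ys ys' ->
  holds sys (nenv z xs' ys') <-> holds sys (nenv z xs ys).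
Proof.
  intros Hwf Hx Hy. split; apply (holds_ext Hwf); intros [k|l i|l i|k] Hv; simpl in *;
    try reflexivity; rewrite ?Hx, ?Hy by lia; reflexivity.
Qed.

Lemma game_shift (psi : nfform) (z : nat -> G) d xs ys : nf_wf psi ->
  game (nf_m psi) d xs ys (fun xs ys => holds (nf_sys psi) (nenv z (dropl d xs) (dropl d ys))) <->
  nf_sat G psi z.
Proof.
  intros Hwf. rewrite <- (Nat.add_0_r d) at 1.
  rewrite (game_drop d (nf_m psi) 0 xs ys (fun xs ys => holds (nf_sys psi) (nenv z xs ys))).
  apply nf_sat_any. exact Hwf.
Qed.

Lemma bind_sat psi n v0 (z : nat -> G) (xs ys : nat -> nat -> G) c : nf_wf psi ->
  (forall xs' ys', agree 1 xs xs' -> agree 1 ys ys' -> nenv z xs' ys' v0 = c) ->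
  game (nf_m psi) 1 xs ys (fun xs ys =>
    holds (ren_sys (bind_level n v0) (nf_sys psi)) (nenv z xs ys)) <->
  nf_sat G psi (upd z n c).
Proof.
  intros Hwf Hc. rewrite <- (game_shift (upd z n c) 1 xs ys Hwf).
  assert (E : forall xs' ys', agree 1 xs xs' -> agree 1 ys ys' ->
    (fun v => nenv z xs' ys' (bind_level n v0 v)) = nenv (upd z n c) (dropl 1 xs') (dropl 1 ys')).
  { intros xs' ys' Hx Hy. apply functional_extensionality. intros [k|l i|l i|k]; try reflexivity.
    cbn [bind_level nenv]. unfold upd. destruct (Nat.eqb k n); [now apply Hc|reflexivity]. }
  split; apply game_impl; intros xs' ys' Hx Hy; rewrite holds_ren_sys, E by assumption; auto.
Qed.

Lemma prenex_sat p (z : nat -> G) : psat z p <-> nf_sat G (prenex p) z.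
Proof.
  revert z. induction p as [w|p IHp q IHq|p IHp q IHq|n p IH|n p IH]; intros z.
  - simpl. unfold nf_sat. simpl. rewrite Exists_cons, Exists_nil, Forall_cons_iff, eval_ren.
    split; [intros H; left; split; [exact H|constructor]|]. now intros [[H _]|[]].
  - pose proof (prenex_wf p) as Wp. pose proof (prenex_wf q) as Wq.
    cbn [psat]. rewrite IHp, IHq. unfold nf_sat at 3. rewrite qsat_game. cbn [nf_m nf_sys prenex].
    rewrite game_add, Nat.add_0_r. split.
    + intros [Hp Hq]. apply (@nf_sat_any G (prenex p) z (fun _ _ => gone) (fun _ _ => gone) Wp) in Hp.
      apply game_impl with (2 := Hp). intros xs ys _ _ Hpxy.
      apply (game_shift z (nf_m (prenex p)) xs ys Wq) in Hq.
      apply game_impl with (2 := Hq). intros xs' ys' Hx Hy Hqxy.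
      apply holds_conj_sys. split; [|now apply holds_shift].
      now apply (holds_agree z Wp Hx Hy).
    + intros H. split.
      * apply (@nf_sat_any G (prenex p) z (fun _ _ => gone) (fun _ _ => gone) Wp).
        apply game_impl with (2 := H). intros xs ys _ _ H'.
        apply (@game_const G (nf_m (prenex q)) (nf_m (prenex p)) xs ys).
        apply game_impl with (2 := H'). intros xs' ys' Hx Hy Hh.
        apply holds_conj_sys in Hh. now apply (holds_agree z Wp Hx Hy).
      * apply (@game_const G (nf_m (prenex p)) 0 (fun _ _ => gone) (fun _ _ => gone)).
        apply game_impl with (2 := H). intros xs ys _ _ H'.
        apply (game_shift z (nf_m (prenex p)) xs ys Wq).
        apply game_impl with (2 := H'). intros xs' ys' _ _ Hh.
        apply holds_conj_sys in Hh. now apply holds_shift.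
  - pose proof (prenex_wf p) as Wp. pose proof (prenex_wf q) as Wq.
    cbn [psat]. rewrite IHp, IHq. unfold nf_sat at 3. rewrite qsat_game. cbn [nf_m nf_sys prenex].
    rewrite game_add, Nat.add_0_r. split.
    + intros [Hp|Hq].
      * apply (@nf_sat_any G (prenex p) z (fun _ _ => gone) (fun _ _ => gone) Wp) in Hp.
        apply game_impl with (2 := Hp). intros xs ys _ _ Hpxy.
        apply (@game_const G (nf_m (prenex q)) (nf_m (prenex p)) xs ys) in Hpxy.
        apply game_impl with (2 := Hpxy). intros xs' ys' Hx Hy Hh.
        apply Exists_app. left. now apply (holds_agree z Wp Hx Hy).
      * apply (@game_const G (nf_m (prenex p)) 0 (fun _ _ => gone) (fun _ _ => gone)) in Hq.
        apply game_impl with (2 := Hq). intros xs ys _ _ Hq'.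
        apply (game_shift z (nf_m (prenex p)) xs ys Wq) in Hq'.
        apply game_impl with (2 := Hq'). intros xs' ys' _ _ Hh.
        apply Exists_app. right. now apply holds_shift.
    (* While one game is played the other disjunct is constant, so classical logic pulls it out of
       the quantifiers. *)
    + intros H. apply or_comm.
      rewrite <- (@nf_sat_any G (prenex p) z (fun _ _ => gone) (fun _ _ => gone) Wp).
      apply game_or_const. apply game_impl with (2 := H). intros xs ys _ _ H'.
      apply or_comm. rewrite <- (game_shift z (nf_m (prenex p)) xs ys Wq).
      apply game_or_const. apply game_impl with (2 := H'). intros xs' ys' Hx Hy Hh.
      apply Exists_app in Hh. destruct Hh as [Hh|Hh].
      * left. now apply (holds_agree z Wp Hx Hy).
      * right. now apply holds_shift.
  - pose proof (prenex_wf p) as Wp. unfold nf_sat. rewrite qsat_game. cbn [psat nf_m nf_sys prenex game].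
    split.
    + intros H f. exists (fun _ => gone).
      apply (bind_sat n (c := f 0) Wp); [|now apply IH].
      intros xs' ys' Hx _. cbn [nenv]. now rewrite Hx, upd_eq by lia.
    + intros H c. apply IH. destruct (H (fun _ => c)) as [g Hg].
      apply (bind_sat n (c := c) Wp) in Hg; [exact Hg|].
      intros xs' ys' Hx _. cbn [nenv]. now rewrite Hx, upd_eq by lia.
  - pose proof (prenex_wf p) as Wp. unfold nf_sat. rewrite qsat_game. cbn [psat nf_m nf_sys prenex game].
    split.
    + intros [c Hc] f. exists (fun _ => c).
      apply (bind_sat n (c := c) Wp); [|now apply IH].
      intros xs' ys' _ Hy. cbn [nenv]. now rewrite Hy, upd_eq by lia.
    + intros H. destruct (H (fun _ => gone)) as [g Hg]. exists (g 0). apply IH.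
      apply (bind_sat n (c := g 0) Wp) in Hg; [exact Hg|].
      intros xs' ys' _ Hy. cbn [nenv]. now rewrite Hy, upd_eq by lia.
Qed.
End Prenex.

(** * Back from normal forms to positive sentences *)

Fixpoint all_block (c : nat -> nat) (n : nat) (p : pform) : pform :=
  match n with O => p | S n' => PAll (c n') (all_block c n' p) end.

Fixpoint ex_block (c : nat -> nat) (n : nat) (p : pform) : pform :=
  match n with O => p | S n' => PEx (c n') (ex_block c n' p) end.

Definition off {T : Type} (c : nat -> nat) (n : nat) (a a' : nat -> T) : Prop :=
  forall k, (forall i, i < n -> k <> c i) -> a' k = a k.

Lemma off_upd (T : Type) c n (a a' : nat -> T) :
  off c (S n) a a' <-> off c n (upd a (c n) (a' (c n))) a'.
Proof.
  split; intros H k Hk.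
  - unfold upd. destruct (Nat.eqb_spec k (c n)) as [->|Hne]; [reflexivity|].
    apply H. intros i Hi. destruct (Nat.eq_dec i n) as [->|]; [exact Hne|]. apply Hk. lia.
  - rewrite H by (intros i Hi; apply Hk; lia). apply upd_ne. apply Hk. lia.
Qed.

Lemma off_upd_S (T : Type) c n (a a' : nat -> T) g : off c n (upd a (c n) g) a' -> off c (S n) a a'.
Proof.
  intros H k Hk. rewrite H by (intros i Hi; apply Hk; lia). apply upd_ne. apply Hk. lia.
Qed.

Lemma psat_all_block (G : group) c n p (a : nat -> G) :
  psat a (all_block c n p) <-> forall a', off c n a a' -> psat a' p.
Proof.
  revert a. induction n as [|n IH]; intros a; simpl.
  - split; intros H.
    + intros a' Ha. replace a' with a; [exact H|]. apply functional_extensionality.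
      intros k. symmetry. apply Ha. lia.
    + apply H. intros k _. reflexivity.
  - split; intros H.
    + intros a' Ha. apply off_upd in Ha. exact (proj1 (IH _) (H (a' (c n))) a' Ha).
    + intros g. apply IH. intros a' Ha. apply H. now apply off_upd_S in Ha.
Qed.

Lemma psat_ex_block (G : group) c n p (a : nat -> G) :
  psat a (ex_block c n p) <-> exists a', off c n a a' /\ psat a' p.
Proof.
  revert a. induction n as [|n IH]; intros a; simpl.
  - split.
    + intros H. exists a. split; [intros k _; reflexivity|exact H].
    + intros (a' & Ha & H). replace a with a'; [exact H|]. apply functional_extensionality.
      intros k. apply Ha. lia.
  - split.
    + intros [g H]. apply IH in H. destruct H as (a' & Ha & H). exists a'.
      split; [now apply off_upd_S in Ha|exact H].
    + intros (a' & Ha & H). exists (a' (c n)). apply IH. exists a'.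
      split; [now apply off_upd|exact H].
Qed.

Definition xcode (l i : nat) : nat := even_var (pair l i).
Definition ycode (l i : nat) : nat := odd_var (pair l i).

Lemma pair_inj l i l' i' : pair l i = pair l' i' -> l = l' /\ i = i'.
Proof.
  intros H. apply (f_equal unpair) in H. rewrite !unpair_pair in H. now injection H.
Qed.

(** A sentence has no parameters, so the letters z are translated by the value 1. *)
Definition tr_letter (v : nvar) : word nat :=
  match v with
  | VX l i => [(xcode l i, false)]
  | VY l i => [(ycode l i, false)]
  | _ => []
  end.

Fixpoint big_and (s : list (word nvar)) : pform :=
  match s with
  | [] => PEq []
  | w :: s' => PAnd (PEq (subst tr_letter w)) (big_and s')
  end.

Fixpoint big_or (s : list (word nvar)) (sys : list (list (word nvar))) : pform :=
  match sys with
  | [] => big_and s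
  | s' :: sys' => POr (big_and s) (big_or s' sys')
  end.

(** The levels of [qsat] are infinite tuples, but the system mentions only finitely many indices;
    [N] bounds them. *)
Fixpoint blocks (N k l : nat) (p : pform) : pform :=
  match k with
  | O => p
  | S k' => all_block (xcode l) N (ex_block (ycode l) N (blocks N k' (S l) p))
  end.

Lemma psat_big_or (G : group) (a : nat -> G) s sys :
  psat a (big_or s sys) <-> holds (s :: sys) (fun v => eval a (tr_letter v)).
Proof.
  assert (Ha : forall s, psat a (big_and s) <-> Forall (fun w => eval (fun v => eval a (tr_letter v)) w = gone) s).
  { induction s0 as [|w s0 IH]; simpl; [split; constructor|].
    now rewrite Forall_cons_iff, IH, eval_subst. }
  unfold holds. revert s. induction sys as [|s' sys IH]; intros s; simpl.
  - rewrite Exists_cons, Exists_nil, Ha. tauto.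
  - rewrite Exists_cons, Ha, IH. reflexivity.
Qed.

Section Blocks.
Variables (G : group) (N : nat) (s : list (word nvar)) (sys : list (list (word nvar))) (m : nat).
Hypothesis Hwf : Forall (Forall (letters_in (fun v => psi_letter m v /\ index_lt N v))) (s :: sys).

Lemma psat_blocks k l (a : nat -> G) (xs ys : nat -> nat -> G) : k + l = m ->
  (forall l' i, l' < l -> i < N -> a (xcode l' i) = xs l' i /\ a (ycode l' i) = ys l' i) ->
  psat a (blocks N k l (big_or s sys)) <-> qsat (s :: sys) (fun _ => gone) k l xs ys.
Proof.
  revert l a xs ys. induction k as [|k IH]; intros l a xs ys Hk Ha.
  - simpl blocks. rewrite psat_big_or. cbn [qsat].
    split; apply (holds_ext Hwf); intros [v|t v|t v|v] [H1 H2]; simpl in *; try reflexivity;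
      rewrite ?gmul1r; try (symmetry; apply Ha; lia); apply Ha; lia.
  - cbn [blocks qsat]. rewrite psat_all_block.
    assert (Hstep : forall a' a'' f g, off (xcode l) N a a' -> off (ycode l) N a' a'' ->
      (forall i, i < N -> a' (xcode l i) = f i) -> (forall i, i < N -> a'' (ycode l i) = g i) ->
      psat a'' (blocks N k (S l) (big_or s sys)) <->
      qsat (s :: sys) (fun _ => gone) k (S l) (upd xs l f) (upd ys l g)).
    { intros a' a'' f g H1 H2 Hf Hg. apply IH; [lia|]. intros l' i Hl' Hi.
      assert (E2 : a'' (xcode l' i) = a' (xcode l' i)).
      { apply H2. intros j _. unfold xcode, ycode, even_var, odd_var. lia. }
      destruct (Nat.eq_dec l' l) as [->|Hne].
      - rewrite !upd_eq, E2. auto.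
      - rewrite !upd_ne, E2 by exact Hne. rewrite H1.
        2:{ intros j _ H. unfold xcode, even_var in H. assert (H' : pair l' i = pair l j) by lia.
            apply pair_inj in H'. lia. }
        rewrite H2.
        2:{ intros j _ H. unfold ycode, odd_var in H. assert (H' : pair l' i = pair l j) by lia.
            apply pair_inj in H'. lia. }
        rewrite H1.
        2:{ intros j _. unfold xcode, ycode, even_var, odd_var. lia. }
        apply Ha; lia. }
    assert (Hset : forall (c : nat -> nat) (a0 : nat -> G) (f : nat -> G),
      (forall i j, c i = c j -> i = j) ->
      exists a', off c N a0 a' /\ forall i, i < N -> a' (c i) = f i).
    { intros c a0 f Hc.
      exists (fun k => if excluded_middle_informative (exists i, i < N /\ k = c i)
        then f (epsilon (inhabits 0) (fun i => i < N /\ k = c i)) else a0 k). split.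
      - intros k' Hk'. destruct (excluded_middle_informative _) as [(i & Hi & E)|]; [|reflexivity].
        exfalso. exact (Hk' i Hi E).
      - intros i Hi. destruct (excluded_middle_informative _) as [Hex|Hno]; [|exfalso; eauto].
        apply (epsilon_spec (inhabits 0)) in Hex. destruct Hex as [_ E]. apply Hc in E.
        now rewrite <- E. }
    assert (Hxi : forall i j, xcode l i = xcode l j -> i = j).
    { intros i j H. unfold xcode, even_var in H. assert (H' : pair l i = pair l j) by lia.
      apply pair_inj in H'. tauto. }
    assert (Hyi : forall i j, ycode l i = ycode l j -> i = j).
    { intros i j H. unfold ycode, odd_var in H. assert (H' : pair l i = pair l j) by lia.
      apply pair_inj in H'. tauto. }
    split.
    + intros H f. destruct (Hset (xcode l) a f Hxi) as (a' & Ha' & Hf).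
      specialize (H a' Ha'). apply psat_ex_block in H. destruct H as (a'' & Ha'' & H).
      exists (fun i => a'' (ycode l i)). now apply (Hstep a' a'').
    + intros H a' Ha'. destruct (H (fun i => a' (xcode l i))) as [g Hg]. apply psat_ex_block.
      destruct (Hset (ycode l) a' g Hyi) as (a'' & Ha'' & Hg'). exists a''. split; [exact Ha''|].
      now apply (Hstep a' a'' (fun i => a' (xcode l i)) g).
Qed.
End Blocks.

Lemma pbound_mono p (B B' : nat -> Prop) : (forall k, B k -> B' k) -> pbound B p -> pbound B' p.
Proof.
  revert B B'. induction p as [w|p IHp q IHq|p IHp q IHq|n p IH|n p IH]; intros B B' H; simpl.
  - now apply letters_in_impl.
  - intros []; split; eauto.
  - intros []; split; eauto.
  - apply IH. intros k []; auto.
  - apply IH. intros k []; auto.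
Qed.

Lemma pbound_all_block c n p (B : nat -> Prop) :
  pbound (fun k => B k \/ exists i, i < n /\ k = c i) p -> pbound B (all_block c n p).
Proof.
  revert B. induction n as [|n IH]; intros B H; simpl.
  - apply pbound_mono with (2 := H). intros k [Hk|(i & Hi & _)]; [exact Hk|lia].
  - apply IH. apply pbound_mono with (2 := H). intros k [Hk|(i & Hi & Hk)]; [auto|].
    destruct (Nat.eq_dec i n) as [->|]; [auto|]. right. exists i. split; [lia|exact Hk].
Qed.

Lemma pbound_ex_block c n p (B : nat -> Prop) :
  pbound (fun k => B k \/ exists i, i < n /\ k = c i) p -> pbound B (ex_block c n p).
Proof.
  revert B. induction n as [|n IH]; intros B H; simpl.
  - apply pbound_mono with (2 := H). intros k [Hk|(i & Hi & _)]; [exact Hk|lia].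
  - apply IH. apply pbound_mono with (2 := H). intros k [Hk|(i & Hi & Hk)]; [auto|].
    destruct (Nat.eq_dec i n) as [->|]; [auto|]. right. exists i. split; [lia|exact Hk].
Qed.

Lemma pbound_big_or N m s sys (B : nat -> Prop) :
  Forall (Forall (letters_in (fun v => psi_letter m v /\ index_lt N v))) (s :: sys) ->
  (forall l i, l < m -> i < N -> B (xcode l i) /\ B (ycode l i)) -> pbound B (big_or s sys).
Proof.
  intros Hwf HB.
  assert (Ha : forall s, Forall (letters_in (fun v => psi_letter m v /\ index_lt N v)) s ->
            pbound B (big_and s)).
  { induction 1 as [|w s' Hw Hs IH]; simpl; [constructor|]. split; [|exact IH].
    apply letters_in_subst with (1 := Hw).
    intros [v|t v|t v|v] [H1 H2]; simpl in *; try constructor; try (now apply HB); constructor. }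
  revert s Hwf. induction sys as [|s' sys IH]; intros s Hwf; inversion Hwf; subst; simpl; auto.
Qed.

Lemma pbound_blocks N m s sys k l (B : nat -> Prop) : k + l = m ->
  Forall (Forall (letters_in (fun v => psi_letter m v /\ index_lt N v))) (s :: sys) ->
  (forall l' i, l' < l -> i < N -> B (xcode l' i) /\ B (ycode l' i)) ->
  pbound B (blocks N k l (big_or s sys)).
Proof.
  intros Hk Hwf. revert l B Hk. induction k as [|k IH]; intros l B Hk HB; simpl.
  - apply (pbound_big_or Hwf). intros l' i Hl'. apply HB. lia.
  - apply pbound_all_block, pbound_ex_block, IH; [lia|]. intros l' i Hl' Hi.
    destruct (Nat.eq_dec l' l) as [->|Hne].
    + split; [left|]; right; exists i; auto.
    + destruct (HB l' i) as [H1 H2]; [lia|exact Hi|]. auto.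
Qed.

(** The empty disjunction is excluded because it is false everywhere, whereas every positive
    sentence holds in the trivial group. *)
Lemma nf_sentence (psi : nfform) : nf_wf psi -> nf_sys psi <> [] ->
  exists p, psentence p /\ forall G : group, sat_sentence G p <-> nf_sat G psi (fun _ => gone).
Proof.
  intros Hwf Hne. destruct (index_bound (nf_sys psi)) as [N HN].
  assert (H : Forall (Forall (letters_in (fun v => psi_letter (nf_m psi) v /\ index_lt N v))) (nf_sys psi)).
  { unfold nf_wf in Hwf. rewrite Forall_forall in Hwf, HN. apply Forall_forall. intros s Hs.
    specialize (Hwf s Hs). specialize (HN s Hs).
    rewrite Forall_forall in Hwf, HN. apply Forall_forall. intros w Hw.
    specialize (Hwf w Hw). specialize (HN w Hw). unfold letters_in in *.
    now apply Forall_and. }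
  clear Hwf HN. unfold nf_sat. destruct (nf_sys psi) as [|s sys]; [congruence|].
  exists (blocks N (nf_m psi) 0 (big_or s sys)). split.
  - apply (pbound_blocks (m := nf_m psi)); [lia|exact H|intros; lia].
  - intros G. apply (psat_blocks H); [lia|]. intros; lia.
Qed.

(** * Positive theories *)

(** Positive formulas pass to homomorphic images: universal moves are lifted and the answers are
    pushed down. *)
Lemma nf_sat_surjective (F H : group) (h : F -> H) (psi : nfform) (z : nat -> F) :
  is_hom h -> (forall y, exists x, h x = y) ->
  nf_sat F psi z -> nf_sat H psi (fun k => h (z k)).
Proof.
  intros Hh Hs. unfold nf_sat.
  assert (Main : forall k l xs ys, qsat (nf_sys psi) z k l xs ys ->
    qsat (nf_sys psi) (fun i => h (z i)) k l (lmap h xs) (lmap h ys)).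
  { induction k as [|k IH]; intros l xs ys H1.
    - apply (holds_hom Hh) in H1. unfold holds in H1.
      eapply Exists_impl; [|exact H1]. intros s. apply Forall_impl. intros w <-.
      apply eval_eq. intros [v|t v|t v|v]; try reflexivity. symmetry. now apply hom_one.
    - intros f. assert (Hf : forall i, exists x, h x = f i) by (intros; apply Hs).
      apply choice in Hf. destruct Hf as [f' Hf]. destruct (H1 f') as [g Hg].
      exists (fun i => h (g i)). apply IH in Hg. rewrite !lmap_upd in Hg.
      replace (fun i => h (f' i)) with f in Hg; [exact Hg|].
      apply functional_extensionality. auto. }
  intros H1. apply Main in H1. unfold lmap in H1. rewrite (hom_one Hh) in H1. exact H1.
Qed.

Lemma gconj_fix (G : group) (g x : G) : gconj g x = x <-> gmul g x = gmul x g.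
Proof.
  unfold gconj. split; intros H.
  - rewrite <- H at 2. now gsimp.
  - rewrite gmulA, H. now gsimp.
Qed.

(* If all basis elements coincide, conjugation by a basis element, and then by any element,
   is an endomorphism fixing the basis. *)
Lemma free_two_generators (F : group) (X : Type) (b : X -> F) :
  free_on F b -> (exists g h : F, gmul g h <> gmul h g) -> exists x y : X, x <> y.
Proof.
  intros Hb (g & h & Hgh). apply NNPP. intros Hno.
  assert (Heq : forall x y : X, x = y).
  { intros x y. apply NNPP. intros Hxy. apply Hno. now exists x, y. }
  assert (Hfix : forall u, (forall x, gconj u (b x) = b x) -> forall v, gconj u v = v).
  { intros u Hu v. destruct (Hb F b) as (phi & _ & _ & Huniq).
    rewrite (Huniq (fun v => v)); [|intros ? ?; reflexivity|reflexivity].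
    apply (Huniq (gconj u)); [|exact Hu]. intros x y. unfold gconj. now gsimp. }
  assert (Hcomm : forall u v : F, gconj u v = v).
  { intros u. apply Hfix. intros x.
    assert (Hx : gconj (b x) u = u).
    { apply Hfix. intros y. rewrite (Heq y x). unfold gconj. now gsimp. }
    apply gconj_fix. symmetry. now apply gconj_fix. }
  apply Hgh. apply gconj_fix, Hcomm.
Qed.

(** Two different basis elements are sent to the generators of the two factors Z, and those generate
    Z * Z. *)
Lemma free_onto_fpZ (F : group) : nonabelian_free F ->
  exists h : F -> fp Zgroup, is_hom h /\ forall y, exists x, h x = y.
Proof.
  intros [(X & b & Hb) Hna]. destruct (free_two_generators Hb Hna) as (x0 & x1 & Hx).
  destruct (Hb (fp Zgroup) (fun x =>
    if excluded_middle_informative (x = x0) then fpC (1%Z : Zgroup)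
    else if excluded_middle_informative (x = x1) then fpB Zgroup 1 else gone))
    as (h & Hh & Hhb & _).
  exists h. split; [exact Hh|].
  pose proof (Hhb x0) as H0. pose proof (Hhb x1) as H1.
  destruct (excluded_middle_informative (x0 = x0)); [|congruence].
  destruct (excluded_middle_informative (x1 = x0)); [congruence|].
  destruct (excluded_middle_informative (x1 = x1)); [|congruence].
  set (im := fun y => exists x, h x = y).
  assert (Im1 : im gone) by (exists gone; now apply hom_one).
  assert (ImM : forall y y', im y -> im y' -> im (gmul y y')).
  { intros y y' [x <-] [x' <-]. exists (gmul x x'). apply Hh. }
  assert (ImV : forall y, im y -> im (ginv y)).
  { intros y [x <-]. exists (ginv x). now apply hom_inv. }
  assert (Hcyc : forall phi : Zgroup -> fp Zgroup, is_hom phi -> im (phi (1%Z)) -> forall n, im (phi n)).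
  { intros phi Hphi Hone.
    assert (Hnat : forall m, im (phi (Z.of_nat m))).
    { intros m. induction m as [|m IH]; [rewrite (hom_one Hphi : phi (Z.of_nat 0) = gone); exact Im1|].
      rewrite Nat2Z.inj_succ, <- Z.add_1_l. change (1 + Z.of_nat m)%Z with (@gmul Zgroup 1%Z (Z.of_nat m)).
      rewrite Hphi. now apply ImM. }
    intros m. destruct (Z_le_gt_dec 0 m) as [Hm|Hm].
    - rewrite <- (Z2Nat.id m) by exact Hm. apply Hnat.
    - replace m with (@ginv Zgroup (Z.of_nat (Z.to_nat (- m)))) by (simpl; lia).
      rewrite (hom_inv _ Hphi). apply ImV, Hnat. }
  apply fp_ind.
  - exact Im1.
  - intros c g Hg. apply ImM; [|exact Hg]. apply (Hcyc (fun c => fpC c)); [apply fpC_hom|].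
    now exists (b x0).
  - intros m g Hg. apply ImM; [|exact Hg].
    apply (Hcyc (fun m => fpB Zgroup m)); [|now exists (b x1)].
    intros u v. symmetry. apply fpB_add.
Qed.

(** If a non-abelian free group satisfied the combined sentence, so would its quotient Z * Z, and
    one of the two given sentences would have a formal solution without relations. Such a solution
    is a strategy in every group, in particular in that free group. *)
Lemma positive_theory_extension : closed_under_extensions nontrivial_positive_theory.
Proof.
  intros K E Q i p Hse (s & Hs & Ks & Fs) (t & Ht & Qt & Ft).
  pose proof (prenex_wf s) as Ws. pose proof (prenex_wf t) as Wt.
  set (r := rank (prenex s) (prenex t)).
  assert (HE : nf_sat E (combine r (prenex s) (prenex t)) (fun _ => gone)).
  { apply (combine_sat r Ws Wt Hse (zk := fun _ => gone)).
    - intros _. apply hom_one. apply Hse.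
    - now apply prenex_sat.
    - destruct Hse as (_ & Hp & _). rewrite (hom_one Hp). now apply prenex_sat. }
  destruct (nf_sentence (combine_wf r Ws Wt)) as (u & Hu & Hsat).
  (* The combined sentence holds in [E], so its disjunction is not empty. *)
  { intros H0.
    assert (HF : game (nf_m (combine r (prenex s) (prenex t))) 0 (fun _ _ => (gone : E)) (fun _ _ => gone)
              (fun _ _ => False)).
    { apply game_impl with (2 := proj1 (qsat_game _ _ _ _ _ _) HE). intros xs ys _ _ H.
      rewrite H0 in H. now apply Exists_nil in H. }
    now apply game_const in HF. }
  exists u. split; [exact Hu|split; [now apply Hsat|]].
  intros F HF HFu. apply Hsat in HFu.
  destruct (free_onto_fpZ HF) as (h & Hh & Hsurj).
  apply (nf_sat_surjective Hh Hsurj) in HFu. cbv beta in HFu.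
  replace (fun _ : nat => h gone) with (fun _ : nat => fpC (0%Z : Zgroup)) in HFu.
  2:{ apply functional_extensionality. intros _. rewrite (hom_one Hh). now apply fp_eq. }
  assert (Hback : forall psi alpha, nf_wf psi -> solves (Pi := []) psi (fun _ => gone) alpha ->
            nf_sat F psi (fun _ => gone)).
  { intros psi alpha Hwf Hal. apply (@solves_sat [] (Forall_nil _) psi (fun _ => gone) alpha F (fun _ => gone));
      [exact Hwf|exact Hal|constructor|]. intros h' Hh' _ _. now apply hom_one. }
  destruct (@combine_dichotomy [] Zgroup (fun _ => gone) (fun _ => 0%Z)) with (7 := HFu)
    as [[al Hal]|[al Hal]].
  - apply trivial_hom.
  - apply Zgroup_big.
  - intros _. exists []. split; [constructor|reflexivity].
  - exact Ws.
  - exact Wt.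
  - unfold r, rank. lia.
  - apply (Fs F HF). apply prenex_sat. exact (Hback _ _ Ws Hal).
  - apply (Ft F HF). apply prenex_sat. exact (Hback _ _ Wt Hal).
Qed.

Theorem theoremG :
  closed_under_extensions satisfies_generic_aps /\
  closed_under_extensions nontrivial_positive_theory /\
  closed_under_extensions satisfies_nontrivial_law.
Proof.
  split; [exact generic_aps_extension|].
  split; [exact positive_theory_extension|exact law_extension].
Qed.
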